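(* Let $N_A,N_B,N_C\ge 3$ be fixed integers (independent of $\beta$) with $N_A+N_B+N_C=2N+1$, and let $M=\min\{N_A,N_B,N_C\}$. Then there are strictly positive numbers $r(i,j)$, $i,j\in\Lambda_N$, $i\ne j$, such that, as $\beta\uparrow\infty$, the speeded up process $\{\eta_0(e^{M\beta}t):t\ge0\}$ converges (in law) to the Markov process on $\Omega^N_0$ which jumps from $\omega_i$ to $\omega_j$ at rate $r(i,j)$.
   Context: $\Lambda_N=\{-N,\dots,N\}$ is the discrete ring with $2N+1$ sites (indices modulo $2N+1$). $\Omega^N$ is the set of $\omega:\Lambda_N\to\{A,B,C\}$ with exactly $N_\alpha$ sites of type $\alpha$ for each $\alpha$. $\sigma^{i,j}\omega$ is obtained from $\omega$ by exchanging the particles at sites $i$ and $j$. ABC process: $\{\eta(t):t\ge 0\}$ (depending on $\beta$) is the continuous-time Markov chain on $\Omega^N$ with generator $(L_\beta f)(\omega)=\sum_{k\in\Lambda_N}c_k^\beta(\omega)[f(\sigma^{k,k+1}\omega)-f(\omega)]$, where $c^\beta_k(\omega)=e^{-\beta}$ if $(\omega(k),\omega(k+1))\in\{(A,B),(B,C),(C,A)\}$ and $c^\beta_k(\omega)=1$ otherwise. Segregated configurations: $\omega_0(j)=A$ for $0\le j\le N_A-1$, $\omega_0(j)=B$ for $N_A\le j\le N_A+N_B-1$ (indices modulo $2N+1$), $\omega_0(j)=C$ otherwise; $\omega_k=\Theta^k\omega_0$ with $(\Theta^k\omega)(i)=\omega(i-k)$; $\Omega^N_0=\{\omega_k:k\in\Lambda_N\}$.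 Trace process: with $\mathcal T_t=\int_0^t\mathbf 1\{\eta(s)\in\Omega^N_0\}ds$ and $\mathcal S_t=\sup\{s\ge0:\mathcal T_s\le t\}$, the trace of $\eta$ on $\Omega^N_0$ is $\eta_0(t)=\eta(\mathcal S_t)$. It is a Markov chain on $\Omega_0^N$. The convergence is convergence in law in the Skorohod space $D([0,\infty),\Omega^N_0)$, for the processes started from a common fixed configuration of $\Omega^N_0$. *)

(* Defs.v *)
From HB Require Import structures.
From mathcomp Require Import all_boot all_order all_algebra all_fingroup.
From mathcomp Require Import all_classical all_reals all_analysis.

Set Implicit Arguments.
Unset Strict Implicit.
Unset Printing Implicit Defensive.

Import Order.TTheory GRing.Theory Num.Theory.
Import numFieldNormedType.Exports.

Local Open Scope classical_set_scope.
Local Open Scope ring_scope.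

Section MarkovChain.
Context {R : realType} {E : finType}.

(* [p t x y] is the probability of going from [x] to [y] in time [t]. The last
   clause says that the infinitesimal generator of the semigroup
   [(P_t f) x = \sum_y p t x y * f y] is [L]. *)
Definition transition_function (L : (E -> R) -> E -> R)
    (p : R -> E -> E -> R) : Prop :=
  [/\ forall t x y, 0 <= t -> 0 <= p t x y,
      forall t x, 0 <= t -> \sum_y p t x y = 1,
      forall x y, p 0 x y = (x == y)%:R,
      forall s t x y, 0 <= s -> 0 <= t ->
        p (s + t) x y = \sum_z p s x z * p t z y
    & forall f x,
        h^-1 * (\sum_y p h x y * f y - f x) @[h --> 0^'+] --> L f x].

(* Right-continuous paths with left limits, for the discrete topology on [E].
   Time is [0, +oo[: the values of a path at negative times are irrelevant. *)
Definition cadlag (x : R -> E) : Prop :=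
  (forall t, 0 <= t -> \forall s \near t^'+, x s = x t) /\
  (forall t, 0 < t -> exists e, \forall s \near t^'-, x s = e).

(* [X w] is the path of the chain with generator [L] started from [x0]. *)
Definition markov_chain d (W : measurableType d) (P : probability W R)
    (L : (E -> R) -> E -> R) (x0 : E) (X : W -> R -> E) : Prop :=
  [/\ forall t e, 0 <= t -> measurable [set w | X w t = e],
      forall w, cadlag (X w)
    & exists2 p, transition_function L p &
      forall (n : nat) (t : nat -> R) (x : nat -> E),
        t 0%N = 0 -> (forall i, t i <= t i.+1) ->
        P [set w | forall i, (i <= n)%N -> X w (t i) = x i] =
        ((x 0%N == x0)%:R *
         \prod_(i < n) p (t i.+1 - t i) (x i) (x i.+1))%:E].

End MarkovChain.

Section Skorohod.
Context {R : realType} {E : finType}.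

Definition time_change (l : R -> R) : Prop :=
  set_bij `[0, +oo[ `[0, +oo[ l /\
  (forall s t, 0 <= s -> s < t -> l s < l t).

(* Convergence of sequences in the (metrizable) Skorohod topology of
   D([0, +oo[, E). For the 0/1 distance on [E], uniform convergence on [0, T]
   of [u n \o l n] to [x] is equality on [0, T] for [n] large enough. *)
Definition skorohod_cvg (u : nat -> R -> E) (x : R -> E) : Prop :=
  exists l : nat -> R -> R,
    [/\ forall n, time_change (l n),
        forall e, 0 < e ->
          \forall n \near \oo, forall s, 0 <= s -> `|l n s - s| <= e
      & forall T, \forall n \near \oo,
          forall s, 0 <= s <= T -> u n (l n s) = x s].

Definition skorohod_continuous (F : (R -> E) -> R) : Prop :=
  forall (u : nat -> R -> E) (x : R -> E),
    (forall n, cadlag (u n)) -> cadlag x -> skorohod_cvg u x ->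
    F (u n) @[n --> \oo] --> F x.

(* The values of [F] outside of the Skorohod space are arbitrary; any bounded
   function on the Skorohod space has a bounded extension. *)
Definition cvg_in_law (d : R -> measure_display)
    (W : forall b, measurableType (d b)) (P : forall b, probability (W b) R)
    (X : forall b, W b -> R -> E)
    d' (W' : measurableType d') (P' : probability W' R) (Y : W' -> R -> E)
    : Prop :=
  forall F : (R -> E) -> R,
    (exists C, forall x, `|F x| <= C) -> skorohod_continuous F ->
    \int[P b]_w F (X b w) @[b --> +oo] --> \int[P']_w F (Y w).

End Skorohod.

Section Trace.
Context {R : realType} {E : finType} (S : {set E}).
Local Notation mu := (@lebesgue_measure R).

Definition time_spent (x : R -> E) (t : R) : R :=
  \int[mu]_(s in `[0, t]) (x s \in S)%:R.

Definition trace_time (x : R -> E) (t : R) : R :=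
  sup [set s | 0 <= s /\ time_spent x s <= t].

(* A right-continuous path that spends an infinite time in [S] is in [S] at all
   times [trace_time x t]. The default value [e0] is only used for paths which
   spend a finite time in [S]. *)
Definition trace_path (e0 : {e : E | e \in S}) (x : R -> E) (t : R)
  : {e : E | e \in S} := insubd e0 (x (trace_time x t)).

End Trace.

(* From here on, [set _ | _] denotes finite sets. *)
Local Close Scope classical_set_scope.

Inductive species := A | B | C.

Definition species_ord (a : species) : 'I_3 :=
  match a with
  | A => Ordinal (isT : 0 < 3)%N
  | B => Ordinal (isT : 1 < 3)%N
  | C => Ordinal (isT : 2 < 3)%N
  end.
Definition ord_species (i : 'I_3) : species :=
  match val i with 0%N => A | 1%N => B | _ => C end.
Lemma species_ordK : cancel species_ord ord_species.
Proof. by case. Qed.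
HB.instance Definition _ := Finite.copy species (can_type species_ordK).

(* The ring of integers modulo 2N+1; the site -i of {-N, ..., N}, 0 < i, is
   represented by 2N+1-i. Subtraction of sites is modulo 2N+1. *)
Notation site N := 'I_(N.*2).+1.

Definition next_site N (k : site N) : site N := ordS k.

Section ABC.
Context {N : nat} {K : species -> nat}.

Definition has_counts (w : {ffun site N -> species}) : bool :=
  [forall a, #|[set i | w i == a]| == K a].

Local Notation config := {w : {ffun site N -> species} | has_counts w}.

Definition exchange_fun (i j : site N) (w : {ffun site N -> species}) :=
  [ffun k => w (tperm i j k)].

Lemma exchange_subproof i j (w : config) :
  has_counts (exchange_fun i j (val w)).
Proof.
apply/forallP => a; have /forallP/(_ a)/eqP <- := valP w; apply/eqP.
rewrite -[RHS](card_imset _ (@perm_inj _ (tperm i j))); apply: eq_card => k.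
rewrite inE ffunE; apply/idP/imsetP => [wk|[l]].
  by exists (tperm i j k); rewrite ?tpermK // inE.
by rewrite inE => wl ->; rewrite tpermK.
Qed.

Definition exchange (i j : site N) (w : config) : config :=
  Sub (exchange_fun i j (val w)) (exchange_subproof i j w).

Definition slow_pair (a b : species) : bool :=
  (a, b) \in [:: (A, B); (B, C); (C, A)].

Definition jump_rate {R : realType} (b : R) (k : site N) (w : config) : R :=
  if slow_pair (val w k) (val w (next_site k)) then expR (- b) else 1.

Definition abc_generator {R : realType} (b : R) (f : config -> R) (w : config)
    : R :=
  \sum_(k : site N) jump_rate b k w * (f (exchange k (next_site k) w) - f w).

Definition segregated_fun (k : site N) : {ffun site N -> species} :=
  [ffun i : site N => let j := nat_of_ord (i - k) in
   if (j < K A)%N then A else if (j < K A + K B)%N then B else C].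

Lemma segregated_subproof (hK : (K A + K B + K C)%N = (N.*2).+1) k :
  has_counts (segregated_fun k).
Proof.
have cnt (P : pred nat) : #|[set i : site N | P (nat_of_ord (i - k)%R)]| =
    count P (iota 0 (K A + (K B + K C))).
  rewrite addnA hK -val_enum_ord count_map cardsE -sum1_card.
  rewrite (reindex_inj (addIr k)) -sum1_count big_enum_cond.
  by apply: eq_bigl => i; rewrite -[in RHS](addrK k i).
apply/forallP => a; rewrite (eq_card (B := [set i : site N |
    (if (nat_of_ord (i - k)%R < K A)%N then A
     else if (nat_of_ord (i - k)%R < K A + K B)%N then B else C) == a])); last first.
  by move=> i; rewrite !inE ffunE.
rewrite (cnt (fun j => (if (j < K A)%N then A
     else if (j < K A + K B)%N then B else C) == a)).
rewrite !iotaD !count_cat !add0n.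
have e1 : {in iota 0 (K A), forall j, (if (j < K A)%N then A
     else if (j < K A + K B)%N then B else C) = A}.
  by move=> j; rewrite mem_iota add0n => /andP[_ ->].
have e2 : {in iota (K A) (K B), forall j, (if (j < K A)%N then A
     else if (j < K A + K B)%N then B else C) = B}.
  by move=> j; rewrite mem_iota => /andP[le lt]; rewrite ltnNge le lt.
have e3 : {in iota (K A + K B) (K C), forall j, (if (j < K A)%N then A
     else if (j < K A + K B)%N then B else C) = C}.
  move=> j; rewrite mem_iota => /andP[le _]; rewrite (ltnNge _ (_ + _)) le.
  by rewrite ltnNge (leq_trans (leq_addr _ _) le).
rewrite (eq_in_count (a2 := fun=> A == a)); last by move=> j /e1 ->.
rewrite (eq_in_count (a2 := fun=> B == a) (s := iota (K A) _)); last first.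
  by move=> j /e2 ->.
rewrite (eq_in_count (a2 := fun=> C == a) (s := iota (K A + _) _)); last first.
  by move=> j /e3 ->.
have cst (c : bool) s : count (fun=> c) s = (c * size s)%N.
  by case: c; rewrite ?count_predT ?count_pred0 ?mul1n.
rewrite !cst !size_iota; apply/eqP.
by case: a; rewrite /= ?mul1n ?mul0n ?addn0 ?add0n.
Qed.

Context (hK : (K A + K B + K C)%N = (N.*2).+1).

Definition segregated (k : site N) : config :=
  Sub (segregated_fun k) (segregated_subproof hK k).

Definition segregated_set : {set config} := [set segregated k | k : site N].

Local Notation seg_config := {w : config | w \in segregated_set}.

Lemma segregated_in k : segregated k \in segregated_set.
Proof. exact: imset_f. Qed.

Definition seg_state (k : site N) : seg_config :=
  Sub (segregated k) (segregated_in k).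

(* The outer sum runs over the indices of the state [x]. *)
Definition seg_generator {R : realType} (r : site N -> site N -> R)
    (f : seg_config -> R) (x : seg_config) : R :=
  \sum_(i | seg_state i == x)
    \sum_(j | j != i) r i j * (f (seg_state j) - f x).

End ABC.

Notation config N K := {w : {ffun site N -> species} | @has_counts N K w}.

(* Main.v *)
Require Import Defs.
From HB Require Import structures.
From mathcomp Require Import all_boot all_order all_algebra all_fingroup.
From mathcomp Require Import all_classical all_reals all_analysis.
From mathcomp Require Import measurable_realfun.
From mathcomp Require Import ring lra zify.

Set Implicit Arguments.
Unset Strict Implicit.
Unset Printing Implicit Defensive.

Import Order.TTheory GRing.Theory Num.Theory.
Import numFieldNormedType.Exports.

Local Open Scope ring_scope.

(** The trace of the chain on the segregated configurations is a finite Markov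
    chain whose jump rates have order [exp (- M b)]. Two independent facts give
    the theorem: the rates, multiplied by [exp (M b)], converge to positive
    limits [r i j]; and convergence of rates implies convergence in law for the
    Skorohod topology, although the trace process is defined path by path
    through the inverse of an occupation time.

    Rates. Let [H b x j] be the probability that the chain started at [x]
    enters the segregated set at [j]. It is [gen]-harmonic off the segregated
    set, and the trace jumps from [w_i] to [w_j] at rate [gen (H b ^~ w_j)
    w_i]. Solving for [H] by eliminating one configuration at a time only uses
    sums, products and quotients of jump rates, so this rate is a [power_law]:
    zero or asymptotic to [l exp (- k b)] with [l > 0]
    (harmonic_extension_exists). Hence only its order of magnitude matters
    (power_law_limit). Upper bound (valley_escape): the measure [exp (- b V)],
    where the energy [V] counts the steps by which particles are displaced, is
    reversible for the swaps inside a valley of depth [M] around [w_i]; summing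
    the harmonicity equations over the valley leaves only its boundary, where
    the weight is at most [exp (- M b)]. Lower bound (escape_lower): if [Y] is
    a smallest species, moving one particle through the [Y] block costs [K Y]
    slow swaps, and the resulting configuration can reach every segregated one
    along swaps that are as fast as any other swap available at that moment.

    From rates to laws. Observe the chain at the times [i c / 4^n] and keep the
    observations in the segregated set: this is a discrete Markov chain with
    kernel [I + h L + o(h)], [h = c / 4^n], where [L] is the generator of the
    trace (trace_chain_markov, trace_kernel_near). The limit process observed
    at the times [i / 4^n] is a Markov chain with kernel [I + h' G + o(h')],
    [h' = 1 / 4^n]. As [c L -> G], paths of length of order [4^n] of the two
    chains are close in total variation, uniformly in [n] (path_exp_tv). As [n]
    grows the first chain determines the path of the trace, because occupation
    times are limits of Riemann sums (visits_limit, trace_approx_ae).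

    It remains to pass from these paths to a bounded Skorohod-continuous [F],
    which need not be measurable. [F] is replaced by its supremum over all
    paths that have the same values on a grid and change at most once in each
    cell of the grid. This envelope is a function of finitely many values; it
    bounds [F] from above along the discrete approximations (sandwich), and it
    tends to [F] when the mesh tends to 0, because two paths that agree on a
    fine grid and change at most once per cell are Skorohod-close
    (close_skorohod_cvg, envelope_gap). Applying this to [F] and [- F] gives
    law_approximation. *)

(** * Functions asymptotic to an exponential *)

Section PowerLaw.
Local Open Scope classical_set_scope.
Local Open Scope ring_scope.
Context {R : realType}.
Implicit Types (f g : R -> R).

(** The alternative [f = 0] is included because some of the coefficients met
    during the elimination of states vanish identically. *)
Definition power_law (f : R -> R) : Prop :=
  (forall b, f b = 0) \/
  exists k l : R, 0 < l /\ f b * expR (k * b) @[b --> +oo] --> l.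

Lemma power_law_ext f g : f =1 g -> power_law f -> power_law g.
Proof. by move=> /funext ->. Qed.

Lemma power_law0 : power_law (fun=> 0).
Proof. by left. Qed.

Lemma power_law_cst (c : R) : 0 <= c -> power_law (fun=> c).
Proof.
rewrite le_eqVlt => /predU1P[<-|c0]; first exact: power_law0.
right; exists 0, c; split => //.
rewrite [X in X @ _](_ : _ = fun=> c); first exact: cvg_cst.
by apply/funext => b; rewrite mul0r expR0 mulr1.
Qed.

Lemma power_law_expR (k : R) : power_law (fun b => expR (k * b)).
Proof.
right; exists (- k), 1; split => //.
rewrite [X in X @ _](_ : _ = fun=> 1); first exact: cvg_cst.
by apply/funext => b; rewrite -expRD mulNr subrr expR0.
Qed.

Lemma expRN_cvg0 (k : R) : 0 < k -> expR (- k * b) @[b --> +oo] --> 0.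
Proof.
move=> k0; apply/cvgrPdist_lt => e e0.
exists (- ln e / k); split; first exact: num_real.
move=> b; rewrite ltr_pdivrMr// => lb.
rewrite sub0r normrN ger0_norm ?expR_ge0//.
rewrite -[ltRHS](lnK (x := e)) ?posrE// ltr_expR mulNr ltrNl.
by rewrite mulrC.
Qed.

Lemma power_lawM f g : power_law f -> power_law g -> power_law (f \* g).
Proof.
move=> [f0 _|[k [l [l0 fl]]]]; first by left => b /=; rewrite f0 mul0r.
move=> [g0|[k' [l' [l0' gl]]]]; first by left => b /=; rewrite g0 mulr0.
right; exists (k + k'), (l * l'); split; first exact: mulr_gt0.
rewrite [X in X @ _](_ : _ = fun b => f b * expR (k * b) * (g b * expR (k' * b))).
  exact: cvgM.
by apply/funext => b /=; rewrite mulrDl expRD mulrACA.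
Qed.

(** The inverse of the zero function is the zero function, so no case has to be
    excluded. *)
Lemma power_lawV f : power_law f -> power_law (fun b => (f b)^-1).
Proof.
move=> [f0|[k [l [l0 fl]]]]; first by left => b; rewrite f0 invr0.
right; exists (- k), l^-1; split; first by rewrite invr_gt0.
rewrite [X in X @ _](_ : _ = fun b => (f b * expR (k * b))^-1).
  by apply: cvgV => //; rewrite gt_eqF.
by apply/funext => b; rewrite invfM mulNr expRN.
Qed.

Let power_lawD_wlog f g (k l k' l' : R) : k <= k' -> 0 < l -> 0 < l' ->
  f b * expR (k * b) @[b --> +oo] --> l ->
  g b * expR (k' * b) @[b --> +oo] --> l' -> power_law (f \+ g).
Proof.
rewrite le_eqVlt => /predU1P[<- l0 l0' fl gl|kk' l0 l0' fl gl].
  right; exists k, (l + l'); split; first exact: addr_gt0.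
  rewrite [X in X @ _](_ : _ = fun b => f b * expR (k * b) + g b * expR (k * b)).
    exact: cvgD.
  by apply/funext => b /=; rewrite mulrDl.
right; exists k, l; split => //.
rewrite [X in X @ _](_ : _ = fun b => f b * expR (k * b) +
    g b * expR (k' * b) * expR (- (k' - k) * b)).
  have -> : l = l + l' * 0 by rewrite mulr0 addr0.
  apply: cvgD => //.
  by apply: cvgM => //; apply: expRN_cvg0; rewrite subr_gt0.
apply/funext => b /=; rewrite mulrDl -(mulrA (g b)) -expRD.
by congr (_ + _ * expR _); ring.
Qed.

(** Closure under sums uses the positivity of the leading coefficients: the
    dominant terms cannot cancel. For this reason differences never appear
    below. *)
Lemma power_lawD f g : power_law f -> power_law g -> power_law (f \+ g).
Proof.
move=> [f0 gP|[k [l [l0 fl]]]].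
  by apply: power_law_ext gP => b /=; rewrite f0 add0r.
move=> [g0|[k' [l' [l0' gl]]]].
  apply: (@power_law_ext f) => [b /=|]; first by rewrite g0 addr0.
  by right; exists k, l.
have [kk|/ltW kk] := leP k k'; first exact: power_lawD_wlog kk l0 l0' fl gl.
apply: (@power_law_ext (g \+ f)) => [b /=|]; first by rewrite addrC.
exact: power_lawD_wlog kk l0' l0 gl fl.
Qed.

Lemma power_law_sum (I : Type) (s : seq I) (P : pred I) (F : I -> R -> R) :
  (forall i, P i -> power_law (F i)) ->
  power_law (fun b => \sum_(i <- s | P i) F i b).
Proof.
move=> FP; elim: s => [|i s IH].
  by apply: power_law_ext power_law0 => b; rewrite big_nil.
case: (boolP (P i)) => Pi.
  apply: (power_law_ext (f := F i \+ (fun b => \sum_(j <- s | P j) F j b))).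
    by move=> b; rewrite big_cons Pi.
  by apply: power_lawD => //; apply: FP.
by apply: power_law_ext IH => b; rewrite big_cons (negbTE Pi).
Qed.

(** Any exponent but [k] would contradict one of the two bounds as [b] tends to
    infinity, so a power law is determined up to its coefficient by crude
    bounds. *)
Lemma power_law_limit f (k c C : R) : power_law f -> 0 < c ->
  (forall b, 0 <= b -> c * expR (- k * b) <= f b <= C * expR (- k * b)) ->
  exists2 l : R, 0 < l & expR (k * b) * f b @[b --> +oo] --> l.
Proof.
move=> fP c0 fb.
have fb' b : 0 <= b -> c <= f b * expR (k * b) <= C.
  move=> /fb /andP[h1 h2].
  have e1 : expR (- k * b) * expR (k * b) = 1.
    by rewrite -expRD mulNr addNr expR0.
  have e0 := expR_ge0 (k * b).
  have := ler_wpM2r e0 h1; have := ler_wpM2r e0 h2.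
  by rewrite -!mulrA e1 !mulr1 => -> ->.
case: fP => [f0|[k' [l [l0 fl]]]].
  by have := fb' 0 (lexx 0); rewrite f0 mul0r => /andP[]; rewrite leNgt c0.
have near0 : \forall b \near +oo, 0 <= b :> R by exact: nbhs_pinfty_ge.
have kk' : k' = k; last first.
  by rewrite kk' in fl; exists l => //; under eq_fun do rewrite mulrC.
apply/eqP; rewrite eq_le; apply/andP; split; rewrite leNgt; apply/negP => kk.
- (* f would be smaller than the lower bound *)
  have : f b * expR (k * b) @[b --> +oo] --> l * 0.
    rewrite [X in X @ _](_ : _ = fun b => f b * expR (k' * b) * expR (- (k' - k) * b)).
      by apply: cvgM => //; apply: expRN_cvg0; rewrite subr_gt0.
    by apply/funext => b; rewrite -mulrA -expRD; congr (_ * expR _); ring.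
  rewrite mulr0 => /cvgrPdist_lt/(_ c c0) h.
  have [b [/fb' /andP[h1 _]]] : exists b : R, 0 <= b /\ `|0 - f b * expR (k * b)| < c.
    by apply: (@filter_ex _ (pinfty_nbhs R)); apply: filterI.
  by rewrite sub0r normrN => h2; have := le_lt_trans (ler_norm _) h2; rewrite ltNge h1.
- have : f b * expR (k' * b) @[b --> +oo] --> 0.
    have C0 : 0 < C.
      by have /andP[h1 h2] := fb' 0 (lexx _); apply: lt_le_trans (le_trans h1 h2).
    apply: (@squeeze_cvgr _ _ _ _ (fun=> 0) (fun b => C * expR (- (k - k') * b))).
    + apply: filterS near0 => b b0; have /andP[h1 h2] := fb' _ b0.
      have -> : f b * expR (k' * b) = f b * expR (k * b) * expR (- (k - k') * b).
        by rewrite -mulrA -expRD; congr (_ * expR _); ring.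
      by rewrite ler_wpM2r ?expR_ge0// mulr_ge0 ?expR_ge0// (le_trans (ltW c0)).
    + exact: cvg_cst.
    + rewrite -[X in _ --> X](mulr0 C); apply: cvgM; first exact: cvg_cst.
      by apply: expRN_cvg0; rewrite subr_gt0.
  move=> g0; have l00 : l = 0 by exact: (cvg_unique _ fl g0).
  by move: l0; rewrite l00 ltxx.
Qed.

End PowerLaw.

(** * Hitting probabilities and their dependence on the temperature *)

Section Generator.
Context {R : realType} {E I : finType}.
Implicit Types (c : I -> E -> R) (s : I -> E -> E) (f : E -> R).

(** Generator of the chain that moves from [x] to [s i x] at rate [c i x].
    Moves with [s i x = x] are allowed. *)
Definition gen s c f (x : E) : R := \sum_i c i x * (f (s i x) - f x).

Lemma generator_lin s c (J : finType) (a : J -> R) (F : J -> E -> R) x :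
  gen s c (fun y => \sum_j a j * F j y) x = \sum_j a j * gen s c (F j) x.
Proof.
rewrite /gen; under [RHS]eq_bigr do rewrite mulr_sumr.
rewrite exchange_big; apply: eq_bigr => i _; rewrite -sumrB mulr_sumr.
by apply: eq_bigr => j _; ring.
Qed.

Lemma generatorD s c f g x : gen s c (f \+ g) x = gen s c f x + gen s c g x.
Proof. by rewrite /gen -big_split; apply: eq_bigr => i _ /=; ring. Qed.

Lemma generatorZ s c (a : R) f x : gen s c (fun y => a * f y) x = a * gen s c f x.
Proof. by rewrite /gen mulr_sumr; apply: eq_bigr => i _ /=; ring. Qed.

Lemma generator_cst s c (a : R) x : gen s c (fun=> a) x = 0.
Proof. by rewrite /gen big1// => i _; rewrite subrr mulr0. Qed.

(** Maximum principle: at a maximum of [f] no term of the generator is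
    positive, so the sum can only be nonnegative if all terms vanish. *)
Lemma gen_max_stable s c f x : (forall i, 0 < c i x) ->
  (forall y, f y <= f x) -> 0 <= gen s c f x -> forall i, f (s i x) = f x.
Proof.
move=> c0 fx g0 i; apply/eqP; rewrite eq_le fx /= leNgt; apply/negP => lt.
move: g0; rewrite leNgt => /negP; apply; rewrite /gen (bigD1 i)//=.
rewrite -[ltRHS]addr0 ltr_leD//; first by rewrite nmulr_llt0 // subr_lt0.
by apply: sumr_le0 => j _; rewrite mulr_ge0_le0 ?subr_le0// ltW.
Qed.

(** Stated through closed sets of states rather than paths: this is the form in
    which a set where a function is maximal contradicts it. *)
Definition reachable_set s (S : {set E}) : Prop :=
  forall D : {set E}, (exists x, x \in D) ->
    (forall x i, x \in D -> s i x \in D) -> exists2 x, x \in D & x \in S.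

(** [H b x j] is the probability that the chain with rates [c b] started at [x]
    enters [S] at [j], and [phi] is a Lyapunov function: its mean decreases at
    speed at least 1 off [S], as the expected time to reach [S] does. Only an
    inequality is kept for [phi], since it serves as a supersolution in
    comparison arguments. *)
Record harmonic_extension s (c : R -> I -> E -> R) (S : {set E})
    (H : R -> E -> E -> R) (phi : R -> E -> R) : Prop := HarmonicExtension {
  hext_power : forall x j, power_law (fun b => H b x j);
  hext_ge0 : forall b x j, 0 <= H b x j;
  hext_in : forall b x j, x \in S -> H b x j = (x == j)%:R;
  hext_out : forall b x j, j \notin S -> H b x j = 0;
  hext_sum : forall b x, \sum_j H b x j = 1;
  hext_harm : forall b x j, x \notin S -> gen s (c b) (H b ^~ j) x = 0;
  hext_phi_ge0 : forall b x, 0 <= phi b x;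
  hext_phi : forall b x, x \notin S -> gen s (c b) (phi b) x <= - 1 }.

(** By induction on the number of states off [S]: a state [x0] is first added
    to [S] and then eliminated. If [w j] is the rate at which the chain that
    starts at [x0] enters [S] at [j] before its return to [x0], then the
    entrance law from [x0] is [w j / sum w], which distributes the mass that
    [H'] puts on [x0].

    The power law property passes through this formula because [w j] is itself
    a sum of products of rates with values of [H'], with no subtraction. The
    sum of the [w j] is positive since otherwise [H' _ x0] would be equal to 1
    on a set of states closed under the moves and disjoint from [S]. *)
Lemma harmonic_extension_exists s (c : R -> I -> E -> R) (S : {set E}) :
  (forall b i x, 0 < c b i x) ->
  (forall i x, power_law (fun b => c b i x)) ->
  reachable_set s S ->
  exists H phi, harmonic_extension s c S H phi.
Proof.
move=> c0 cP; have [m] := ubnP #|~: S|.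
elim: m S => // m IH S; rewrite ltnS => Sm mS.
have [S0|[x0]] := set_0Vmem (~: S).
  have inS x : x \in S by move/setP/(_ x): S0; rewrite !inE => /negbFE.
  exists (fun _ x j => (x == j)%:R), (fun _ _ => 0); split => //=.
  - by move=> x j; apply: power_law_cst; rewrite ler0n.
  - by move=> _ x j; rewrite inS.
  - by move=> _ x; rewrite (bigD1 x)//= eqxx big1 ?addr0// => j /negbTE; rewrite eq_sym => ->.
  - by move=> b x j; rewrite inS.
  - by move=> b x; rewrite inS.
(* x0 is the state that is going to be eliminated *)
rewrite inE => x0S; pose S' := x0 |: S.
have [H' [phi' [P1 P2 P3 P4 P5 P6 P7 P8]]] : exists H phi, harmonic_extension s c S' H phi.
  apply: IH; last first.
    by move=> D D0 /mS -/(_ D0) [x xD xS]; exists x => //; rewrite !inE xS orbT.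
  apply: leq_trans Sm; apply: proper_card; apply/properP; split.
    by apply/fintype.subsetP => x; rewrite !inE negb_or => /andP[].
  by exists x0; rewrite !inE ?eqxx.
have x0S' : x0 \in S' by rewrite !inE eqxx.
pose w b j := if j == x0 then 0 else gen s (c b) (H' b ^~ j) x0.
have wx0 b : w b x0 = 0 by rewrite /w eqxx.
have wE b j : j != x0 -> w b j = \sum_i c b i x0 * H' b (s i x0) j.
  move=> jx; rewrite /w (negbTE jx); apply: eq_bigr => i _.
  by rewrite (P3 _ x0) // eq_sym (negbTE jx) subr0.
have w0 b j : 0 <= w b j.
  have [->|jx] := eqVneq j x0; first by rewrite /w eqxx.
  by rewrite wE//; apply: sumr_ge0 => i _; rewrite mulr_ge0// ltW.
have wP j : power_law (w ^~ j).
  have [->|jx] := eqVneq j x0.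
    by apply: power_law_ext power_law0 => b; rewrite /w eqxx.
  apply: (@power_law_ext _ (fun b => \sum_i c b i x0 * H' b (s i x0) j)).
    by move=> b; rewrite wE.
  by apply: power_law_sum => i _; apply: power_lawM.
pose W b := \sum_j w b j.
have gW b : gen s (c b) (H' b ^~ x0) x0 = - W b.
  have : \sum_j gen s (c b) (H' b ^~ j) x0 = 0.
    have := generator_lin s (c b) (fun=> 1) (fun j => H' b ^~ j) x0.
    under [in RHS]eq_bigr do rewrite mul1r.
    move=> <-; rewrite -[RHS](generator_cst s (c b) 1 x0); congr gen.
    by apply/funext => y; under eq_bigr do rewrite mul1r; rewrite P5.
  rewrite (bigD1 x0)//= => /eqP; rewrite addr_eq0 => /eqP ->; congr (- _).
  rewrite /W [RHS](bigD1 x0)//= wx0 add0r; apply: eq_bigr => j jx.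
  by rewrite /w (negbTE jx).
have H'1 b x j : H' b x j <= 1.
  by rewrite -(P5 b x) (bigD1 j)//= lerDl sumr_ge0.
have W0 b : 0 < W b.
  rewrite lt_neqAle (sumr_ge0 _ (fun j _ => w0 b j)) andbT eq_sym.
  apply/eqP => Wb.
  (* the states from which the chain enters S' at x0 almost surely *)
  pose D := [set x | H' b x x0 == 1].
  (* D is closed under the moves, hence meets S, where H' _ x0 is 0 *)
  have [||x] := mS D.
  - by exists x0; rewrite inE P3// eqxx.
  - move=> x i; rewrite !inE => /eqP Hx.
    suff -> : H' b (s i x) x0 = H' b x x0 by rewrite Hx.
    apply: (@gen_max_stable s (c b) (H' b ^~ x0)) => //.
      by move=> y /=; rewrite Hx.
    have [xS'|xS'] := boolP (x \in S'); last by rewrite P6.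
    have -> : x = x0.
      apply/eqP; move: Hx; rewrite P3//; case: eqP => // _ /eqP.
      by rewrite eq_sym oner_eq0.
    by rewrite gW Wb oppr0.
  - rewrite inE => /eqP Hx xS; have xS' : x \in S' by rewrite !inE xS orbT.
    move: Hx; rewrite P3//; case: eqP => [xx|_ /eqP].
      by rewrite -xx xS in x0S.
    by rewrite eq_sym oner_eq0.
(* an entrance at x0 is followed by the entrance law of S from x0 *)
pose H b x j := if j == x0 then 0 else H' b x j + (w b j / W b) * H' b x x0.
(* the multiple of H' _ x0 compensates for the value of gen phi' at x0 *)
exists H, (fun b => phi' b \+ (fun x => ((`|gen s (c b) (phi' b) x0| + 1) / W b) * H' b x x0)).
have x0x x : x \in S -> x == x0 = false by apply: contraTF => /eqP ->.
split => /=.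
- move=> x j; rewrite /H; case: eqP => // _; first exact: power_law0.
  apply: power_lawD => //; apply: power_lawM => //; apply: power_lawM => //.
  by apply: power_lawV; exact: power_law_sum.
- move=> b x j; rewrite /H; case: eqP => // _.
  by rewrite addr_ge0// mulr_ge0// divr_ge0// ltW.
- move=> b x j xS; have xS' : x \in S' by rewrite !inE xS orbT.
  rewrite /H !P3//; case: eqP => [->|_]; rewrite x0x//.
  by rewrite mulr0 addr0.
- move=> b x j jS; rewrite /H; case: eqP => // /eqP jx.
  have jS' : j \notin S' by rewrite !inE negb_or jx.
  rewrite P4// /w (negbTE jx).
  rewrite (_ : gen _ _ _ _ = 0) ?mul0r ?addr0//.
  rewrite -[RHS](generator_cst s (c b) 0 x0); congr gen.
  by apply/funext => y; rewrite P4.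
- move=> b x; rewrite -[RHS](P5 b x) (bigD1 x0)//= [RHS](bigD1 x0)//=.
  rewrite {1}/H eqxx add0r.
  rewrite (eq_bigr (fun j => H' b x j + (w b j / W b) * H' b x x0)); last first.
    by move=> j /negbTE jx; rewrite /H jx.
  rewrite big_split/= addrC; congr (_ + _).
  rewrite -mulr_suml -mulr_suml -[RHS]mul1r; congr (_ * _).
  rewrite -[RHS](divff (lt0r_neq0 (W0 b))); congr (_ / _).
  by rewrite /W [RHS](bigD1 x0)//= wx0 add0r.
- move=> b x j xS; have [->|jx] := eqVneq j x0.
    by rewrite -[RHS](generator_cst s (c b) 0 x); congr gen; apply/funext => y; rewrite /H eqxx.
  rewrite (_ : (H b)^~ j = (H' b ^~ j) \+ (fun y => (w b j / W b) * H' b y x0)); last first.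
    by apply/funext => y; rewrite /H (negbTE jx).
  rewrite generatorD generatorZ; have [->|xx0] := eqVneq x x0.
    by rewrite gW /w (negbTE jx) mulrN divfK ?subrr// lt0r_neq0.
  by rewrite !P6 ?mulr0 ?addr0// !inE negb_or xx0.
- by move=> b x; rewrite addr_ge0// mulr_ge0// divr_ge0// ?addr_ge0// ltW.
- move=> b x xS; rewrite generatorD generatorZ; have [->|xx0] := eqVneq x x0.
    rewrite gW mulrN divfK ?lt0r_neq0//.
    by have := ler_norm (gen s (c b) (phi' b) x0); lra.
  by rewrite (P6 _ x) ?mulr0 ?addr0 ?P8// !inE negb_or xx0.
Qed.

End Generator.

(** * Species, sites, swaps and blocks *)

Section Species.
Definition succ_species (a : species) : species :=
  match a with A => B | B => C | C => A end.
Notation nx := succ_species.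

Lemma slow_pairE a b : slow_pair a b = (b == nx a).
Proof. by case: a; case: b. Qed.

Lemma succ_species3 a : nx (nx (nx a)) = a.
Proof. by case: a. Qed.

Lemma succ_species_neq a : nx a != a.
Proof. by case: a. Qed.

Lemma succ_species2_neq a : nx (nx a) != a.
Proof. by case: a. Qed.

Lemma species_eqE a b : (a == b) =
  match a, b with A, A | B, B | C, C => true | _, _ => false end.
Proof. by case: a; case: b. Qed.

Variant species_spec (x : species) : species -> Prop :=
  | SpeciesSame : species_spec x x
  | SpeciesNext : species_spec x (nx x)
  | SpeciesPrev : species_spec x (nx (nx x)).

Lemma speciesP x y : species_spec x y.
Proof. by case: x; case: y; constructor. Qed.

End Species.
Notation nx := succ_species.

Section Sites.
Context {N : nat}.
Local Notation n := (N.*2).+1.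
Implicit Types p k : site N.

Definition dist_from k p : nat := nat_of_ord (p - k).
Definition site_at k (m : nat) : site N := k + inZp m.

Lemma dist_site_at k m : dist_from k (site_at k m) = (m %% n)%N.
Proof. by rewrite /dist_from /site_at addrC addKr. Qed.

Lemma site_at_dist k p : site_at k (dist_from k p) = p.
Proof.
by rewrite /site_at /dist_from valZpK addrC subrK.
Qed.

Lemma site_at0 k : site_at k 0 = k.
Proof. by have := site_at_dist k k; rewrite {1}/dist_from subrr. Qed.

Lemma dist_lt k p : (dist_from k p < n)%N.
Proof. exact: ltn_ord. Qed.

Lemma next_site_at k m : next_site (site_at k m) = site_at k m.+1.
Proof.
apply: val_inj => /=; rewrite modnDmr -[in LHS]addn1 modnDml addn1 modnDmr.
by rewrite addnS.
Qed.

Lemma dist_next k p : dist_from k (next_site p) = ((dist_from k p).+1 %% n)%N.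
Proof. by rewrite -[in LHS](site_at_dist k p) next_site_at dist_site_at. Qed.

Lemma site_atD k m l : site_at (site_at k m) l = site_at k (m + l).
Proof.
rewrite /site_at -addrA; congr (_ + _); apply: val_inj => /=.
by rewrite modnDm.
Qed.

Lemma site_at_mod k m : site_at k (m %% n) = site_at k m.
Proof. by rewrite /site_at; congr (_ + _); apply: val_inj; rewrite /= modn_mod. Qed.

Lemma site_atn k : site_at k n = k.
Proof. by rewrite -site_at_mod modnn site_at0. Qed.

Lemma site_at_inj k m l : (m < n)%N -> (l < n)%N -> site_at k m = site_at k l -> m = l.
Proof.
by move=> mn ln /(congr1 (dist_from k)); rewrite !dist_site_at !modn_small.
Qed.

End Sites.

Section Config.
Context {N : nat} {K : species -> nat}.
Local Notation n := (N.*2).+1.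
Local Notation config := {w : {ffun site N -> species} | @has_counts N K w}.
Hypothesis hK : (K A + K B + K C)%N = n.
Hypothesis K0 : forall a, (0 < K a)%N.
Implicit Types (p k : site N) (x : config).

Definition at_site x p : species := val x p.

Definition swap k x : config := exchange k (next_site k) x.

Lemma at_exchange i j x p : at_site (exchange i j x) p = at_site x (tperm i j p).
Proof. by rewrite /at_site /= ffunE. Qed.

Lemma exchangeK i j : involutive (@exchange N K i j).
Proof.
by move=> x; apply: val_inj; apply/ffunP => p; rewrite /= !ffunE tpermK.
Qed.

Lemma config_eqP x y : (forall p, at_site x p = at_site y p) -> x = y.
Proof. by move=> e; apply: val_inj; apply/ffunP => p; exact: e. Qed.

Lemma config_count x a : #|[set p | at_site x p == a]| = K a.
Proof. by have /forallP/(_ a)/eqP := valP x. Qed.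

(** Conjugating a transposition by a nearest-neighbour one moves an endpoint to
    the next site, so every transposition is a product of swaps of neighbours. *)
Lemma swap_closed_exchange (D : {set config}) :
  (forall x k, x \in D -> swap k x \in D) ->
  forall i j x, x \in D -> exchange i j x \in D.
Proof.
move=> cD; pose r i j := forall x, x \in D -> exchange i j x \in D.
have rxx i : r i i.
  move=> x xD; rewrite (_ : exchange i i x = x)//.
  by apply: config_eqP => p; rewrite at_exchange tperm1 perm1.
have rtr i j k : r i j -> r j k -> r i k.
  have [->//|ij] := eqVneq i j; have [->//|jk] := eqVneq j k.
  have [->//|ik] := eqVneq i k.
  move=> rij rjk x xD.
  rewrite (_ : exchange i k x = exchange i j (exchange j k (exchange i j x))).
    exact/rij/rjk/rij.
  apply: config_eqP => p; rewrite !at_exchange; congr at_site.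
  have -> : tperm i k = (tperm j k ^ tperm i j)%g.
    by rewrite tpermJ tpermR tpermD // 1?eq_sym.
  by rewrite conjgE tpermV !permM.
have rn i m : r i (site_at i m).
  elim: m => [|m IH].
    by rewrite -{1}(site_at_dist i i) /dist_from subrr; exact: rxx.
  by apply: (rtr _ _ _ IH) => x xD; rewrite -next_site_at; exact: cD.
by move=> i j; rewrite -(site_at_dist i j); exact: rn.
Qed.

(** If [x] differs from [y] at [p], counting the particles of species [y p]
    gives a site [q] where [x] has this species and [y] has not; exchanging [p]
    and [q] removes the disagreement at [p] and creates none. *)
Lemma swap_closed_full (D : {set config}) x y :
  (forall x k, x \in D -> swap k x \in D) -> x \in D -> y \in D.
Proof.
move=> /swap_closed_exchange cD; have [m] := ubnP #|[set p | at_site x p != at_site y p]|.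
elim: m x => // m IH x; rewrite ltnS => xm xD.
have [/eqP e|[p]] := set_0Vmem [set p | at_site x p != at_site y p].
  rewrite (_ : y = x)//; apply: config_eqP => p.
  by move/eqP/setP/(_ p): e; rewrite !inE => /negbFE/eqP ->.
rewrite inE => xyp.
pose a := at_site y p.
have [q] : exists q, (at_site x q == a) && (at_site y q != a).
  apply/existsP; apply: contraT; rewrite negb_exists => /forallP h.
  have : [set q | at_site x q == a] \proper [set q | at_site y q == a].
    apply/properP; split.
      by apply/fintype.subsetP => q; rewrite !inE => xq; have := h q; rewrite xq/= negbK.
    by exists p; rewrite !inE ?eqxx// /a.
  by move/proper_card; rewrite !config_count ltnn.
move=> /andP[/eqP xq yq].
apply: (IH (exchange p q x)); last exact: cD.
apply: leq_trans xm; apply: proper_card; apply/properP; split.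
  apply/fintype.subsetP => l; rewrite !inE at_exchange.
  case: tpermP => [->|->|_ _]; last by [].
  - by rewrite xq eqxx.
  - by move=> _; rewrite xq eq_sym.
by exists p; rewrite !inE // at_exchange tpermL xq eqxx.
Qed.

(** The species that the segregated configuration of index [k] has at [p]. *)
Definition block k p : species := segregated_fun (K := K) k p.
Definition block_start (a : species) : nat :=
  match a with A => 0%N | B => K A | C => (K A + K B)%N end.
Definition block_rel k p : nat := (dist_from k p - block_start (block k p))%N.

Lemma blockE k p : block k p = (if (dist_from k p < K A)%N then A
  else if (dist_from k p < K A + K B)%N then B else C).
Proof. by rewrite /block ffunE. Qed.

Lemma dist_block k p : dist_from k p = (block_start (block k p) + block_rel k p)%N.
Proof. by rewrite /block_rel blockE; case: ltnP => //= h1; last case: ltnP => //= h2; lia. Qed.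

Lemma block_rel_lt k p : (block_rel k p < K (block k p))%N.
Proof.
have := dist_lt k p; rewrite -hK /block_rel blockE => dn.
by case: (ltnP (dist_from k p) (K A)) => /= h1; last case: (ltnP (dist_from k p) (K A + K B)) => /= h3; lia.
Qed.

Lemma block_rel_inj k p q : block k p = block k q -> block_rel k p = block_rel k q -> p = q.
Proof.
move=> e1 e2; rewrite -(site_at_dist k p) -(site_at_dist k q).
by rewrite !dist_block e1 e2.
Qed.

Lemma block_next k p : ((block_rel k p).+1 < K (block k p))%N ->
  block k (next_site p) = block k p /\ block_rel k (next_site p) = (block_rel k p).+1.
Proof.
move=> h; have dn := dist_lt k p; have := block_rel_lt k (next_site p).
have := dist_block k (next_site p); have := dist_block k p; move: h.
rewrite dist_next !blockE dist_next -hK in dn *.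
move: (dist_from k p) (block_rel k p) (block_rel k (next_site p)) dn => d r r' dn.
have a0 := K0 A; have b0 := K0 B; have c0 := K0 C.
have [e|e] := eqVneq d.+1 (K A + K B + K C)%N.
  rewrite (_ : (d.+1 %% _ = 0)%N); last by rewrite e modnn.
  case: (ltnP d (K A)) => h1 /=; first by lia.
  by case: (ltnP d (K A + K B)) => h2 /=; lia.
rewrite modn_small; last by lia.
case: (ltnP d (K A)) => h1 /=.
  by move=> h h2; rewrite (_ : (d.+1 < K A)%N = true) /=; [split => //; lia|lia].
case: (ltnP d (K A + K B)) => h2 /= h h3; rewrite (_ : (d.+1 < K A)%N = false) /=; try lia.
  by rewrite (_ : (d.+1 < K A + K B)%N = true) /=; [split => //; lia|lia].
by rewrite (_ : (d.+1 < K A + K B)%N = false) /=; [split => //; lia|lia].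
Qed.

Lemma block_next_last k p : (block_rel k p).+1 = K (block k p) ->
  block k (next_site p) = nx (block k p) /\ block_rel k (next_site p) = 0%N.
Proof.
move=> h; have dn := dist_lt k p; have := block_rel_lt k (next_site p).
have := dist_block k (next_site p); have := dist_block k p; move: h.
rewrite dist_next !blockE dist_next -hK in dn *.
move: (dist_from k p) (block_rel k p) (block_rel k (next_site p)) dn => d r r' dn.
have a0 := K0 A; have b0 := K0 B; have c0 := K0 C.
have [e|e] := eqVneq d.+1 (K A + K B + K C)%N.
  rewrite (_ : (d.+1 %% _ = 0)%N) ?a0 /=; last by rewrite e modnn.
  case: (ltnP d (K A)) => h1 /=; first by lia.
  by case: (ltnP d (K A + K B)) => h2 /=; [lia|split => //; lia].
rewrite modn_small; last by lia.
case: (ltnP d (K A)) => h1 /= h h3.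
  rewrite (_ : (d.+1 < K A)%N = false) /=; last by lia.
  by rewrite (_ : (d.+1 < K A + K B)%N = true) /=; [split => //; lia|lia].
move: h h3; case: (ltnP d (K A + K B)) => h2 /= h h3; last by lia.
rewrite (_ : (d.+1 < K A)%N = false) /=; last by lia.
by rewrite (_ : (d.+1 < K A + K B)%N = false) /=; [split => //; lia|lia].
Qed.

Lemma at_segregated k p : at_site (segregated hK k) p = block k p.
Proof. by []. Qed.

Lemma card_block k a : #|[set p | block k p == a]| = K a.
Proof. exact: (config_count (segregated hK k)). Qed.

Lemma block_nextP k p :
  (((block_rel k p).+1 < K (block k p))%N /\
    (block k (next_site p) = block k p /\ block_rel k (next_site p) = (block_rel k p).+1)) \/
  ((block_rel k p).+1 = K (block k p) /\
    (block k (next_site p) = nx (block k p) /\ block_rel k (next_site p) = 0%N)).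
Proof.
have := block_rel_lt k p; rewrite leq_eqVlt => /orP[/eqP h|h].
  by right; split => //; exact: block_next_last.
by left; split => //; exact: block_next.
Qed.

(** Swapping the sites [p] and [next_site p] happens at rate 1 and, among pairs
    of different species, only at such pairs. *)
Definition fast_at x p := slow_pair (at_site x (next_site p)) (at_site x p).

(** The blocks follow each other in the order A, B, C around the ring, so all
    the moves out of a segregated configuration are slow. *)
Lemma segregated_not_fast k p : ~~ fast_at (segregated hK k) p.
Proof.
rewrite /fast_at !at_segregated slow_pairE.
case: (block_nextP k p) => [] [_ [-> _]]; by case: (block k p).
Qed.

Lemma next_site_neq p : next_site p != p.
Proof.
have := dist_next p p; rewrite {2}/dist_from subrr => e.
have : (1 < n)%N by have := K0 A; have := K0 B; have := K0 C; lia.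
move=> n1; apply/eqP => e'; move: e; rewrite e' /dist_from subrr/=.
by rewrite modn_small.
Qed.

End Config.

(** * Upper bound: the valley of a segregated configuration *)

Section Energy.
Context {N : nat} {K : species -> nat}.
Local Notation n := (N.*2).+1.
Local Notation config := {w : {ffun site N -> species} | @has_counts N K w}.
Hypothesis hK : (K A + K B + K C)%N = n.
Hypothesis K0 : forall a, (0 < K a)%N.
Variable M : nat.
Hypothesis MK : forall a, (M <= K a)%N.
Variable k : site N.
Implicit Types (p q : site N) (x y : config).

Local Notation blk := (@block N K k).
Local Notation rl := (@block_rel N K k).

(** Number of swaps needed to bring a particle of species [a] from [p] into its
    own block, travelling through the end of the block of [p] that is adjacent
    to that block. *)
Definition gap p (a : species) : nat :=
  if a == blk p then 0%N else if a == nx (blk p) then (K (blk p) - rl p)%N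
  else (rl p).+1.
(** In units of one half: a misplaced particle is charged its [gap] minus
    [1/2], so that exchanging two particles across the common boundary of their
    blocks, which misplaces both, costs exactly one unit. *)
Definition cost p (a : species) : nat := ((gap p a).*2 - (a != blk p))%N.
(** Twice the energy [V]; doubling avoids fractions. *)
Definition energy2 x : nat := (\sum_p cost p (at_site x p))%N.
Definition misplaced a c x : nat :=
  (\sum_p ((at_site x p == a) && (blk p == c)))%N.
(** As many particles have crossed each boundary between blocks in one
    direction as in the other. This excludes configurations obtained by moving
    particles around the ring, such as the other segregated configurations. *)
Definition balanced x : bool :=
  [forall a, misplaced a (nx a) x == misplaced (nx a) a x].

Lemma gap_gt0 p a : a != blk p -> (0 < gap p a)%N.
Proof.
rewrite /gap => /negbTE ->; case: ifP => // _.
by rewrite subn_gt0 (block_rel_lt hK).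
Qed.

Lemma costE p a : (cost p a + (a != blk p) = (gap p a).*2)%N.
Proof.
rewrite /cost subnK//; case: eqP => //= /eqP /gap_gt0.
by rewrite double_gt0.
Qed.

(** The block of [X] contains as many foreign particles as there are particles
    of species [X] outside of it, and each of the latter is charged at least a
    half. The energy thus controls the gaps in one block without the correction
    by a half per particle. *)
Lemma gap_le_energy X x :
  ((\sum_(p | blk p == X) gap p (at_site x p)).*2 <= energy2 x)%N.
Proof.
rewrite (_ : (\sum_(p | blk p == X) gap p (at_site x p)).*2 = \sum_(p | blk p == X) cost p (at_site x p) +
    \sum_(p | blk p == X) (at_site x p != blk p))%N; last first.
  rewrite -muln2 big_distrl -big_split/=.
  by apply: eq_bigr => p _; rewrite costE muln2.
rewrite /energy2 [leqRHS](bigID (fun p => blk p == X))/= leq_add2l.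
have h1 : (\sum_(p | blk p == X) (at_site x p != blk p) +
    \sum_(p | blk p == X) (at_site x p == X) = K X)%N.
  rewrite -big_split/= -(card_block hK k X) cardsE -sum1_card.
  by apply: eq_big => [p|p /eqP ->] //; case: eqP.
have h2 : (\sum_(p | blk p == X) (at_site x p == X) +
    \sum_(p | blk p != X) (at_site x p == X) = K X)%N.
  rewrite -(config_count x X) cardsE -sum1_card.
  rewrite [RHS]big_mkcond [RHS](bigID (fun p => blk p == X))/=.
  by congr addn; apply: eq_bigr => p _; case: (at_site x p == X).
have {h1 h2} -> : (\sum_(p | blk p == X) (at_site x p != blk p) =
   \sum_(p | blk p != X) (at_site x p == X))%N by lia.
apply: leq_sum => p; case: (eqVneq (at_site x p) X) => //= -> h.
have := costE p X; have := gap_gt0 (p := p) (a := X).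
by rewrite eq_sym h => /(_ isT); lia.
Qed.

Lemma gap_lt_of_energy p x : (energy2 x < M.*2)%N ->
  (gap p (at_site x p) < K (blk p))%N.
Proof.
move=> h; have := gap_le_energy (blk p) x; have := MK (blk p).
by rewrite (bigD1 p)//=; lia.
Qed.

(** Below the threshold, a particle that should leave its block through one end
    and another that should leave through the other end have not passed each
    other. *)
Lemma gap2_lt_of_energy p q x : (energy2 x < M.*2)%N -> q != p ->
  blk q = blk p -> (gap p (at_site x p) + gap q (at_site x q) < K (blk p))%N.
Proof.
move=> h qp bqp; have := gap_le_energy (blk p) x; have := MK (blk p).
rewrite (bigD1 p)//= (bigD1 q)/=; first by lia.
by rewrite bqp eqxx.
Qed.

Lemma sum_exchange (F : site N -> species -> nat) p q x : q != p ->
  (\sum_r F r (at_site (exchange p q x) r) + F p (at_site x p) + F q (at_site x q)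
   = \sum_r F r (at_site x r) + F p (at_site x q) + F q (at_site x p))%N.
Proof.
move=> qp; rewrite (bigD1 p)//= (bigD1 q)//= [in RHS](bigD1 p)//= [in RHS](bigD1 q)//=.
rewrite !at_exchange tpermL tpermR.
rewrite (eq_bigr (fun r => F r (at_site x r))); first by lia.
by move=> r /andP[rp rq]; rewrite at_exchange tpermD // eq_sym.
Qed.

(** The neighbourhood of [segregated hK k] that the chain has to leave before
    it enters another segregated configuration. Its outer boundary has energy
    at least [M]. *)
Definition valley : {set config} := [set x | (energy2 x < M.*2)%N && balanced x].

Lemma misplaced_swap a c p x y : y = swap p x -> (
  misplaced a c y + ((at_site x p == a) && (blk p == c)) +
     ((at_site x (next_site p) == a) && (blk (next_site p) == c)) =
  misplaced a c x + ((at_site x (next_site p) == a) && (blk p == c)) +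
     ((at_site x p == a) && (blk (next_site p) == c)))%N.
Proof.
move=> ->; apply: (sum_exchange (fun r s => (s == a) && (blk r == c)) x).
exact: next_site_neq hK K0 p.
Qed.

(** Inside the valley each slow swap increases the energy by exactly 1 and each
    fast swap decreases it by exactly 1, which makes [exp (- b V)] reversible.
    Two mistakes are possible for a general configuration: a foreign particle
    could leave a block through the end that is opposite to its own block,
    where [gap] changes side, and two foreign particles could have passed each
    other. The bounds on gaps exclude both as long as [M] does not exceed the
    number of particles of any species. *)
Lemma valley_swap x p : x \in valley -> at_site x p != at_site x (next_site p) ->
  balanced (swap p x) /\
  (if slow_pair (at_site x p) (at_site x (next_site p))
   then (energy2 (swap p x) = energy2 x + 2)%N
   else slow_pair (at_site x (next_site p)) (at_site x p) /\
     energy2 x = (energy2 (swap p x) + 2)%N).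
Proof.
rewrite inE => /andP[ex /forallP bx] xpq.
have qp := next_site_neq hK K0 p.
have E := sum_exchange cost x qp.
rewrite -/(swap p x) -/(energy2 _) -/(energy2 _) in E.
have c1 := costE p (at_site x p).
have c2 := costE (next_site p) (at_site x (next_site p)).
have c3 := costE p (at_site x (next_site p)).
have c4 := costE (next_site p) (at_site x p).
have rp := block_rel_lt hK k p.
have Kp := K0 (blk p).
have g1 := gap_lt_of_energy p ex.
have g2 := gap_lt_of_energy (next_site p) ex.
rewrite !slow_pairE.
have msw a c := misplaced_swap a c (erefl (swap p x)).
case: (block_nextP hK K0 k p) => -[rb [bq rq]].
- (* both sites are in the block X; at most one of the two particles changes
     its gap, or one is of species X, since foreign particles of different
     species cannot be adjacent by g3 *)
  have g3 := gap2_lt_of_energy ex qp bq.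
  split.
    apply/forallP => a; have := bx a; have := msw a (nx a); have := msw (nx a) a.
    rewrite bq; do 4 move: (nat_of_bool _) => ?.
    by do 4 move: (misplaced _ _ _) => ?; clear; lia.
  move: E c1 c2 c3 c4 g1 g2 g3 xpq; rewrite /gap bq rq !species_eqE.
  move: (energy2 _) (energy2 _) => e1 e2.
  do 4 move: (cost _ _) => ?.
  move: (at_site x p) (at_site x (next_site p)) => a b; move: rp Kp rb.
  move: (blk p) => X; move: (rl p) (K X) => r KX; clear.
  by case: X; case: a; case: b => //=; lia.
- (* by the gap bounds, the third species is not at the common boundary *)
  have abX : (at_site x p == blk p) || (at_site x p == nx (blk p)).
    move: g1; rewrite /gap; case: eqVneq => //= _; case: eqVneq => //= _; lia.
  have abY : (at_site x (next_site p) == blk p) ||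
             (at_site x (next_site p) == nx (blk p)).
    move: g2; rewrite /gap bq rq orbC; case: eqVneq => //= e1.
    case: eqVneq => [_|e2 _]; first by rewrite subn0 ltnn.
    by move: e1 e2; case: (blk p); case: (at_site x (next_site p)).
  split.
    apply/forallP => a; have := bx a; have := msw a (nx a); have := msw (nx a) a; rewrite bq.
    do 4 move: (misplaced _ _ _) => ?.
    move: abX abY xpq; move: (at_site x p) (at_site x (next_site p)) => u v.
    move: (blk p) => X; clear; rewrite !species_eqE.
    by case: X; case: u => //=; case: v => //=; case: a => /=; lia.
  move: E c1 c2 c3 c4 abX abY xpq; rewrite /gap bq rq !species_eqE.
  move: (energy2 _) (energy2 _) => e1 e2.
  do 4 move: (cost _ _) => ?.
  move: (at_site x p) (at_site x (next_site p)) => a b; move: rp Kp rb.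
  move: (K (nx (blk p))) (K (blk p)) => K1 K2; move: (blk p) (rl p) => X r; clear.
  by case: X; case: a => //=; case: b => //=; lia.
Qed.

Lemma energy2_segregated : energy2 (segregated hK k) = 0%N.
Proof.
by rewrite /energy2 big1// => p _; rewrite /cost at_segregated /gap !eqxx.
Qed.

Lemma balanced_segregated : balanced (segregated hK k).
Proof.
apply/forallP => a; rewrite /misplaced !big1// => p _; rewrite at_segregated.
  by case: eqVneq => //= ->; rewrite eq_sym; case: a.
by case: eqVneq => //= ->; case: a.
Qed.

Lemma segregated_valley : (0 < M)%N -> segregated hK k \in valley.
Proof. by move=> M0; rewrite inE energy2_segregated balanced_segregated double_gt0 M0. Qed.

Lemma misplaced_gt0 a c x p :
  at_site x p = a -> blk p = c -> (0 < misplaced a c x)%N.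
Proof. by move=> e1 e2; rewrite /misplaced (bigD1 p)//= e1 e2 !eqxx. Qed.

Lemma misplaced_ex a c x : (0 < misplaced a c x)%N ->
  exists p, at_site x p = a /\ blk p = c.
Proof.
rewrite lt0n sum_nat_eq0 negb_forall => /existsP[p]; rewrite eqb0 negbK.
by move=> /andP[/eqP e1 /eqP e2]; exists p.
Qed.

(** By balance, a foreign particle in one block has a partner in the opposite
    direction across the same boundary. *)
Lemma valley_misplaced x p : x \in valley -> at_site x p != blk p ->
  exists X q1 q2, [/\ at_site x q1 = nx X, blk q1 = X, at_site x q2 = X & blk q2 = nx X].
Proof.
rewrite inE => /andP[_ /forallP bx].
case e: _ / (speciesP (blk p) (at_site x p)); first by rewrite eqxx.
  move=> _; exists (blk p), p.
  have := misplaced_gt0 e (erefl (blk p)).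
  by rewrite -(eqP (bx (blk p))) => /misplaced_ex[q [e1 e2]]; exists q.
move=> _; exists (at_site x p).
have bp : blk p = nx (at_site x p) by rewrite e succ_species3.
have := misplaced_gt0 (erefl (at_site x p)) bp.
by rewrite (eqP (bx _)) => /misplaced_ex[q [e1 e2]]; exists q, p.
Qed.

(** Otherwise there is a particle of species [nx X] in the block of [X] and a
    particle of species [X] in the next block. Between them the gap bounds
    leave no room for the third species, so that on the way from the first to
    the second some [nx X] is directly followed by an [X], which is a fast
    pair. *)
Lemma valley_stable x : x \in valley -> (forall p, ~~ fast_at x p) ->
  x = segregated hK k.
Proof.
move=> xV nf; apply: config_eqP => p; rewrite at_segregated; apply/eqP.
apply: contraT => /(valley_misplaced xV)[X [q1 [q2 [a1 b1 a2 b2]]]].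
have ex : (energy2 x < M.*2)%N by move: xV; rewrite inE => /andP[].
have nextX q : at_site x q = nx X -> at_site x (next_site q) != X.
  move=> aq; apply/eqP => aq'; have := nf q.
  by rewrite /fast_at aq aq' slow_pairE eqxx.
(* from q1 to the end of its block all particles are of species nx X *)
have step1 m : (rl q1 + m < K X)%N -> exists q,
    [/\ blk q = X, rl q = (rl q1 + m)%N & at_site x q = nx X].
  elim: m => [|m IH]; first by rewrite addn0; exists q1.
  move=> lt; have [|q [bq rq aq]] := IH; first by lia.
  have [|bq' rq'] := block_next hK K0 (k := k) (p := q); first by rewrite rq bq; lia.
  rewrite bq in bq'; exists (next_site q); split => //; first by rewrite rq' rq addnS.
  case e: _ / (speciesP X (at_site x (next_site q))) (nextX _ aq) => //.
    by rewrite eqxx.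
  move=> _; have qq1 : next_site q != q1.
    by apply/eqP => /(congr1 rl); lia.
  have := gap2_lt_of_energy ex qq1; rewrite bq' b1 => /(_ erefl).
  rewrite /gap e a1 b1 bq' rq' rq eqxx !(negbTE (succ_species_neq _)) (negbTE (succ_species2_neq _)).
  by lia.
have := block_rel_lt hK k q1; rewrite b1 => r1.
have [|l [bl rl' al]] := step1 (K X - (rl q1).+1)%N; first by lia.
have [|bl' rll'] := block_next_last hK K0 (k := k) (p := l); first by rewrite rl' bl; lia.
rewrite bl in bl'.
(* and they go on from the start of the next block up to q2, a contradiction *)
have step2 m : (m <= rl q2)%N -> exists q,
    [/\ blk q = nx X, rl q = m & at_site x q = nx X].
  have step q : at_site x q = nx X -> blk (next_site q) = nx X ->
      (rl (next_site q) <= rl q2)%N -> at_site x (next_site q) = nx X.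
    move=> aq bq' rq'.
    case e: _ / (speciesP X (at_site x (next_site q))) (nextX _ aq) => //.
      by rewrite eqxx.
    move=> _; have qq2 : next_site q != q2.
      by apply/eqP => eq2; move: e; rewrite eq2 a2; case: (X).
    have := gap2_lt_of_energy ex qq2; rewrite bq' b2 => /(_ erefl).
    rewrite /gap e a2 b2 bq' eqxx !(negbTE (succ_species_neq _)) eq_sym (negbTE (succ_species_neq _)).
    rewrite eq_sym (negbTE (succ_species2_neq _)).
    have := block_rel_lt hK k (next_site q); rewrite bq'; lia.
  elim: m => [|m IH] lt.
    exists (next_site l); split => //; apply: step => //; by rewrite rll'.
  have [|q [bq rq aq]] := IH; first by lia.
  have := block_rel_lt hK k q2; rewrite b2 => r2.
  have [|bq' rq'] := block_next hK K0 (k := k) (p := q); first by rewrite rq bq; lia.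
  exists (next_site q); rewrite rq' rq bq' bq; split => //; apply: step => //.
    by rewrite bq' bq.
  by rewrite rq' rq.
have [q [bq rq aq]] := step2 _ (leqnn _).
have qq2 : q = q2 by apply: (block_rel_inj hK (k := k)) => //; rewrite bq b2.
by move: aq; rewrite qq2 a2 => e; have := succ_species_neq X; rewrite -e eqxx.
Qed.

Lemma swap_id p x : at_site x p = at_site x (next_site p) -> swap p x = x.
Proof.
by move=> e; apply: config_eqP => q; rewrite at_exchange; case: tpermP => // ->.
Qed.

Lemma swapK p : involutive (@swap N K p).
Proof. exact: exchangeK. Qed.

Context {R : realType}.
Implicit Types (b : R) (u : config -> R).

Lemma jump_rateE b p x : jump_rate b p x =
  if slow_pair (at_site x p) (at_site x (next_site p)) then expR (- b) else 1.
Proof. by []. Qed.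

Lemma at_swap p x : at_site (swap p x) p = at_site x (next_site p).
Proof. by rewrite at_exchange tpermL. Qed.

Lemma at_swap_next p x : at_site (swap p x) (next_site p) = at_site x p.
Proof. by rewrite at_exchange tpermR. Qed.

(** Sum the generator over the valley against the reversible weights [mu = exp
    (- b V)]. All terms but the one at the segregated configuration vanish by
    harmonicity. The terms of swaps that stay in the valley cancel in pairs,
    and a swap that leaves the valley is slow and ends at energy at least [M],
    so that its term is at most [exp (- M b)]. *)
Lemma valley_escape b u : 0 <= b -> (forall x, 0 <= u x <= 1) -> (0 < M)%N ->
  (forall x, x \in valley -> x != segregated hK k ->
     gen (@swap N K) (jump_rate b) u x = 0) ->
  gen (@swap N K) (jump_rate b) u (segregated hK k) <=
    (n * #|{: config}|)%:R * expR (- M%:R * b).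
Proof.
move=> b0 u01 M0 u0.
pose mu x : R := expR (- b * ((energy2 x)%:R / 2)).
pose G p x := mu x * (jump_rate b p x * (u (swap p x) - u x)).
have -> : gen (@swap N K) (jump_rate b) u (segregated hK k) =
    \sum_p \sum_(x in valley) G p x.
  rewrite exchange_big/= (bigD1 (segregated hK k)) ?segregated_valley//=.
  rewrite [X in _ + X]big1 => [|x /andP[xV xs]]; last by rewrite -mulr_sumr -/(gen _ _ _ _) u0// mulr0.
  by rewrite addr0 -mulr_sumr /mu energy2_segregated mul0r mulr0 expR0 mul1r.
pose eM := expR (- M%:R * b).
have -> : (n * #|{: config}|)%:R * eM = \sum_(p : site N) #|{: config}|%:R * eM.
  by rewrite sumr_const card_ord -[RHS]mulr_natl natrM mulrA.
apply: ler_sum => p _.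
rewrite (bigID (fun x => swap p x \in valley))/=.
have G0 x : at_site x p = at_site x (next_site p) -> G p x = 0.
  by move=> /swap_id; rewrite /G => ->; rewrite subrr !mulr0.
have mu2 x y : energy2 y = (energy2 x + 2)%N -> mu x * expR (- b) = mu y.
  by move=> e; rewrite /mu -expRD e natrD; congr expR; field.
rewrite [X in X + _](_ : _ = 0) ?add0r.
  have -> : #|{: config}|%:R * eM = \sum_(x : config) eM.
    by rewrite sumr_const mulr_natl.
  rewrite [leLHS]big_mkcond/=; apply: ler_sum => x _.
  case: ifP => [/andP[xV sV]|_]; last by rewrite expR_ge0.
  have [xpq|xpq] := eqVneq (at_site x p) (at_site x (next_site p)).
    by rewrite G0// expR_ge0.
  have [bs] := valley_swap xV xpq; rewrite /G jump_rateE; case: ifP => [_ e|_ [_ e]].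
    rewrite mulrA (mu2 x (swap p x))//.
    apply: (@le_trans _ _ (mu (swap p x) * 1)).
      apply: ler_wpM2l; first exact: expR_ge0.
      by have := u01 x; have := u01 (swap p x); lra.
    rewrite mulr1 ler_expR mulNr mulNr lerN2 mulrC ler_wpM2l//.
    rewrite ler_pdivlMr// -natrM ler_nat.
    by move: sV; rewrite inE bs andbT -leqNgt muln2.
  by move: sV xV; rewrite !inE bs e => /negP sV /andP[h _]; exfalso; apply: sV; rewrite andbT; lia.
(* the swap p is an involution of the pairs of states inside the valley, and by
    reversibility it changes the sign of G p *)
set s := \sum_(_ | _) _; suff : s = - s by lra.
rewrite /s [LHS](reindex_inj (inv_inj (swapK p))) /= -sumrN.
apply: eq_big => x; rewrite swapK; first by rewrite andbC.
move=> /andP[sV xV]; have [xpq|xpq] := eqVneq (at_site x p) (at_site x (next_site p)).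
  by rewrite (swap_id xpq) G0// oppr0.
rewrite /G swapK !jump_rateE at_swap at_swap_next.
have [_] := valley_swap xV xpq.
have [sl|/negbTE sl] := boolP (slow_pair (at_site x p) (at_site x (next_site p))).
  move=> /mu2 <-; rewrite (_ : slow_pair _ _ = false); first by ring.
  by move: sl; case: (at_site x p); case: (at_site x (next_site p)).
by move=> [-> /mu2 <-]; ring.
Qed.

End Energy.

(** * Configurations read as cyclic words *)

Section Words.
Context {N : nat} {K : species -> nat}.
Local Notation n := (N.*2).+1.
Local Notation config := {w : {ffun site N -> species} | @has_counts N K w}.
Hypothesis hK : (K A + K B + K C)%N = n.
Hypothesis K0 : forall a, (0 < K a)%N.
Implicit Types (p q k : site N) (x y : config) (u v s : seq species).
Local Notation blk := (@block N K).
Local Notation rl := (@block_rel N K).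

(** The configuration read from the site [k]; words make explicit families of
    configurations easy to write. *)
Definition word k x : seq species := mkseq (fun m => at_site x (site_at k m)) n.

Lemma size_word k x : size (word k x) = n.
Proof. exact: size_mkseq. Qed.

Lemma nth_word k x m : (m < n)%N -> nth A (word k x) m = at_site x (site_at k m).
Proof. exact: nth_mkseq. Qed.

Lemma word_inj k x y : word k x = word k y -> x = y.
Proof.
move=> e; apply: config_eqP => p; rewrite -(site_at_dist k p).
by rewrite -!nth_word ?dist_lt// e.
Qed.

Lemma word_at_block k i p (X : species) : at_site (segregated hK i) p = X ->
  rl i p = 0%N -> word p (segregated hK i) =
  nseq (K X) X ++ nseq (K (nx X)) (nx X) ++ nseq (K (nx (nx X))) (nx (nx X)).
Proof.
rewrite at_segregated => bp rp.
have KS : (K X + K (nx X) + K (nx (nx X)) = n)%N by rewrite -hK; case: (X) => /=; lia.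
have st q a : blk i q = a -> rl i q = 0%N -> forall m, (m < K a)%N ->
    blk i (site_at q m) = a /\ rl i (site_at q m) = m.
  move=> bq rq; elim=> [_|m IH lt].
    by rewrite site_at0 bq rq.
  have [|b1 r1] := IH; first by lia.
  rewrite -next_site_at; have [|-> ->] := block_next hK K0 (k := i) (p := site_at q m).
    by rewrite b1 r1.
  by rewrite b1 r1.
have st2 q a : blk i q = a -> rl i q = 0%N ->
    blk i (site_at q (K a)) = nx a /\ rl i (site_at q (K a)) = 0%N.
  move=> bq rq; have [|b1 r1] := st _ _ bq rq (K a).-1; first by have := K0 a; lia.
  have := block_next_last hK K0 (k := i) (p := site_at q (K a).-1).
  by rewrite next_site_at b1 r1 prednK//; apply.
have [b1 r1] := st2 _ _ bp rp; have [b2 r2] := st2 _ _ b1 r1.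
rewrite site_atD in b2 r2.
apply: (@eq_from_nth _ A) => [|m]; rewrite size_word.
  by rewrite !size_cat !size_nseq; lia.
move=> mn; rewrite nth_word// !nth_cat !size_nseq !nth_nseq at_segregated.
case: ltnP => h1; first by rewrite (st _ _ bp rp _ h1).1.
case: ltnP => h2.
  have {1}-> : m = (K X + (m - K X))%N by lia.
  by rewrite -site_atD (st _ _ b1 r1 _ h2).1.
have {1}-> : m = (K X + K (nx X) + (m - K X - K (nx X)))%N by lia.
have h3 : (m - K X - K (nx X) < K (nx (nx X)))%N by lia.
by rewrite -(site_atD p) (st _ _ b2 r2 _ h3).1 h3.
Qed.

Definition seg_word X :=
  nseq (K X) X ++ nseq (K (nx X)) (nx X) ++ nseq (K (nx (nx X))) (nx (nx X)).

Lemma segregated_word X i : exists k, word k (segregated hK i) = seg_word X.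
Proof.
exists (site_at i (@block_start K X)).
have lt : (@block_start K X < n)%N.
  by have := K0 A; have := K0 B; have := K0 C; case: (X); rewrite -hK /=; lia.
have bl : blk i (site_at i (@block_start K X)) = X.
  rewrite blockE dist_site_at modn_small//.
  have := K0 A; have := K0 B; case: (X) => /= b0 a0; first by rewrite a0.
    by rewrite ltnn -[X in (X < _)%N]addn0 ltn_add2l b0.
  by rewrite ltnn ltnNge leq_addr.
apply: word_at_block; rewrite ?at_segregated//.
by rewrite /block_rel bl dist_site_at modn_small// subnn.
Qed.

Lemma word_swap k x u v a c : word k x = u ++ a :: c :: v ->
  word k (swap (site_at k (size u)) x) = u ++ c :: a :: v.
Proof.
move=> e; have sz : (size u + (size v).+2 = n)%N by rewrite -(size_word k x) e size_cat.
apply: (@eq_from_nth _ A) => [|m]; rewrite size_word; first by rewrite size_cat.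
move=> mn; rewrite nth_word// at_exchange next_site_at.
have nu m' : (m' < n)%N -> at_site x (site_at k m') = nth A (u ++ a :: c :: v) m'.
  by move=> h; rewrite -nth_word// e.
case: tpermP => [/site_at_inj|/site_at_inj|].
- move=> ->; [|exact: mn|lia].
  by rewrite nu ?nth_cat ?ltnn ?subnn ?ltnNge ?leqnSn /= ?subSnn //; lia.
- move=> ->; [|exact: mn|lia].
  by rewrite nu ?nth_cat ?ltnn ?subnn ?ltnNge ?leqnSn /= ?subSnn //; lia.
- move=> h1 h2; rewrite nu// !nth_cat; case: ltnP => // um.
  have : m != size u by apply/eqP => mu; apply: h1; rewrite mu.
  have : m != (size u).+1 by apply/eqP => mu; apply: h2; rewrite mu.
  move=> m1 m2; have -> : (m - size u = (m - size u).-2.+2)%N by lia.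
  by [].
Qed.

Lemma word_rot k x u v : word k x = u ++ v ->
  word (site_at k (size u)) x = v ++ u.
Proof.
move=> e; have sz : (size u + size v = n)%N by rewrite -(size_word k x) e size_cat.
apply: (@eq_from_nth _ A) => [|m]; rewrite size_word; first by rewrite size_cat addnC.
move=> mn; rewrite nth_word// site_atD nth_cat.
case: ltnP => h.
  rewrite -nth_word ?e; last by lia.
  by rewrite nth_cat ltnNge leq_addr /= addKn.
have -> : (size u + m = (m - size v) + n)%N by lia.
rewrite -site_at_mod modnDr site_at_mod -nth_word; last by lia.
by rewrite e nth_cat ifT//; lia.
Qed.

Lemma word_at k x u v a c : word k x = u ++ a :: c :: v ->
  at_site x (site_at k (size u)) = a /\
  at_site x (next_site (site_at k (size u))) = c.
Proof.
move=> e; have sz : (size u + (size v).+2 = n)%N by rewrite -(size_word k x) e size_cat.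
rewrite next_site_at -!nth_word ?e; try lia.
rewrite !nth_cat ltnn subnn ltnNge leqnSn /= (_ : ((size u).+1 - size u = 1)%N)//.
by lia.
Qed.

(** Neighbours that are not a fast pair. A cyclic word of such pairs stands for
    a configuration whose moves all have rate [exp (- b)]. *)
Definition stable_pair a c := ~~ slow_pair c a.

Lemma word_stable k x : path.cycle stable_pair (word k x) -> forall p, ~~ fast_at x p.
Proof.
move=> cs p; rewrite /fast_at -/(stable_pair _ _).
move: cs; rewrite /word /mkseq /=; set t := map _ _ => /(pathP A) h.
have lt := dist_lt k p.
have st : size t = N.*2 by rewrite /t size_map size_iota.
have := h (dist_from k p); rewrite size_rcons st => /(_ lt).
have e m : (m < n)%N -> nth A (at_site x (site_at k 0) :: t) m = at_site x (site_at k m).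
  by move=> mn; rewrite -[RHS]nth_word.
rewrite -rcons_cons !nth_rcons /= st.
have -> : nth A (at_site x (site_at k 0) :: t) (dist_from k p) = at_site x p.
  by rewrite e// site_at_dist.
rewrite lt /=; have := e (dist_from k p).+1; rewrite /= => e1.
rewrite -[in next_site p](site_at_dist k p) next_site_at.
case: ltnP => h1; first by rewrite e1.
have -> : dist_from k p = N.*2 by apply/eqP; rewrite eqn_leq h1 -ltnS lt.
rewrite eqxx (_ : site_at k n = site_at k 0)//.
by rewrite -site_at_mod modnn.
Qed.

End Words.

(** * Lower bound: paths between segregated configurations *)

Section LowerBound.
Context {R : realType} {N : nat} {K : species -> nat}.
Local Notation n := (N.*2).+1.
Local Notation config := {w : {ffun site N -> species} | @has_counts N K w}.
Hypothesis hK : (K A + K B + K C)%N = n.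
Hypothesis K2 : forall a, (1 < K a)%N.
Variable h : R -> config -> R.
Hypothesis h0 : forall b x, 0 <= h b x.
Hypothesis harm : forall b x, x \notin segregated_set hK ->
  gen (@swap N K) (jump_rate b) (h b) x = 0.
Implicit Types (b : R) (p q k : site N) (x y : config) (u v s : seq species).
Local Notation blk := (@block N K).
Local Notation rl := (@block_rel N K).

Let K0 a : (0 < K a)%N. Proof. exact: ltnW (K2 a). Qed.

Lemma jump_rate_le1 b p x : 0 <= b -> jump_rate b p x <= 1.
Proof. by move=> b0; rewrite jump_rateE; case: ifP => // _; rewrite expR_le1 lerNl oppr0. Qed.

Lemma jump_rate_gt0 b p x : 0 < jump_rate b p x.
Proof. by rewrite jump_rateE; case: ifP => // _; rewrite expR_gt0. Qed.

(** Harmonicity equates the flow out of [x] with the flow into it. As all terms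
    are nonnegative, a single neighbour bounds the value at [x] from below,
    weighted by its rate relative to the [n] swaps of rate at most [t]. *)
Lemma harmonic_step b x p (t : R) : x \notin segregated_set hK ->
  (forall q, at_site x q != at_site x (next_site q) -> jump_rate b q x <= t) ->
  at_site x p != at_site x (next_site p) ->
  jump_rate b p x * h b (swap p x) <= n%:R * t * h b x.
Proof.
move=> xS rt xp.
(* swaps of equal particles do not contribute to the generator *)
have E : \sum_(q | at_site x q != at_site x (next_site q)) jump_rate b q x * h b (swap q x)
  = \sum_(q | at_site x q != at_site x (next_site q)) jump_rate b q x * h b x.
  apply/eqP; rewrite -subr_eq0 -sumrB -[X in _ == X](harm b xS) /gen [X in _ == X](bigID
    (fun q => at_site x q != at_site x (next_site q)))/=.
  rewrite [X in _ + X]big1 ?addr0; last first.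
    by move=> q /negbNE/eqP/swap_id ->; rewrite subrr mulr0.
  by apply/eqP; apply: eq_bigr => q _; rewrite mulrBr.
apply: (@le_trans _ _ (\sum_(q | at_site x q != at_site x (next_site q))
    jump_rate b q x * h b (swap q x))).
  rewrite (bigD1 p)//= lerDl; apply: sumr_ge0 => q _.
  by rewrite mulr_ge0// ltW// jump_rate_gt0.
rewrite E -mulrA -[X in X%:R * _](card_ord n) mulr_natl -sumr_const.
have t0 : 0 <= t by apply: le_trans (rt _ xp); rewrite ltW// jump_rate_gt0.
rewrite big_mkcond; apply: ler_sum => q _; case: ifP => [xq|_].
  by rewrite ler_wpM2r// rt.
by rewrite mulr_ge0.
Qed.

Definition lower_order x (m : nat) : Prop :=
  exists2 c : R, 0 < c & forall b, 0 <= b -> c * expR (- m%:R * b) <= h b x.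

(** Vacuously true if no configuration has the word [s] at [k]. *)
Definition word_order k s (m : nat) : Prop :=
  forall x, word k x = s -> lower_order x m.

Lemma fast_not_segregated x p : fast_at x p -> x \notin segregated_set hK.
Proof.
move=> f; apply/negP => /imsetP[i _ xi]; have := segregated_not_fast hK K0 i p.
by rewrite -xi f.
Qed.

(** A segregated configuration has only one site where a given species is
    followed by its successor. *)
Lemma segregated_boundary x p q a : x \in segregated_set hK ->
  at_site x p = a -> at_site x (next_site p) = nx a ->
  at_site x q = a -> at_site x (next_site q) = nx a -> p = q.
Proof.
move=> /imsetP[i _ ->]; rewrite !at_segregated => ap ap' aq aq'.
have L l : blk i l = a -> blk i (next_site l) = nx a -> (rl i l).+1 = K a.
  move=> al al'; case: (block_nextP hK K0 i l) => -[rl' [e _]]; last by rewrite rl' al.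
  by move: al'; rewrite e al; case: (a).
apply: (block_rel_inj hK (k := i)); first by rewrite ap aq.
by have := L _ ap ap'; have := L _ aq aq'; lia.
Qed.

Let n0 : 0 < n%:R :> R. Proof. by rewrite ltr0n. Qed.

(** A fast swap is at least as likely as any other move, so it costs no factor. *)
Lemma word_fast k u v a c m : slow_pair a c ->
  word_order k (u ++ a :: c :: v) m -> word_order k (u ++ c :: a :: v) m.
Proof.
move=> ac L x xw; have [e1 e2] := word_at hK xw.
have [d d0 hd] := L _ (word_swap hK xw).
exists (d / n%:R); first by rewrite divr_gt0.
move=> b b0; rewrite mulrAC ler_pdivrMr// (le_trans (hd _ b0))//.
have fp : fast_at x (site_at k (size u)) by rewrite /fast_at e1 e2.
have := @harmonic_step b x (site_at k (size u)) 1 (fast_not_segregated fp).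
rewrite mulr1 jump_rateE e1 e2 (mulrC (h b x)).
rewrite (_ : slow_pair c a = false) ?mul1r; last by move: ac; case: (a); case: (c).
apply; last by move: ac; case: (a); case: (c).
by move=> q _; apply: jump_rate_le1.
Qed.

(** When a fast move is available as well, a slow swap costs a factor [exp (-
    b)]. *)
Lemma word_slow k u v a c m : slow_pair a c ->
  ~~ path.cycle stable_pair (u ++ a :: c :: v) ->
  word_order k (u ++ c :: a :: v) m -> word_order k (u ++ a :: c :: v) m.+1.
Proof.
move=> ac ncs L x xw; have [e1 e2] := word_at hK xw.
have [d d0 hd] := L _ (word_swap hK xw).
have [q fq] : exists q, fast_at x q.
  apply: contrapT => nf; move/negP: ncs; apply; rewrite -xw.
  rewrite /word /mkseq /=; set t := map _ _; apply/(pathP A) => i.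
  have st : size t = N.*2 by rewrite /t size_map size_iota.
  rewrite size_rcons st => lt.
  have e j : (j < n)%N -> nth A (at_site x (site_at k 0) :: t) j = at_site x (site_at k j).
    by move=> jn; rewrite -[RHS]nth_word.
  rewrite -rcons_cons !nth_rcons /= st lt.
  have -> : nth A (at_site x (site_at k 0) :: t) i = at_site x (site_at k i) by rewrite e.
  have -> : (if (i < N.*2)%N then nth A t i else if i == N.*2 then at_site x (site_at k 0) else A) =
      at_site x (site_at k i.+1).
    case: ltnP => h1; first by have := e i.+1 h1.
    have -> : i = N.*2 by apply/eqP; rewrite eqn_leq h1 -ltnS lt.
    by rewrite eqxx -(site_at_mod k n) modnn.
  by rewrite -next_site_at; apply/negP => f; apply: nf; exists (site_at k i).
exists (d / n%:R); first by rewrite divr_gt0.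
move=> b b0; rewrite mulrAC ler_pdivrMr//.
have := @harmonic_step b x (site_at k (size u)) 1 (fast_not_segregated fq).
rewrite mulr1 jump_rateE e1 e2 ac (mulrC n%:R) => H; apply: le_trans (H _ _); last 2 first.
- by move=> l _; apply: jump_rate_le1.
- by move: ac; case: (a); case: (c).
rewrite -[m.+1]addn1 natrD opprD mulrDl expRD mulN1r mulrA mulrC ler_wpM2l ?expR_ge0//.
exact: hd.
Qed.

(** When no fast move is available all the possible moves have the same rate,
    so a slow swap is free. Segregated configurations are excluded as
    harmonicity fails there. *)
Lemma word_slow_stable k u v a c m : slow_pair a c ->
  path.cycle stable_pair (u ++ a :: c :: v) ->
  (forall x, word k x = u ++ a :: c :: v -> x \notin segregated_set hK) ->
  word_order k (u ++ c :: a :: v) m -> word_order k (u ++ a :: c :: v) m.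
Proof.
move=> ac cs ns L x xw; have [e1 e2] := word_at hK xw.
have [d d0 hd] := L _ (word_swap hK xw).
have nf q : ~~ fast_at x q by apply: (@word_stable _ _ k); rewrite xw.
exists (d / n%:R); first by rewrite divr_gt0.
move=> b b0; rewrite mulrAC ler_pdivrMr// (le_trans (hd _ b0))//.
have := @harmonic_step b x (site_at k (size u)) (expR (- b)) (ns _ xw).
rewrite jump_rateE e1 e2 ac => H.
rewrite -(ler_pM2l (expR_gt0 (- b))) (mulrC (h b x)) mulrA (mulrC _ n%:R).
apply: H; last by move: ac; case: (a); case: (c).
move=> q xq; rewrite jump_rateE; case: ifP => // /negP; have := nf q; rewrite /fast_at.
by move: xq; case: (at_site x q); case: (at_site x (next_site q)).
Qed.

Lemma word_order_rot k u v m :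
  word_order (site_at k (size u)) (v ++ u) m -> word_order k (u ++ v) m.
Proof. by move=> L x /(word_rot hK); exact: L. Qed.

(** A pair [Y Z] of foreign particles with [i] particles [X] to its left and
    [j] to its right, in an otherwise segregated configuration ([Y] and [Z]
    being the species after [X]). *)
Definition defect X (i j : nat) : seq species :=
  nseq i X ++ nx X :: nx (nx X) :: nseq j X ++
  nseq (K (nx X)).-1 (nx X) ++ nseq (K (nx (nx X))).-1 (nx (nx X)).

Lemma path_nseq a i s : path stable_pair a (nseq i a ++ s) = path stable_pair a s.
Proof. by elim: i => //= i ->; case: a. Qed.

Lemma nseqSr i (a : species) s : nseq i.+1 a ++ s = nseq i a ++ a :: s.
Proof. by elim: i => //= i <-. Qed.

(** With [X] on both sides, the pair can only move slowly. *)
Lemma defect_stable X i j : path.cycle stable_pair (defect X i.+1 j.+1).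
Proof.
rewrite /defect; have : (0 < (K (nx X)).-1)%N by have := K2 (nx X); lia.
have : (0 < (K (nx (nx X))).-1)%N by have := K2 (nx (nx X)); lia.
case: (K (nx X)).-1 => // y; case: (K (nx (nx X))).-1 => // z _ _.
rewrite /= -cat1s -!cats1 -!catA path_nseq /=.
rewrite -!catA path_nseq /= -?catA path_nseq /= -?catA path_nseq /=.
by case: X.
Qed.

Lemma defect_not_segregated k X i j x : word k x = defect X i.+1 j.+1 ->
  x \notin segregated_set hK.
Proof.
move=> xw; apply/negP => xS.
have yK : (K (nx X)).-1 = (K (nx X)).-2.+1 by have := K2 (nx X); lia.
have w1 : word k x = nseq i X ++ X :: nx X :: (nx (nx X) :: nseq j.+1 X ++
  nseq (K (nx X)).-1 (nx X) ++ nseq (K (nx (nx X))).-1 (nx (nx X))).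
  by rewrite xw /defect nseqSr.
have w2 : word k x = (nseq i.+1 X ++ nx X :: nx (nx X) :: nseq j X) ++ X :: nx X ::
   (nseq (K (nx X)).-2 (nx X) ++ nseq (K (nx (nx X))).-1 (nx (nx X))).
  by rewrite xw /defect yK [nseq j.+1 X ++ _]nseqSr /= -!catA /=.
have [a1 a2] := word_at hK w1; have [a3 a4] := word_at hK w2.
have E := segregated_boundary xS a1 a2 a3 a4.
have sz := size_word k x; rewrite w2 in sz.
rewrite !size_cat /= !size_cat /= !size_nseq in sz E.
by have := site_at_inj _ _ E; lia.
Qed.

(** The pair moves one step to the left: first its [Y] in a slow swap of a
    configuration without fast pairs, then its [Z] in a fast swap. *)
Lemma defect_left k X i j m :
  word_order k (defect X i.+1 j.+2) m -> word_order k (defect X i.+2 j.+1) m.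
Proof.
move=> L.
have e : defect X i.+2 j.+1 = nseq i.+1 X ++ X :: nx X :: (nx (nx X) :: nseq j.+1 X ++
  nseq (K (nx X)).-1 (nx X) ++ nseq (K (nx (nx X))).-1 (nx (nx X))).
  by rewrite /defect nseqSr.
rewrite e; apply: word_slow_stable.
- by rewrite slow_pairE eqxx.
- by rewrite -e defect_stable.
- by move=> x; rewrite -e => /defect_not_segregated.
rewrite -cat_rcons; apply: word_fast; first by rewrite slow_pairE succ_species3.
by rewrite cat_rcons.
Qed.

Lemma defect_far_left k X i j m :
  word_order k (defect X 1 (i + j.+1)) m -> word_order k (defect X i.+1 j.+1) m.
Proof.
elim: i j => [|i IH] j; first by rewrite add0n.
by rewrite addSnnS => /IH; exact: defect_left.
Qed.

(** When the pair [Y Z] reaches the left end of the block of [X], what is left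
    there of the [X]'s together with the pair reads [X Y Z]. The same
    configuration is a pair [X Y] at the right end of the block of [Z], and
    this pair can travel on to the left. *)
Lemma defect_change k k' X m : k = site_at k' (K (nx (nx X))).-1 ->
  word_order k' (defect (nx (nx X)) (K (nx (nx X))).-1 1) m ->
  word_order k (defect X 1 (K X).-1) m.
Proof.
move=> kk L x xw; apply: L.
rewrite kk in xw.
have -> : defect (nx (nx X)) (K (nx (nx X))).-1 1 =
  nseq (K (nx (nx X))).-1 (nx (nx X)) ++ (X :: nx X :: nx (nx X) :: nseq (K X).-1 X ++
    nseq (K (nx X)).-1 (nx X)).
  by rewrite /defect succ_species3.
set u := nseq _ _; set v := _ :: _.
have e : word (site_at k' (size u)) x = v ++ u.
  by rewrite /u size_nseq xw /defect /v /= -catA.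
have := word_rot hK e; rewrite site_atD => <-; congr word.
rewrite -[LHS]site_at0; rewrite -{1}(site_at_mod k' 0).
have := size_word k x; rewrite kk xw => sz.
have -> : (size u + size v)%N = n.
  by rewrite addnC -size_cat -e size_word.
by rewrite site_at_mod -[in RHS]site_at_mod modnn site_at0.
Qed.

(** After it has crossed the three blocks the defect is back in the block of
    [X], and all the blocks have moved by three sites. *)
Lemma defect_cycle k k' X m : k' = site_at k 3 ->
  word_order k' (defect X (K X).-1 1) m -> word_order k (defect X (K X).-1 1) m.
Proof.
pose Y := nx X; pose Z := nx Y.
have eZ : nx (nx Z) = Y := succ_species3 Y.
have eY : nx (nx Y) = X := succ_species3 X.
have kX := K2 X; have kY := K2 Y; have kZ := K2 Z.
have KS : (K X + K Y + K Z = n)%N by rewrite -hK /Z /Y; case: (X) => /=; lia.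
have near1 W k1 : word_order k1 (defect W 1 (K W).-1) m -> word_order k1 (defect W (K W).-1 1) m.
  have := K2 W; case: (K W) => // -[|w] //= _ L; apply: defect_far_left.
  by rewrite addn1.
move=> -> L; apply: (near1 X).
apply: (@defect_change _ (site_at k (n - (K Z).-1))); first rewrite site_atD.
  by rewrite -[LHS]site_atn; congr site_at; rewrite -/Y -/Z; lia.
rewrite -/Y -/Z; apply: (near1 Z).
apply: (@defect_change _ (site_at k (n - (K Z).-1 - (K Y).-1))); first rewrite site_atD.
  by congr site_at; rewrite eZ; lia.
rewrite eZ; apply: (near1 Y).
apply: (@defect_change _ (site_at k 3)); first rewrite site_atD.
  by congr site_at; rewrite eY; lia.
by rewrite eY.
Qed.

Lemma word_order_cycle k X m j :
  word_order (site_at k (3 * j)) (defect X (K X).-1 1) m -> word_order k (defect X (K X).-1 1) m.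
Proof.
elim: j k => [|j IH] k; first by rewrite muln0 site_at0.
rewrite mulnS -site_atD => /IH; exact: defect_cycle.
Qed.

(** A particle crosses a block of the species before which it stands in a fast
    pair by fast swaps only. *)
Lemma word_travel_right k u v a c i m : slow_pair a c ->
  word_order k (u ++ nseq i a ++ c :: v) m -> word_order k (u ++ c :: nseq i a ++ v) m.
Proof.
move=> ac; elim: i u => // i IH u L; apply: word_fast ac _.
by rewrite -cat_rcons; apply: IH; rewrite cat_rcons.
Qed.

Lemma word_travel_left k u v a c i m : slow_pair c a ->
  word_order k (u ++ c :: nseq i a ++ v) m -> word_order k (u ++ nseq i a ++ c :: v) m.
Proof.
move=> ac; elim: i v => // i IH v L; rewrite nseqSr catA.
by apply: word_fast ac _; rewrite -catA; apply: IH; rewrite -nseqSr.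
Qed.

Local Notation seg_word := (@seg_word K).

Lemma seg_wordE X : seg_word X =
  nseq (K X).-1 X ++ X :: nx X :: nseq (K (nx X)).-1 (nx X) ++
  nx (nx X) :: nseq (K (nx (nx X))).-1 (nx (nx X)).
Proof.
rewrite /seg_word; have := K2 X; have := K2 (nx X); have := K2 (nx (nx X)).
case: (K X) => // x; case: (K (nx X)) => // y; case: (K (nx (nx X))) => // z _ _ _.
by rewrite nseqSr.
Qed.

(** The pair separates: [Z] goes right through the [X] next to it, and then
    through the block of [Y] to its own block. *)
Lemma defect_close0 k X m :
  word_order k (seg_word X) m -> word_order k (defect X (K X).-1 1) m.
Proof.
rewrite seg_wordE => L; have st := defect_stable X (K X).-2 0.
have ns := @defect_not_segregated k X (K X).-2 0.
have kX : (K X).-2.+1 = (K X).-1 by have := K2 X; lia.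
rewrite !kX in st ns; move: st ns; rewrite /defect -cat_rcons => st ns.
apply: word_slow_stable; [by rewrite slow_pairE succ_species3|exact: st|exact: ns|].
rewrite cat_rcons; apply: word_fast; first by rewrite slow_pairE eqxx.
rewrite -cat_rcons -cat_rcons; apply: word_travel_right; first by rewrite slow_pairE eqxx.
by rewrite !cat_rcons.
Qed.

(** The pair separates after its [Y] has moved to the right, back to its block;
    its [Z] then crosses the block of [X] to the left. The blocks have moved by
    one site. *)
Lemma defect_close1 k X m :
  word_order (site_at k 1) (seg_word X) m -> word_order k (defect X (K X).-1 1) m.
Proof.
rewrite seg_wordE => L; have st := defect_stable X (K X).-2 0.
have ns := @defect_not_segregated k X (K X).-2 0.
have kX : (K X).-2.+1 = (K X).-1 by have := K2 X; lia.
rewrite !kX in st ns; move: st ns; rewrite /defect => st ns.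
apply: word_slow_stable; [by rewrite slow_pairE eqxx|exact: st|exact: ns|].
rewrite -cat_rcons; apply: word_fast; first by rewrite slow_pairE eqxx.
rewrite cat_rcons -[nseq _ X ++ _]cat0s.
apply: word_travel_left; first by rewrite slow_pairE succ_species3.
rewrite cat0s -cat1s; apply: word_order_rot.
rewrite -!catA /= -!catA; move: L.
rewrite (_ : nseq (K (nx (nx X))).-1 _ ++ [:: _] = nx (nx X) :: nseq (K (nx (nx X))).-1 (nx (nx X)))//.
by rewrite -nseqSr cats0.
Qed.

(** At the left end of the block of [X], the pair and the [X] in front of it
    rearrange so that [Y] crosses the block of [Z] to the left. The blocks have
    moved by two sites. *)
Lemma defect_close2 k X m :
  word_order (site_at k 2) (seg_word X) m -> word_order k (defect X (K X).-1 1) m.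
Proof.
rewrite seg_wordE => L.
have kX : (K X).-2.+1 = (K X).-1 by have := K2 X; lia.
rewrite -kX; apply: defect_far_left; rewrite addn1 kX.
have st := defect_stable X 0 (K X).-2.
have ns := @defect_not_segregated k X 0 (K X).-2.
rewrite !kX in st ns; move: st ns; rewrite /defect => st ns.
rewrite cat1s -[X :: _]cat0s.
apply: word_slow_stable; [by rewrite slow_pairE eqxx|exact: st|exact: ns|].
rewrite cat0s -cat1s; apply: word_fast; first by rewrite slow_pairE succ_species3.
rewrite cat1s (_ : [:: _, _, _ & _] = [:: nx X; nx (nx X)] ++ X :: (nseq (K X).-1 X ++
   nseq (K (nx X)).-1 (nx X) ++ nseq (K (nx (nx X))).-1 (nx (nx X))))//.
apply: word_order_rot.
rewrite (_ : _ ++ [:: _; _] = (X :: nseq (K X).-1 X ++ nseq (K (nx X)).-1 (nx X)) ++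
  nseq (K (nx (nx X))).-1 (nx (nx X)) ++ nx X :: [:: nx (nx X)]); last by rewrite /= -!catA.
apply: word_travel_left; first by rewrite slow_pairE eqxx.
move: L; rewrite -nseqSr /= -!catA.
by rewrite -(nseqSr (K (nx X)).-1) /= -nseqSr cats0.
Qed.

(** Rotating by multiples of three with [word_order_cycle] and by 0, 1 or 2
    with the three ways to close the defect reaches all segregated
    configurations. *)
Lemma defect_to_segregated k k' X m :
  word_order k' (seg_word X) m -> word_order k (defect X (K X).-1 1) m.
Proof.
move=> L; have : k' = site_at (site_at k (3 * (dist_from k k' %/ 3))) (dist_from k k' %% 3).
  by rewrite site_atD mulnC -divn_eq site_at_dist.
have : (dist_from k k' %% 3 < 3)%N by rewrite ltn_mod.
move: (_ %/ 3)%N (_ %% 3)%N => q r r3 e; rewrite {}e in L.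
apply: (@word_order_cycle _ _ _ q).
case: r r3 L => [_|[_|[_|//]]]; [rewrite site_at0|..].
- exact: defect_close0.
- exact: defect_close1.
- exact: defect_close2.
Qed.

Lemma not_stable_word u v a c : slow_pair a c ->
  ~~ path.cycle stable_pair (u ++ c :: a :: v).
Proof.
move=> ac; rewrite cycle_catC /= negb_and.
by rewrite /stable_pair ac.
Qed.

(** A particle [Z] crosses the block of [Y] to the left: after a first swap,
    made in [escape_lower], each further step is slow while the way back is
    fast. Once [Z] has only one [Y] before it, that [Y] moves left through the
    last [X], and the pair [Y Z] is the defect. *)
Lemma word_order_first_swap k X :
  word_order k (defect X (K X).-1 1) 0 ->
  word_order k (nseq (K X) X ++ nseq (K (nx X)).-1 (nx X) ++
    nx (nx X) :: nx X :: nseq (K (nx (nx X))).-1 (nx (nx X))) (K (nx X)).-1.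
Proof.
move=> L; set v := nseq (K (nx (nx X))).-1 _.
have [r ey] : exists r, K (nx X) = r.+2.
  by have := K2 (nx X); case: (K (nx X)) => // -[|r] // _; exists r.
rewrite ey /=.
have st i j : (i + j = r)%N ->
  word_order k (nseq (K X) X ++ nseq i.+1 (nx X) ++ nx (nx X) :: nseq j.+1 (nx X) ++ v) i.+1.
  elim: i j => [|i IH] j ij.
    have kX : K X = (K X).-1.+1 by have := K2 X; lia.
    rewrite kX nseqSr [nseq 1 _]/= cat1s; apply: word_slow; first by rewrite slow_pairE eqxx.
      rewrite -cat_rcons -cat_rcons; apply: not_stable_word.
      by rewrite slow_pairE eqxx.
    rewrite -cat_rcons; apply: word_fast; first by rewrite slow_pairE succ_species3.
    rewrite cat_rcons; move: L; rewrite /defect ey /=.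
    by rewrite add0n in ij; rewrite ij.
  rewrite nseqSr catA; apply: word_slow; first by rewrite slow_pairE eqxx.
    rewrite -cat_rcons; apply: not_stable_word.
    by rewrite slow_pairE eqxx.
  rewrite -catA; apply: (IH j.+1); lia.
by have := st r 0%N; rewrite addn0; apply.
Qed.

(** A particle [Z] crosses the block of [Y = nx X]; the number of slow swaps
    against a fast way back is the number of particles [Y]. *)
Lemma escape_lower k k' X w : word k w = seg_word X -> (forall b, h b w = 0) ->
  word_order k' (seg_word X) 0 ->
  exists2 c : R, 0 < c & forall b, 0 <= b ->
    c * expR (- (K (nx X))%:R * b) <= gen (@swap N K) (jump_rate b) (h b) w.
Proof.
move=> ww hw /(@defect_to_segregated k _ _ _)/word_order_first_swap L.
have ew : word k w = (nseq (K X) X ++ nseq (K (nx X)).-1 (nx X)) ++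
    nx X :: nx (nx X) :: nseq (K (nx (nx X))).-1 (nx (nx X)).
  rewrite ww /seg_word -catA; congr (_ ++ _); rewrite -nseqSr prednK//.
  by case: (K (nx (nx X))) (K0 (nx (nx X))).
have [a1 a2] := word_at hK ew.
have [|c c0 hc] := L (swap (site_at k (size (nseq (K X) X ++ nseq (K (nx X)).-1 (nx X)))) w).
  by rewrite (word_swap hK ew) -catA.
exists c => // b b0; rewrite /gen.
rewrite (bigD1 (site_at k (size (nseq (K X) X ++ nseq (K (nx X)).-1 (nx X)))))//=.
rewrite -[leLHS]addr0; apply: lerD; last first.
  by apply: sumr_ge0 => q _; rewrite hw subr0 mulr_ge0// ltW// jump_rate_gt0.
rewrite hw subr0 jump_rateE a1 a2 slow_pairE eqxx.
have -> : (K (nx X))%:R = (K (nx X)).-1%:R + 1 :> R.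
  by rewrite natr1 prednK//.
rewrite opprD mulrDl expRD mulN1r mulrA mulrC ler_wpM2l ?expR_ge0//.
exact: hc.
Qed.

End LowerBound.

(** * The limit rates *)

Section Rates.
Context {R : realType} {N : nat} {K : species -> nat}.
Local Notation n := (N.*2).+1.
Local Notation config := {w : {ffun site N -> species} | @has_counts N K w}.
Hypothesis hK : (K A + K B + K C)%N = n.
Hypothesis K3 : forall a, (2 < K a)%N.
Local Open Scope classical_set_scope.
Local Open Scope ring_scope.

Let K2 a : (1 < K a)%N. Proof. exact: ltnW (K3 a). Qed.
Let K0 a : (0 < K a)%N. Proof. exact: ltnW (K2 a). Qed.

(** The block of C ends just before the site of index [k]. *)
Lemma segregated_inj : injective (@segregated N K hK).
Proof.
move=> i j e.
(* the site before l is the last one of its block of C's *)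
have bd l : at_site (segregated hK l) (site_at l N.*2) = C /\
    at_site (segregated hK l) (next_site (site_at l N.*2)) = nx C.
  rewrite next_site_at site_atn !at_segregated !blockE dist_site_at modn_small//.
  rewrite /dist_from subrr /= K0; split => //.
  have := K0 C; rewrite -ltnS -hK => kc.
  by rewrite ifF ?ifF//; lia.
have [a1 a2] := bd i; have [a3 a4] := bd j; rewrite -e in a3 a4.
have := segregated_boundary K2 (segregated_in hK i) a1 a2 a3 a4.
by move=> /(congr1 (@next_site N)); rewrite !next_site_at !site_atn.
Qed.

Definition min_count := minn (K A) (minn (K B) (K C)).

Lemma min_count_le a : (min_count <= K a)%N.
Proof. by rewrite /min_count; case: a; rewrite !geq_min leqnn ?orbT. Qed.

Lemma min_count_next : exists X, K (nx X) = min_count.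
Proof.
rewrite /min_count /minn; case: ifP => _; first by exists C.
by case: ifP => _; [exists A|exists B].
Qed.

Lemma min_count_gt0 : (0 < min_count)%N.
Proof. by have [X <-] := min_count_next. Qed.

Lemma segregated_reachable : reachable_set (@swap N K) (segregated_set hK).
Proof.
move=> D [x xD] cD; exists (segregated hK ord0); last exact: segregated_in.
by apply: (@swap_closed_full _ _ _ x) => // y k; exact: cD.
Qed.

Lemma power_law_jump_rate p (x : config) : power_law (fun b : R => jump_rate b p x).
Proof.
case s: (slow_pair (at_site x p) (at_site x (next_site p))).
  apply: (@power_law_ext R (fun b => expR (-1 * b))); last exact: power_law_expR.
  by move=> b; rewrite jump_rateE s mulN1r.
apply: (@power_law_ext R (fun=> 1)); last exact: (power_law_cst ler01).
by move=> b; rewrite jump_rateE s.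
Qed.

(** For [i != j] the upper bound is applied to [1 - H b _ w_i], the probability
    to enter the segregated set elsewhere, which is at least [H b _ w_j] and
    vanishes at [w_i]. The lower bound is applied to a species [nx X] with the
    least number of particles. *)
Theorem trace_rates : exists (H : R -> config -> config -> R) phi (r : site N -> site N -> R),
  [/\ harmonic_extension (@swap N K) (@jump_rate N K R) (segregated_set hK) H phi,
      forall i j, i != j -> 0 < r i j
    & forall i j, i != j ->
      expR (min_count%:R * b) *
        gen (@swap N K) (jump_rate b) (H b ^~ (segregated hK j)) (segregated hK i)
      @[b --> +oo] --> r i j].
Proof.
have [|||H [phi hH]] := @harmonic_extension_exists R _ _ (@swap N K) (@jump_rate N K R) (segregated_set hK).
- by move=> b i x; exact: jump_rate_gt0.
- exact: power_law_jump_rate.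
- exact: segregated_reachable.
have H1 b x j : H b x j <= 1.
  by rewrite -(hext_sum hH b x) (bigD1 j)//= lerDl sumr_ge0// => y _; exact: (hext_ge0 hH).
suff lim i j : i != j -> exists2 l : R, 0 < l & expR (min_count%:R * b) *
        gen (@swap N K) (jump_rate b) (H b ^~ (segregated hK j)) (segregated hK i)
      @[b --> +oo] --> l.
  have /choice[r hr] (ij : site N * site N) : exists l : R, ij.1 != ij.2 -> 0 < l /\
     expR (min_count%:R * b) *
        gen (@swap N K) (jump_rate b) (H b ^~ (segregated hK ij.2)) (segregated hK ij.1)
      @[b --> +oo] --> l.
    case: ij => i j /=; have [->|ij] := eqVneq i j; first by exists 0.
    by have [l l0 hl] := lim _ _ ij; exists l.
  exists H, phi, (fun i j => r (i, j)); split => // i j ij.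
    by have [] := hr (i, j) ij.
  by have [] := hr (i, j) ij.
move=> ij; have sij : segregated hK i != segregated hK j.
  by apply: contra ij => /eqP/segregated_inj ->.
have Hi b : H b (segregated hK i) (segregated hK j) = 0.
  by rewrite (hext_in hH) ?segregated_in// (negbTE sij).
have [X KX] := min_count_next.
have [k kw] := segregated_word hK K0 X i.
have [k' kw'] := segregated_word hK K0 X j.
have [||||c c0 hc] := @escape_lower R N K hK K2 (fun b x => H b x (segregated hK j)) _ _ k k' X (segregated hK i) kw.
- by move=> b x; exact: (hext_ge0 hH).
- by move=> b x xS; apply: (hext_harm hH).
- by [].
- move=> x xw; have -> : x = segregated hK j by apply: (@word_inj _ _ k'); rewrite xw.
  exists 1 => // b b0; rewrite (hext_in hH) ?segregated_in// eqxx mul1r.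
  by rewrite oppr0 mul0r expR0.
rewrite KX in hc.
have pg : power_law (fun b => gen (@swap N K) (jump_rate b) (H b ^~ (segregated hK j)) (segregated hK i)).
  apply: (@power_law_ext _ (fun b => \sum_p jump_rate b p (segregated hK i) * H b (swap p (segregated hK i)) (segregated hK j))).
    by move=> b; apply: eq_bigr => p _; rewrite Hi subr0.
  apply: power_law_sum => p _; apply: power_lawM; [exact: power_law_jump_rate|exact: (hext_power hH)].
apply: (power_law_limit (C := (n * #|{: config}|)%:R) pg c0) => b b0.
rewrite hc//=.
(* u vanishes at segregated i and bounds H b _ (segregated j) from above *)
pose u x := 1 - H b x (segregated hK i).
apply: (@le_trans _ _ (gen (@swap N K) (jump_rate b) u (segregated hK i))).
  apply: ler_sum => p _; rewrite ler_wpM2l ?(ltW (jump_rate_gt0 _ _ _))//.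
  rewrite Hi subr0 /u (hext_in hH b (x := segregated hK i)) ?segregated_in// eqxx subrr subr0.
  rewrite lerBrDr -(hext_sum hH b (swap p (segregated hK i))).
  rewrite (bigD1 (segregated hK j))//= (bigD1 (segregated hK i))//= addrA lerDl sumr_ge0//.
  by move=> y _; exact: (hext_ge0 hH).
apply: (@valley_escape N K hK K0 min_count min_count_le i R b u) => //.
- by move=> x; rewrite /u subr_ge0 H1 gerBl (hext_ge0 hH).
- exact: min_count_gt0.
- move=> x xV xi.
  have xS : x \notin segregated_set hK.
    apply/negP => /imsetP[l _ xl]; move/eqP: xi; apply.
    by apply: (valley_stable hK K0 min_count_le xV) => p; rewrite xl segregated_not_fast.
  rewrite (_ : u = (fun=> 1) \+ (fun x => -1 * H b x (segregated hK i))); last first.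
    by apply/funext => y; rewrite /u /= mulN1r.
  by rewrite generatorD generator_cst generatorZ (hext_harm hH)// mulr0 addr0.
Qed.

End Rates.

(** * Paths that agree on a fine grid *)

Section RealInduction.
Context {R : realType}.
Implicit Types (u v s t : R).

(** The supremum of the [s] such that [P] holds on [[0, s]] belongs to this set
    by the third hypothesis, and is not below [v] by the second one. Local
    statements on cadlag paths are extended to bounded intervals in this way,
    in place of a compactness argument. *)
Lemma real_induction (P : R -> Prop) :
  P 0 ->
  (forall v, 0 <= v -> P v -> exists2 e, 0 < e & forall u, v < u < v + e -> P u) ->
  (forall v, 0 < v -> (forall u, 0 <= u < v -> P u) -> P v) ->
  forall v, 0 <= v -> P v.
Proof.
move=> P0 Pr Pl v v0; apply: contrapT => nPv.
pose D : set R := [set s | 0 <= s /\ forall u, 0 <= u <= s -> P u]%classic.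
have D0 : D 0.
  split=> // u /andP[u0 u0']; have -> : u = 0 by apply/eqP; rewrite eq_le u0 u0'.
  exact: P0.
have Dv s : D s -> s <= v.
  by move=> [s0 h]; rewrite leNgt; apply/negP => vs; apply: nPv; apply: h; rewrite v0 ltW.
have supD : has_sup D by split; [exists 0|exists v => s /Dv].
pose s := sup D.
have s0 : 0 <= s by apply: ub_le_sup => //; exists v => ? /Dv.
have below u : 0 <= u < s -> P u.
  move=> /andP[u0 us]; have e0 : 0 < s - u by rewrite subr_gt0.
  have [w [w0 h]] := sup_adherent e0 supD; rewrite opprB addrC subrK => uw.
  by apply: h; rewrite u0 ltW.
have Ps : P s.
  by move: s0; rewrite le_eqVlt => /predU1P[<-//|s0]; apply: Pl.
have [e e0 he] := Pr _ s0 Ps.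
have : D (s + e / 2).
  split; first by rewrite addr_ge0// divr_ge0// ltW.
  move=> u /andP[u0 ul]; case: (ltgtP u s) => us; last by rewrite us.
    by apply: below; rewrite u0.
  by apply: he; rewrite us/=; lra.
move=> /(ub_le_sup (ex_intro _ v (fun _ => @Dv _))) ; rewrite -/s; lra.
Qed.

Lemma nbhs_right_ex (P : R -> Prop) t : (\forall s \near t^'+, P s)%classic ->
  exists2 e, 0 < e & forall s, t < s < t + e -> P s.
Proof.
move=> [e /= e0 h]; exists e => // s /andP[ts se]; apply: h => //=.
by rewrite distrC ger0_norm; lra.
Qed.

Lemma nbhs_left_ex (P : R -> Prop) t : (\forall s \near t^'-, P s)%classic ->
  exists2 e, 0 < e & forall s, t - e < s < t -> P s.
Proof.
move=> [e /= e0 h]; exists e => // s /andP[ts se]; apply: h => //=.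
by rewrite ger0_norm; lra.
Qed.

Lemma near_rightI (P : R -> Prop) t e : 0 < e -> (forall s, t < s < t + e -> P s) ->
  (\forall s \near t^'+, P s)%classic.
Proof.
move=> e0 h; exists e => //= s; rewrite /ball_ /= distrC => se ts; apply: h.
by rewrite ts/=; move: se; rewrite ger0_norm; lra.
Qed.

Lemma near_leftI (P : R -> Prop) t e : 0 < e -> (forall s, t - e < s < t -> P s) ->
  (\forall s \near t^'-, P s)%classic.
Proof.
move=> e0 h; exists e => //= s; rewrite /ball_ /= => se ts; apply: h.
by rewrite ts andbT; move: se; rewrite ger0_norm; lra.
Qed.

End RealInduction.

Section Paths.
Context {R : realType} {E : finType}.
Implicit Types (x z : R -> E) (l : R -> R) (d s t u v w : R).

Lemma cadlag_right x t : cadlag x -> 0 <= t ->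
  exists2 e, 0 < e & forall s, t <= s < t + e -> x s = x t.
Proof.
move=> [cr _] /cr /nbhs_right_ex[e e0 h]; exists e => // s /andP[].
by rewrite le_eqVlt => /predU1P[<-//|ts se]; apply: h; rewrite ts.
Qed.

Lemma cadlag_left x t : cadlag x -> 0 < t ->
  exists2 e, 0 < e <= t & exists a, forall s, t - e < s < t -> x s = a.
Proof.
move=> [_ cl] t0; have [a /nbhs_left_ex[e e0 h]] := cl _ t0.
exists (Num.min e t); first by rewrite lt_min e0 t0 ge_min lexx orbT.
exists a => s /andP[ts st]; apply: h; rewrite st andbT (le_lt_trans _ ts)//.
by rewrite lerD2l lerN2 ge_min lexx.
Qed.

(** Among any three times at least two successive ones have the same value: the
    path takes at most two values on [[u, v]], the first of them up to some
    time and the second from then on. *)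
Definition one_change z u v : Prop :=
  forall u1 u2 u3, u <= u1 -> u1 < u2 -> u2 < u3 -> u3 <= v ->
    z u1 = z u2 \/ z u2 = z u3.

(** A cadlag path with values in a discrete space has finitely many jumps on a
    bounded interval, hence a positive least distance between them. *)
Lemma cadlag_separated x : cadlag x -> forall v, 0 <= v ->
  exists2 e, 0 < e & forall u1 u2 u3, 0 <= u1 -> u1 < u2 -> u2 < u3 -> u3 <= v ->
    u3 - u1 < e -> x u1 = x u2 \/ x u2 = x u3.
Proof.
move=> cx; apply: real_induction.
- by exists 1 => // u1 u2 u3 *; exfalso; lra.
- move=> v v0 [e e0 he]; have [f f0 hf] := cadlag_right cx v0.
  exists f => // u /andP[vu uf].
  have [g /andP[g0 gv] [a ha]] : exists2 g, 0 < g <= v + 1 & exists a, forall s, 0 <= s -> v - g < s < v -> x s = a.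
    move: v0; rewrite le_eqVlt => /predU1P[<-|v0].
      by exists 1; [lra|exists (x 0) => s s0 /andP[? ?]; exfalso; lra].
    by have [g /andP[g0 gv] [a ha]] := cadlag_left cx v0; exists g; [lra|exists a => s _; exact: ha].
  exists (Num.min e g); first by rewrite lt_min e0 g0.
  move=> u1 u2 u3 h1 h2 h3 h4; rewrite lt_min => /andP[h5 h6].
  have [h7|h7] := leP u3 v; first exact: he.
  have [h8|h8] := leP v u2; first by right; rewrite !hf//; lra.
  by left; rewrite !ha//; lra.
- move=> v v0 IH; have [g /andP[g0 gv] [a ha]] := cadlag_left cx v0.
  have [|e e0 he] := IH (v - g / 2); first by lra.
  exists (Num.min e (g / 2)); first by rewrite lt_min e0 divr_gt0.
  move=> u1 u2 u3 h1 h2 h3 h4; rewrite lt_min => /andP[h5 h6].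
  have [h7|h7] := leP u3 (v - g / 2); first exact: he.
  by left; rewrite !ha//; lra.
Qed.

(** [z] agrees with [x] at the points of the grid of mesh [d] up to time [G],
    and changes at most once in each cell. No such condition is put on [x]: for
    small [d] it is satisfied automatically, by [cadlag_separated]. *)
Definition close d G z x : Prop :=
  forall i : nat, i.+1%:R * d <= G ->
    [/\ z (i%:R * d) = x (i%:R * d), z (i.+1%:R * d) = x (i.+1%:R * d)
      & one_change z (i%:R * d) (i.+1%:R * d)].

Lemma grid_cell d s : 0 < d -> 0 <= s ->
  exists i : nat, i%:R * d <= s < i.+1%:R * d.
Proof.
move=> d0 s0; exists (Num.truncn (s / d)).
have := truncn_itv (divr_ge0 s0 (ltW d0)).
by rewrite ler_pdivlMr// ltr_pdivrMr.
Qed.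

Lemma close_const_cell d G z x u v a s (i : nat) : 0 < d -> close d G z x -> v <= G ->
  (forall s, u <= s <= v -> x s = a) -> u <= i%:R * d -> i.+1%:R * d <= v ->
  i%:R * d <= s <= i.+1%:R * d -> z s = a.
Proof.
move=> d0 cl vG xa ui iv /andP[i1 i2].
have [|e1 e2 o] := cl i; first by lra.
have x1 : x (i%:R * d) = a by apply: xa; rewrite ui; move: iv; rewrite -natr1; lra.
have x2 : x (i.+1%:R * d) = a by apply: xa; rewrite iv; move: iv; rewrite -natr1; lra.
move: i1; rewrite le_eqVlt => /predU1P[<-|i1]; first by rewrite e1.
move: i2; rewrite le_eqVlt => /predU1P[->|i2]; first by rewrite e2.
by have := o _ _ _ (lexx _) i1 i2 (lexx _); rewrite e1 e2 x1 x2 => -[].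
Qed.

(** If [x] is constant on an interval then [z] takes the same value twice on
    each cell inside it, so that [z] has no change there. *)
Lemma close_const d G z x u v a s : 0 < d -> close d G z x -> v <= G -> 0 <= u ->
  (forall s, u <= s <= v -> x s = a) -> u + d <= s <= v - d -> z s = a.
Proof.
move=> d0 cl vG u0 xa /andP[us sv].
have [|i /andP[i1 i2]] := grid_cell d0 (s := s); first by lra.
apply: (close_const_cell (i := i) d0 cl vG xa); rewrite -?natr1 in i2 *; lra.
Qed.

(** The time change [l] up to [w], then affine until it has the value [q] at
    [v], then of slope 1. *)
Definition bend l w v q s : R :=
  if s <= w then l s else if s <= v then l w + (s - w) * ((q - l w) / (v - w))
  else q + (s - v).

Lemma time_change0 l : time_change l -> l 0 = 0.
Proof.
move=> [[fl _ sl] inc].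
have [s /= s0 ls] : ((fun y => exists2 s, (`[0, +oo[)%classic s & l s = y) : R -> Prop) 0.
  by have := sl 0; apply; rewrite /= in_itv /= lexx.
rewrite /= in_itv/= andbT in s0.
case: (eqVneq s 0) => [s00|sn0]; first by rewrite s00 in ls.
have := inc 0 s (lexx _); rewrite lt0r sn0 s0 ls => /(_ isT) l0.
have := fl 0; rewrite /= !in_itv/= !andbT lexx => /(_ isT); by rewrite leNgt l0.
Qed.

Lemma time_change_intro l : (forall s t, 0 <= s -> s < t -> l s < l t) ->
  l 0 = 0 -> (forall y, 0 <= y -> exists2 s, 0 <= s & l s = y) -> time_change l.
Proof.
move=> inc l0 sur; split => //; split.
- move=> s /=; rewrite !in_itv/= !andbT => s0.
  move: s0; rewrite le_eqVlt => /predU1P[<-|s0]; first by rewrite l0.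
  by rewrite -l0 ltW// inc.
- move=> s t; rewrite !inE/= !in_itv/= !andbT => s0 t0 e.
  by case: (ltgtP s t) => // /inc; [move=> /(_ s0)|move=> /(_ t0)]; rewrite e ltxx.
- move=> y; rewrite /= in_itv/= andbT => /sur[s s0 <-]; exists s => //=.
  by rewrite in_itv/= s0.
Qed.

Lemma time_change_sur l y : time_change l -> 0 <= y -> exists2 s, 0 <= s & l s = y.
Proof.
move=> [[_ _ sl] _] y0; have := sl y; rewrite /= in_itv/= y0 => /(_ isT)[s].
by rewrite /= in_itv/= andbT; exists s.
Qed.

Lemma time_change_id : time_change (idfun : R -> R).
Proof. by apply: time_change_intro => // y y0; exists y. Qed.

Lemma bend_time_change l w v q : time_change l -> 0 <= w -> w < v -> l w < q ->
  time_change (bend l w v q).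
Proof.
move=> tl w0 wv lq; have l0 := time_change0 tl; have [_ inc] := tl.
have lw0 : 0 <= l w.
  by move: w0; rewrite le_eqVlt => /predU1P[<-|w0]; rewrite ?l0// -l0 ltW// inc.
pose k := (q - l w) / (v - w).
have k0 : 0 < k by rewrite divr_gt0 ?subr_gt0.
have kv : (v - w) * k = q - l w by rewrite /k mulrC divfK// gt_eqF ?subr_gt0.
apply: time_change_intro.
- move=> s t s0 st; rewrite /bend -/k.
  case: (leP t w) => tw; first by rewrite ifT ?inc//; lra.
  case: (leP s w) => sw.
    have lsw : l s <= l w.
      by move: sw; rewrite le_eqVlt => /predU1P[->//|sw]; rewrite ltW ?inc.
    case: (leP t v) => tv; last by lra.
    have : 0 < (t - w) * k by rewrite mulr_gt0// subr_gt0.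
    lra.
  case: (leP t v) => tv.
    by rewrite ifT ?ltrD2l ?ltr_pM2r ?ltrD2r//; lra.
  case: (leP s v) => sv; last by lra.
  have : (s - w) * k <= (v - w) * k by apply: ler_wpM2r; [exact: ltW|lra].
  lra.
- by rewrite /bend w0.
- move=> y y0; have [y1|y1] := leP y (l w).
    have [s s0 ls] := time_change_sur tl y0; exists s => //.
    rewrite /bend ifT// leNgt; apply/negP => /(inc _ _ w0); rewrite ls; lra.
  have [y2|y2] := leP y q.
    exists (w + (y - l w) / k).
      by rewrite addr_ge0// divr_ge0// ?ltW// subr_gt0.
    rewrite /bend -/k ifF; last first.
      by apply/negbTE; rewrite -ltNge ltrDl divr_gt0 ?subr_gt0.
    rewrite ifT; last by rewrite -lerBrDl ler_pdivrMr// kv lerD2r.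
    by rewrite (addrC w) addrK divfK ?gt_eqF//; lra.
  exists (v + (y - q)); first by lra.
  by rewrite /bend !ifF; [lra|apply/negbTE; rewrite -ltNge; lra|apply/negbTE; rewrite -ltNge; lra].
Qed.

Lemma bend_dist l w v q d : 0 <= w -> w < v -> (forall s, 0 <= s -> `|l s - s| <= d) ->
  `|q - v| <= d -> forall s, 0 <= s -> `|bend l w v q s - s| <= d.
Proof.
move=> w0 wv ld qv s s0; rewrite /bend; case: (leP s w) => sw; first exact: ld.
case: (leP s v) => sv; last by rewrite (_ : q + (s - v) - s = q - v)//; lra.
have := ld _ w0; move: qv; rewrite !ler_norml => /andP[h1 h2] /andP[h3 h4].
pose k := (s - w) / (v - w).
have -> : (s - w) * ((q - l w) / (v - w)) = k * (q - l w) by rewrite /k; ring.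
have es : s = w + k * (v - w) by rewrite /k divfK ?gt_eqF ?subr_gt0//; lra.
have k0 : 0 <= k by rewrite divr_ge0// ?subr_ge0 ltW.
have k1 : k <= 1 by rewrite ler_pdivrMr ?subr_gt0// mul1r; lra.
rewrite es.
clearbody k; clear es.
have -> : l w + k * (q - l w) - (w + k * (v - w)) = (1 - k) * (l w - w) + k * (q - v) by ring.
nra.
Qed.

(** Right-continuity decides which value is taken at the time of the change. *)
Lemma one_change_split z u v : cadlag z -> 0 <= u -> u < v -> one_change z u v ->
  z u <> z v -> exists2 q, u < q <= v &
    (forall s, u <= s < q -> z s = z u) /\ (forall s, q <= s <= v -> z s = z v).
Proof.
move=> cz u0 uv o nz.
have two s : u <= s <= v -> z s = z u \/ z s = z v.
  move=> /andP[]; rewrite le_eqVlt => /predU1P[<-|us]; first by left.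
  rewrite le_eqVlt => /predU1P[->|sv]; first by right.
  by have [->|->] := o _ _ _ (lexx _) us sv (lexx _); [left|right].
pose D : set R := [set s | u <= s <= v /\ z s = z u]%classic.
have Du : D u by split => //; rewrite lexx ltW.
have supD : has_sup D by split; [exists u|exists v => s [/andP[]]].
pose q := sup D.
have uq : u <= q by apply: ub_le_sup => //; exists v => s [/andP[]].
have qv : q <= v by apply: ge_sup; [exists u|move=> s [/andP[]]].
have below s : u <= s < q -> z s = z u.
  move=> /andP[us sq]; have e0 : 0 < q - s by rewrite subr_gt0.
  have [w [/andP[w1 w2] zw]] := sup_adherent e0 supD; rewrite opprB addrC subrK => sw.
  have [//|zs] : z s = z u \/ z s = z v by apply: two; lra.
  move: us; rewrite le_eqVlt => /predU1P[<-//|us].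
  by have [->//|] := o _ _ _ (lexx _) us sw w2; rewrite zw.
have above s : q < s <= v -> z s = z v.
  move=> /andP[qs sv]; have [zs|//] : z s = z u \/ z s = z v by apply: two; lra.
  exfalso; have : D s by split => //; lra.
  by move=> /(ub_le_sup (ex_intro _ v (fun w (h : D w) => proj2 (andP h.1)))); rewrite -/q; lra.
have zq : z q = z v.
  have [zq|//] : z q = z u \/ z q = z v by apply: two; lra.
  have [e e0 he] := cadlag_right cz (le_trans u0 uq).
  have qv' : q < v by rewrite lt_neqAle qv andbT; apply/eqP => qv'; apply: nz; rewrite -qv'.
  have m1 : q < Num.min v (q + e / 2) by rewrite lt_min qv'/=; lra.
  have m2 : Num.min v (q + e / 2) <= q + e / 2 by rewrite ge_min lexx orbT.
  have m3 : Num.min v (q + e / 2) <= v by rewrite ge_min lexx.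
  by rewrite -(above (Num.min v (q + e / 2))) ?he ?m1//; lra.
exists q; last split => //.
  rewrite qv andbT lt_neqAle uq andbT; apply/eqP => uq'; apply: nz.
  by rewrite {1}uq' zq.
by move=> s /andP[]; rewrite le_eqVlt => /predU1P[<-//|qs sv]; apply: above; rewrite qs.
Qed.

Lemma close_le d G G' z x : G <= G' -> close d G' z x -> close d G z x.
Proof. by move=> GG cl i iG; apply: cl; exact: le_trans iG GG. Qed.

(** By real induction on the horizon [v], along which the time change is bent
    at each jump of [x]: it maps the jump of [x] at [v] to the jump of [z],
    which is in the same cell of the grid and therefore at distance at most
    [d].

    The last condition, that [z] keeps the value [x v] for a while after [l v],
    makes the induction work across an interval on which [x] is constant: up to
    the next point of the grid the hypothesis [close] alone would say nothing
    about [z]. *)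
Lemma close_time_change x : cadlag x -> forall v, 0 <= v -> exists2 d0, 0 < d0 &
  forall d z, 0 < d < d0 -> cadlag z -> close d (v + 1) z x ->
  exists l, [/\ time_change l, forall s, 0 <= s -> `|l s - s| <= d,
    forall s, 0 <= s <= v -> z (l s) = x s &
    forall s, l v <= s <= v + 2 * d -> z s = x v].
Proof.
move=> cx.
have right v : 0 <= v -> exists2 f, 0 < f <= 1 & forall s, v <= s < v + f -> x s = x v.
  move=> v0; have [f f0 hf] := cadlag_right cx v0; exists (Num.min f 1).
    by rewrite lt_min f0 ge_min lexx orbT ltr01.
  move=> s /andP[vs sf]; apply: hf; rewrite vs (lt_le_trans sf)// lerD2l.
  by rewrite ge_min lexx.
apply: real_induction.
- have [f /andP[f0 f1] hf] := right 0 (lexx _).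
  exists (f / 8); first by rewrite divr_gt0.
  move=> d z /andP[d0 df] cz cl; exists idfun.
  have zc s : 0 <= s <= 2 * d -> z s = x 0.
    move=> /andP[s0 sd]; have [i /andP[i1 i2]] := grid_cell d0 s0.
    have i0 : (0 : R) <= i%:R * d by rewrite mulr_ge0// ltW.
    apply: (@close_const_cell d _ z x 0 (f / 2) _ s i d0 cl) => //; first by lra.
    + by move=> t /andP[t0 tf]; apply: hf; lra.
    + by move: i2; rewrite -natr1; lra.
    + by rewrite i1 ltW.
  split; [exact: time_change_id|by move=> s _; rewrite subrr normr0 ltW| |].
    move=> s /andP[s0 s0']; have -> : s = 0 by apply/eqP; rewrite eq_le s0 s0'.
    by apply: zc; lra.
  by move=> s; rewrite add0r; exact: zc.
- move=> v v0 [d1 d10 H]; have [f /andP[f0 f1] hf] := right v v0.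
  exists f => // u /andP[vu uf].
  exists (Num.min d1 ((v + f - u) / 8)); first by rewrite lt_min d10 divr_gt0// subr_gt0.
  move=> d z /andP[d0]; rewrite lt_min => /andP[dd1 df] cz cl.
  have [||l [tl ld lz lv]] := H d z _ cz.
  - by rewrite d0.
  - by apply: close_le cl; lra.
  have := ld _ v0; rewrite ler_norml => /andP[lv1 lv2].
  have zc y : l v <= y <= u + 2 * d -> z y = x v.
    move=> /andP[y1 y2]; have [y3|y3] := leP y (v + 2 * d); first by apply: lv; rewrite y1.
    apply: (@close_const d _ z x v ((v + f + u) / 2) _ y d0 cl) => //; try lra.
    by move=> s /andP[s1 s2]; apply: hf; lra.
  have bE s : v < s -> s <= u -> bend l v u (l v + (u - v)) s = l v + (s - v).
    move=> vs su; rewrite /bend ifF; last by apply/negbTE; rewrite -ltNge.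
    by rewrite su (_ : l v + (u - v) - l v = u - v) ?divff ?mulr1 ?subr_eq0 ?gt_eqF//; ring.
  exists (bend l v u (l v + (u - v))); split.
  + by apply: bend_time_change => //; lra.
  + by apply: bend_dist => //; rewrite (_ : l v + (u - v) - u = l v - v) ?ld//; ring.
  + move=> s /andP[s0 su]; have [sv|vs] := leP s v.
      by rewrite /bend sv lz// s0.
    by rewrite bE// zc ?hf//; lra.
  + by move=> s; rewrite bE// => sb; rewrite zc ?hf//; lra.
- move=> v v0 IH; have [g /andP[g0 gv] [c hc]] := cadlag_left cx v0.
  have [f /andP[f0 f1] hf] := right v (ltW v0).
  have w0 : 0 <= v - g / 2 by lra.
  have wv : v - g / 2 < v by lra.
  have [|d1 d10 H] := IH (v - g / 2); first by rewrite w0.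
  move: w0 wv H; set w := v - g / 2 => w0 wv H.
  have xw : x w = c by apply: hc; rewrite /w; lra.
  exists (Num.min d1 (Num.min (g / 16) (f / 16))).
    by rewrite !lt_min d10 !divr_gt0.
  move=> d z /andP[d0]; rewrite !lt_min => /and3P[dd1 dg df] cz cl.
  have [||l [tl ld lz lw]] := H d z _ cz.
  - by rewrite d0.
  - by apply: close_le cl; lra.
  have := ld _ w0; rewrite ler_norml => /andP[lw1 lw2].
  (* the cell that contains v; if v is on the grid, the cell on its left, as x
      may jump at v *)
  have [i [i1 i2]] : exists i : nat, i%:R * d < v /\ v <= i.+1%:R * d.
    have [i /andP[i1 i2]] := grid_cell d0 (ltW v0).
    move: i1; rewrite le_eqVlt => /predU1P[iv|i1]; last by exists i; rewrite i1 ltW.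
    case: i iv i2 => [|i] iv i2; first by exfalso; rewrite mul0r in iv; lra.
    by exists i; rewrite iv lexx -iv ltr_pM2r// ltr_nat.
  have i3 : i.+1%:R * d = i%:R * d + d by rewrite -natr1; ring.
  have [|e1 e2 o] := cl i; first by lra.
  have zi : z (i%:R * d) = c by rewrite e1 hc//; lra.
  have zi' : z (i.+1%:R * d) = x v by rewrite e2 hf//; lra.
  have zc y : l w <= y <= i%:R * d -> z y = c.
    move=> /andP[y1 y2]; have [y3|y3] := leP y (w + 2 * d).
      by rewrite lw ?xw// y1.
    move: y2; rewrite le_eqVlt => /predU1P[->//|y2].
    have y0 : 0 <= y by lra.
    have [j /andP[j1 j2]] := grid_cell d0 y0.
    apply: (@close_const_cell d _ z x w (i%:R * d) _ y j d0 cl) => //; try lra.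
    + by move=> s /andP[s1 s2]; apply: hc; rewrite /w in s1; lra.
    + rewrite ler_pM2r// ler_nat -(ltr_nat R) -(ltr_pM2r d0); exact: le_lt_trans y2.
  have za y : i.+1%:R * d <= y <= v + 2 * d -> z y = x v.
    move=> /andP[y1 y2]; have y0 : 0 <= y by lra.
    have [j /andP[j1 j2]] := grid_cell d0 y0.
    apply: (@close_const_cell d _ z x v (v + f / 2) _ y j d0 cl) => //; try lra.
    + by move=> s /andP[s1 s2]; apply: hf; lra.
    + apply: le_trans i2 _; rewrite ler_pM2r// ler_nat -ltnS -(ltr_nat R) -(ltr_pM2r d0).
      exact: le_lt_trans j2.
  (* q is the time at which z jumps, or v if x does not jump there *)
  have [q q1 [q2 q3]] : exists2 q, i%:R * d < q <= i.+1%:R * d &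
      (forall s, i%:R * d <= s < q -> z s = c) /\
      (forall s, q <= s <= i.+1%:R * d -> z s = x v).
    have [cv|cv] := eqVneq c (x v); last first.
      have [|||q q1 [q2 q3]] := one_change_split cz _ _ o.
      - by lra.
      - by lra.
      - by rewrite zi zi'; exact/eqP.
      - by exists q => //; rewrite -{1}zi -zi'.
    exists v; first by rewrite i1.
    have zz s : i%:R * d <= s <= i.+1%:R * d -> z s = c.
      move=> /andP[]; rewrite le_eqVlt => /predU1P[<-//|s1].
      rewrite le_eqVlt => /predU1P[->|s2]; first by rewrite zi' cv.
      by have := o _ _ _ (lexx _) s1 s2 (lexx _); rewrite zi zi' -cv => -[].
    by split => s hs; rewrite -?cv; apply: zz; lra.
  have lwq : l w < q by rewrite /w in lw2 *; lra.
  exists (bend l w v q); split.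
  + exact: bend_time_change.
  + by apply: bend_dist => //; rewrite ler_norml; lra.
  + move=> s /andP[s0 sv]; have [sw|ws] := leP s w.
      by rewrite /bend sw lz// s0.
    rewrite /bend ifF; last by apply/negbTE; rewrite -ltNge.
    rewrite sv; move: sv; rewrite le_eqVlt => /predU1P[->|sv].
      rewrite mulrC divfK ?gt_eqF ?subr_gt0// addrC subrK.
      by rewrite q3// lexx; lra.
    rewrite (hc s); last by rewrite /w in ws; lra.
    set y := l w + _; have y1 : l w <= y.
      by rewrite lerDl mulr_ge0 ?divr_ge0//; lra.
    have y2 : y < q.
      rewrite /y -ltrBrDl mulrA ltr_pdivrMr ?subr_gt0// mulrC ltr_pM2l ?subr_gt0//.
      by rewrite ltrD2r.
    by have [y3|y3] := leP y (i%:R * d); [apply: zc; rewrite y1|apply: q2; rewrite y2 ltW].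
  + move=> s; have -> : bend l w v q v = q.
      rewrite /bend ifF; last by apply/negbTE; rewrite -ltNge.
      by rewrite lexx mulrC divfK ?gt_eqF ?subr_gt0// addrC subrK.
    move=> /andP[s1 s2]; have [s3|s3] := leP s (i.+1%:R * d).
      by apply: q3; rewrite s1.
    by apply: za; rewrite s2 ltW.
Qed.

(** The time changes of [close_time_change] depend on the horizon; for each [m]
    the largest horizon that is allowed by [d m] and [G m] is taken. The
    alternative [z m = x] is there for grids on which no path satisfies
    [close]. *)
Lemma close_skorohod_cvg (x : R -> E) (z : nat -> R -> E) (d G : nat -> R) :
  cadlag x -> (forall m, cadlag (z m)) -> (forall m, 0 < d m) ->
  (d m @[m --> \oo] --> 0)%classic ->
  (forall T, \forall m \near \oo, T <= G m)%classic ->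
  (forall m, z m = x \/ close (d m) (G m) (z m) x) -> skorohod_cvg z x.
Proof.
move=> cx cz d0 dc Gc cl.
have /choice[e0 he] (T : nat) : exists e, 0 < e /\
  forall d z, 0 < d < e -> cadlag z -> close d (T%:R + 1) z x ->
  exists l, [/\ time_change l, forall s, 0 <= s -> `|l s - s| <= d &
    forall s, 0 <= s <= T%:R -> z (l s) = x s].
  have [e e0 h] := close_time_change cx (ler0n R T); exists e; split => // d' z' h1 h2 h3.
  by have [l [h4 h5 h6 _]] := h _ _ h1 h2 h3; exists l.
(* horizons for which the path number m is close enough to x *)
pose good m T := `[< d m < e0 T /\ T%:R + 1 <= G m >].
have /choice[l hl] m : exists l : R -> R, [/\ time_change l,
    forall s, 0 <= s -> `|l s - s| <= d m &
    forall T : nat, (T <= m)%N -> good m T ->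
    (forall s, 0 <= s <= T%:R -> z m (l s) = x s)].
  have [zm|clm] := cl m.
    exists idfun; split; [exact: time_change_id|by move=> s _; rewrite subrr normr0 ltW|].
    by move=> T _ _ s _; rewrite zm.
  have [[T /andP[Tm gT]]|ng] := pselect (exists T, (T <= m)%N && good m T).
    have ex : exists T, (T <= m)%N && good m T by exists T; rewrite Tm.
    have ub T' : (T' <= m)%N && good m T' -> (T' <= m)%N by move=> /andP[].
    have [T1 /andP[T1m /asboolP[g1 g2]] Tmax] := ex_maxnP ex ub.
    have [_ h] := he T1.
    have [||l [l1 l2 l3]] := h (d m) (z m) _ (cz m).
    - by rewrite d0.
    - exact: close_le g2 clm.
    exists l; split => // T' T'm gT' s /andP[s0 sT]; apply: l3.
    rewrite s0 (le_trans sT)// ler_nat; apply: Tmax; rewrite T'm; exact: gT'.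
  exists idfun; split; [exact: time_change_id|by move=> s _; rewrite subrr normr0 ltW|].
  by move=> T Tm gT; exfalso; apply: ng; exists T; rewrite Tm.
exists l; split.
- by move=> m; have [] := hl m.
- move=> e epos; have := dc => /cvgrPdist_le/(_ e epos); apply: filterS => m.
  rewrite sub0r normrN ger0_norm ?(ltW (d0 m))// => de s s0.
  by have [_ h _] := hl m; apply: le_trans de; exact: h.
- move=> T; pose T' := (Num.truncn `|T|).+1.
  have TT' : T <= T'%:R by rewrite (le_trans (ler_norm _))// ltW// truncnS_gt.
  have [e0' _] := he T'.
  have n1 : (\forall m \near \oo, d m < e0 T')%classic.
    have := dc => /cvgrPdist_lt/(_ _ e0'); apply: filterS => m.
    by rewrite sub0r normrN ger0_norm ?(ltW (d0 m)).
  near=> m => s /andP[s0 sT]; have [_ _ h] := hl m.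
  apply: (h T'); last by rewrite s0 (le_trans sT).
    by near: m; exact: nbhs_infty_ge.
  by apply/asboolP; split; near: m => //; exact: Gc.
Unshelve. all: by end_near.
Qed.

End Paths.

(** * Occupation times and Riemann sums *)

Section TimeSpent.
Context {R : realType} {E : finType}.
Variables (S : {set E}) (x : R -> E).
Hypothesis cx : cadlag x.
Implicit Types (d s t u v w h : R).
Local Notation mu := (@lebesgue_measure R).
Local Notation T := (time_spent S x).
Local Open Scope classical_set_scope.
Local Open Scope ring_scope.

Let B : set R := [set s | x s \in S].

Let measurable_extend u v a : u <= v -> measurable (`[0, u]%classic `&` B) -> 0 <= u ->
  (forall s, u < s < v -> x s = a) -> measurable (`[0, v]%classic `&` B).
Proof.
move=> uv mu0 u0 xa.
have mv : measurable ([set v] `&` B).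
  have [vB|vB] := boolP (x v \in S).
    rewrite (_ : _ `&` _ = [set v]); first exact: measurable_set1.
    by apply/seteqP; split => s /=; [move=> [-> _]|move=> ->; split].
  rewrite (_ : _ `&` _ = set0); first exact: measurable0.
  by apply/seteqP; split => s //= [->]; exact/negP.
have ma : measurable (`]u, v[%classic `&` B).
  have [aB|aB] := boolP (a \in S).
    rewrite (_ : _ `&` _ = `]u, v[%classic)//.
    by apply/seteqP; split => s /= [] //; rewrite in_itv/= => uv'; split => //; rewrite /B/= xa.
  rewrite (_ : _ `&` _ = set0); first exact: measurable0.
  apply/seteqP; split => s //= []; rewrite in_itv /B/= => sv; rewrite xa//; exact/negP.
rewrite (_ : _ `&` _ = (`[0, u]%classic `&` B) `|` ((`]u, v[%classic `&` B) `|` ([set v] `&` B))).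
  by apply: measurableU => //; exact: measurableU.
apply/seteqP; split => s /=; rewrite !in_itv/=.
  move=> [/andP[s0 sv] sB]; have [su|us] := leP s u; first by left; rewrite s0.
  right; have [e|sv'] := eqVneq s v; [by right|left; split => //].
  by rewrite lt_neqAle sv' sv.
by case=> [[/andP[s0 su] sB]|[[/andP[us sv] sB]|[-> vB]]]; split => //; lra.
Qed.

Lemma measurable_visits v : 0 <= v -> measurable (`[0, v]%classic `&` B).
Proof.
move: v; apply: real_induction.
- have [xB|xB] := boolP (x 0 \in S).
    rewrite (_ : _ `&` _ = [set 0]); first exact: measurable_set1.
    apply/seteqP; split => s /=; rewrite in_itv/=.
      by move=> [s0 _]; apply/eqP; rewrite eq_le andbC.
    by move=> ->; rewrite lexx.
  rewrite (_ : _ `&` _ = set0); first exact: measurable0.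
  apply/seteqP; split => s //=; rewrite in_itv/= => -[s0].
  rewrite /B/= (_ : s = 0); first exact/negP.
  by apply/eqP; rewrite eq_le andbC.
- move=> v v0 mv; have [e e0 he] := cadlag_right cx v0; exists e => // u /andP[vu ue].
  by apply: (measurable_extend (a := x v) (ltW vu) mv v0) => s /andP[vs su]; apply: he; lra.
- move=> v v0 IH; have [g /andP[g0 gv] [a ha]] := cadlag_left cx v0.
  apply: (@measurable_extend (v - g / 2) v a) => //; try lra.
    by apply: IH; lra.
  by move=> s /andP[? ?]; apply: ha; lra.
Qed.

Let mT v : mu (`[0, v]%classic `&` B) \is a fin_num.
Proof.
have [v0|v0] := leP 0 v; last first.
  by rewrite (_ : `[0, v]%classic = set0) ?set0I ?measure0//; apply: set_itv_ge; rewrite bnd_simp -ltNge.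
rewrite ge0_fin_numE// (@le_lt_trans _ _ (mu `[0, v]%classic))//.
  by apply: le_measure; rewrite ?inE//; exact: measurable_visits.
by rewrite lebesgue_measure_itv/=; case: ifP => _; rewrite ?ltry// -EFinB ltry.
Qed.

Lemma time_spentE v : 0 <= v -> T v = fine (mu (`[0, v]%classic `&` B)).
Proof.
move=> v0; rewrite /time_spent /Rintegral; congr fine.
transitivity (\int[mu]_(s in `[0%R, v]%classic) (\1_(`[0%R, v]%classic `&` B) s)%:E)%E.
  apply: eq_integral => s; rewrite inE /= => s0; rewrite indicE; congr (_%:E).
  rewrite in_setI mem_set//=; congr ((nat_of_bool _)%:R).
  by apply/idP/idP => h; [rewrite inE|move: h; rewrite inE].
rewrite integral_indic//; last exact: measurable_visits.
by rewrite setIAC setIid.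
Qed.

Let time_spent_diff u v : 0 <= u -> u <= v ->
  measurable (`]u, v]%classic `&` B) /\ T v = T u + fine (mu (`]u, v]%classic `&` B)).
Proof.
move=> u0 uv; have v0 := le_trans u0 uv.
have e : `]u, v]%classic `&` B = (`[0, v]%classic `&` B) `\` (`[0, u]%classic `&` B).
  apply/seteqP; split => s /=; rewrite !in_itv/=.
    move=> [/andP[us sv] sB]; split; first by split => //; lra.
    by move=> [/andP[_ su] _]; move: us; rewrite ltNge su.
  move=> [[/andP[s0 sv] sB] n]; split => //; rewrite sv andbT ltNge.
  by apply/negP => su; apply: n; rewrite s0.
have m : measurable (`]u, v]%classic `&` B).
  by rewrite e; apply: measurableD; exact: measurable_visits.
split => //; rewrite !time_spentE// -fineD//; last first.
  rewrite ge0_fin_numE// (le_lt_trans (y := mu (`[0, v]%classic `&` B)))//.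
    apply: le_measure; rewrite ?inE//; first exact: measurable_visits.
    by rewrite e; exact: subDsetl.
  by rewrite -ge0_fin_numE.
rewrite -measureU//; last 2 first.
- exact: measurable_visits.
- rewrite e; apply/seteqP; split => // s /= [h1 [_ h2]]; exact: h2.
congr (fine (mu _)); rewrite e setDUK//.
by move=> s /= [h1 sB]; split => //; move: h1; rewrite !in_itv/=; lra.
Qed.

Lemma time_spent0 : T 0 = 0.
Proof.
rewrite time_spentE//; have : (mu (`[0%R, 0%R]%classic `&` B) <= mu `[0%R, 0%R]%classic)%E.
  by apply: le_measure; rewrite ?inE//; exact: measurable_visits.
rewrite lebesgue_measure_itv/= ltxx => h.
by rewrite (_ : mu _ = 0%E)//; apply/eqP; rewrite eq_le h measure_ge0.
Qed.

(** On an interval where the path is constant (except possibly at the ends) the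
    occupation time grows at speed 1 or 0. *)
Lemma time_spent_const u v a : 0 <= u -> u <= v -> (forall s, u < s < v -> x s = a) ->
  T v = T u + (v - u) * (a \in S)%:R.
Proof.
move=> u0; rewrite le_eqVlt => /predU1P[<- _|uv xa]; first by rewrite subrr mul0r addr0.
have [m ->] := time_spent_diff u0 (ltW uv); congr (_ + _).
case aS: (a \in S); rewrite ?mulr1 ?mulr0.
  rewrite (_ : mu _ = (v - u)%:E)//; apply/eqP; rewrite eq_le; apply/andP; split.
    rewrite (@le_trans _ _ (mu `]u, v]%classic))//.
      by apply: le_measure; rewrite ?inE.
    by rewrite lebesgue_measure_itv/= lte_fin uv.
  rewrite (@le_trans _ _ (mu `]u, v[%classic))//.
    by rewrite lebesgue_measure_itv/= lte_fin uv.
  apply: le_measure; rewrite ?inE// => s /=; rewrite !in_itv/= => sv; split.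
    by move: sv => /andP[-> /ltW ->].
  by rewrite /B/= xa.
rewrite (_ : mu _ = 0%E)//.
apply: (@subset_measure0 _ _ _ mu _ [set v]) => //; last exact: lebesgue_measure_set1.
move=> s /=; rewrite in_itv/= => -[/andP[us]]; rewrite le_eqVlt => /predU1P[//|sv].
by rewrite /B/= xa ?us// aS.
Qed.

Lemma time_spent_mono u v : 0 <= u -> u <= v -> T u <= T v.
Proof. by move=> u0 /(time_spent_diff u0)[_ ->]; rewrite lerDl fine_ge0. Qed.

Lemma time_spent_lip u v : 0 <= u -> u <= v -> T v <= T u + (v - u).
Proof.
move=> u0 uv; have [m ->] := time_spent_diff u0 uv; rewrite lerD2l.
have h : (mu (`]u, v]%classic `&` B) <= (v - u)%:E)%E.
  rewrite (@le_trans _ _ (mu `]u, v]%classic))//.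
    by apply: le_measure; rewrite ?inE.
  rewrite lebesgue_measure_itv/= lte_fin; case: ifP => //.
  by rewrite lee_fin subr_ge0.
have fn : mu (`]u, v]%classic `&` B) \is a fin_num.
  by rewrite ge0_fin_numE// (le_lt_trans h)// ltry.
by rewrite -lee_fin fineK.
Qed.

(** [h * visits h i] is the Riemann sum of mesh [h] for the time spent in [S]
    up to time [i h]. *)
Definition visits h (i : nat) : nat := \sum_(j < i) (x (j%:R * h) \in S).

Lemma visitsS h i : visits h i.+1 = (visits h i + (x (i%:R * h) \in S))%N.
Proof. by rewrite /visits big_ord_recr. Qed.

Definition riemann_bound v (J : nat) : Prop := forall h (i : nat), 0 < h -> i%:R * h <= v ->
  `|h * (visits h i)%:R - T (i%:R * h)| <= J%:R * h.

Let riemann_extend u v a J : u <= v -> riemann_bound u J ->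
  0 <= u -> (forall s, u < s < v -> x s = a) -> riemann_bound v J.+2.
Proof.
move=> uv bu u0 xa h i h0 ih.
have hge (j : nat) : 0 <= j%:R * h by rewrite mulr_ge0// ltW.
have stp (j : nat) : `|h * (visits h j.+1)%:R - T (j.+1%:R * h) - (h * (visits h j)%:R - T (j%:R * h))| <= h.
  have l1 := time_spent_lip (hge j) (v := j.+1%:R * h).
  have l2 := time_spent_mono (hge j) (v := j.+1%:R * h).
  have e : j.+1%:R * h = j%:R * h + h by rewrite -natr1; ring.
  rewrite e in l1 l2 *; have {}l1 := l1 _; have {}l2 := l2 _.
  rewrite visitsS natrD mulrDr ler_norml.
  have [l3 l4] : T (j%:R * h + h) <= T (j%:R * h) + h /\ T (j%:R * h) <= T (j%:R * h + h).
    by split; [apply: le_trans (l1 _) _; lra|apply: l2; lra].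
  by case: (_ \in S); rewrite ?mulr1 ?mulr0; lra.
have [i0 i0u] := grid_cell h0 u0.
have e0 : i0.+1%:R * h = i0%:R * h + h by rewrite -natr1; ring.
have [ii0|i0i] := leqP i i0.
  have iu : i%:R * h <= u.
    move: i0u => /andP[i0u _]; apply: le_trans i0u.
    by apply: ler_wpM2r; [exact: ltW|rewrite ler_nat].
  apply: (le_trans (bu h i h0 iu)).
  by apply: ler_wpM2r; [exact: ltW|rewrite ler_nat; lia].
(* the cell that contains u adds an error; the later cells add none, as the
   path is constant on them *)
have st1 : `|h * (visits h i0.+1)%:R - T (i0.+1%:R * h)| <= J.+1%:R * h.
  have := stp i0; have := bu h i0 h0; move: i0u => /andP[-> _] /(_ isT).
  rewrite -(natr1 J) mulrDl mul1r !ler_norml; lra.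
elim: i ih i0i => // i IH ih; rewrite ltnS leq_eqVlt => /predU1P[ei|i0i].
  rewrite -ei; apply: (le_trans st1).
  by apply: ler_wpM2r; [exact: ltW|rewrite ler_nat].
have e1 : i.+1%:R * h = i%:R * h + h by rewrite -natr1; ring.
have {}IH : `|h * (visits h i)%:R - T (i%:R * h)| <= J.+2%:R * h by apply: IH => //; lra.
have ui : u < i%:R * h.
  move: i0u => /andP[_ ui0]; apply: (lt_le_trans ui0).
  by apply: ler_wpM2r; [exact: ltW|rewrite ler_nat].
have Te := @time_spent_const (i%:R * h) (i.+1%:R * h) a (hge i) _ _.
rewrite visitsS natrD mulrDr Te; last 2 first.
- by rewrite e1; lra.
- by move=> s /andP[s1 s2]; apply: xa; lra.
have -> : x (i%:R * h) = a by apply: xa; lra.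
have -> : i.+1%:R * h - i%:R * h = h by lra.
by rewrite (_ : _ - _ = h * (visits h i)%:R - T (i%:R * h))//; ring.
Qed.

(** The error is at most [h] in each cell in which the path changes and 0 in
    the other ones, and on a bounded interval the number of changes does not
    depend on [h]. *)
Lemma riemann_visits v : 0 <= v -> exists J, riemann_bound v J.
Proof.
move: v; apply: real_induction.
- exists 0%N => h i h0 ih; have -> : i = 0%N.
    by apply/eqP; case: i ih => // i; rewrite pmulr_lle0// lern0.
  by rewrite !mul0r time_spent0 /visits big_ord0 mulr0 subrr normr0.
- move=> v v0 [J hJ]; have [e e0 he] := cadlag_right cx v0; exists e => // u /andP[vu ue].
  exists J.+2; apply: (riemann_extend (a := x v) (ltW vu) hJ v0).
  by move=> s /andP[? ?]; apply: he; lra.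
- move=> v v0 IH; have [g /andP[g0 gv] [a ha]] := cadlag_left cx v0.
  have [|J hJ] := IH (v - g / 2); first by lra.
  exists J.+2; apply: (@riemann_extend (v - g / 2) v a) => //; try lra.
  by move=> s /andP[? ?]; apply: ha; lra.
Qed.

End TimeSpent.

(** * The trace of a path *)

Section TraceTime.
Context {R : realType} {E : finType}.
Variables (S : {set E}) (x : R -> E).
Hypothesis cx : cadlag x.
Implicit Types (c d s t u v w h y : R).
Local Notation T := (time_spent S x).
Local Notation tau := (trace_time S x).
Hypothesis T_unbounded : forall y, exists2 v, 0 <= v & y < T v.
Local Open Scope classical_set_scope.
Local Open Scope ring_scope.

Let D y : set R := [set s | 0 <= s /\ T s <= y].

Let T_lt u v : 0 <= u -> T u < T v -> u < v.
Proof.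
move=> u0 h; rewrite ltNge; apply/negP => vu.
have [v0|v0] := leP 0 v.
  by have := time_spent_mono S cx v0 vu; rewrite leNgt h.
have : T v <= T 0.
  rewrite (time_spent0 S cx) /time_spent.
  rewrite (_ : `[0, v]%classic = set0); last first.
    by apply: set_itv_ge; rewrite bnd_simp -ltNge.
  by rewrite Rintegral_set0.
by have := time_spent_mono S cx (lexx 0) u0; lra.
Qed.

Let supD y : 0 <= y -> has_sup (D y).
Proof.
move=> y0; split; first by exists 0; split => //; rewrite (time_spent0 S cx).
have [v v0 yv] := T_unbounded y; exists v => s [s0 Ts].
by apply: ltW; apply: T_lt => //; exact: le_lt_trans yv.
Qed.

Lemma trace_time_ge0 y : 0 <= y -> 0 <= tau y.
Proof.
move=> y0; apply: ub_le_sup; first by have [] := supD y0.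
by split => //; rewrite (time_spent0 S cx).
Qed.

Let T_gt_tau y s : 0 <= y -> tau y < s -> y < T s.
Proof.
move=> y0 ts; rewrite ltNge; apply/negP => Ts.
have : D y s by split => //; apply: ltW; apply: le_lt_trans ts; exact: trace_time_ge0.
by move=> /(ub_le_sup (supD y0).2); rewrite leNgt ts.
Qed.

(** The occupation time is continuous, so its generalized inverse is a right
    inverse. *)
Lemma time_spent_trace_time y : 0 <= y -> T (tau y) = y.
Proof.
move=> y0; have t0 := trace_time_ge0 y0; apply/eqP; rewrite eq_le; apply/andP; split.
  apply/ler_addgt0Pr => e e0.
  have [s [s0 Ts]] := sup_adherent e0 (supD y0); rewrite -/(tau y) => ts.
  have st : s <= tau y by apply: ub_le_sup => //; exact: (supD y0).2.
  by have := time_spent_lip S cx s0 st; lra.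
apply/ler_addgt0Pr => e e0.
have l : tau y <= tau y + e by rewrite lerDl ltW.
have := time_spent_lip S cx t0 l; have := @T_gt_tau y (tau y + e) y0.
by rewrite ltrDl => /(_ e0); lra.
Qed.

Lemma trace_time_unique y s : 0 <= s -> T s = y -> (forall s', s < s' -> y < T s') ->
  tau y = s.
Proof.
move=> s0 Ts h; have y0 : 0 <= y by rewrite -Ts -(time_spent0 S cx) (time_spent_mono S cx).
apply/eqP; rewrite eq_le; apply/andP; split; rewrite leNgt; apply/negP => l.
  by have := h _ l; rewrite time_spent_trace_time// ltxx.
by have := T_gt_tau y0 l; rewrite Ts ltxx.
Qed.

(** If the path were outside of [S] at this time it would stay outside for a
    while, and the occupation time would stay at [y] beyond the supremum. *)
Lemma trace_time_in y : 0 <= y -> x (tau y) \in S.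
Proof.
move=> y0; have t0 := trace_time_ge0 y0; have [e e0 he] := cadlag_right cx t0.
apply: contraT => /negbTE xS.
have l : tau y <= tau y + e / 2 by rewrite lerDl divr_ge0// ltW.
have := @time_spent_const _ _ S x cx _ _ (x (tau y)) t0 l _.
rewrite xS mulr0 addr0 time_spent_trace_time// => H.
have : y < T (tau y + e / 2) by apply: T_gt_tau => //; rewrite ltrDl divr_gt0.
by rewrite H ?ltxx// => s hs; apply: he; lra.
Qed.

Lemma trace_time_right y : 0 <= y -> exists2 e, 0 < e & forall y', y <= y' < y + e ->
  tau y' = tau y + (y' - y) /\ x (tau y') = x (tau y).
Proof.
move=> y0; have t0 := trace_time_ge0 y0; have [e e0 he] := cadlag_right cx t0.
have Te d : 0 <= d -> d < e -> T (tau y + d) = y + d.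
  move=> d0 de; have l : tau y <= tau y + d by rewrite lerDl.
  rewrite (@time_spent_const _ _ S x cx _ _ (x (tau y)) t0 l) => [|s hs]; last by apply: he; lra.
  by rewrite time_spent_trace_time// trace_time_in// mulr1; ring.
exists e => // y' /andP[y1 y2].
have tE : tau y' = tau y + (y' - y).
  apply: trace_time_unique; first by lra.
    by rewrite Te; lra.
  move=> s' hs'; have [l|l] := ltP s' (tau y + e).
    by rewrite (_ : s' = tau y + (s' - tau y)) ?Te; lra.
  have := Te ((y' - y + e) / 2) _ _; have := time_spent_mono S cx (u := tau y + (y' - y + e) / 2) (v := s') _ _.
  by move=> h1 h2; have {}h1 := h1 _ _; have {}h2 := h2 _ _; lra.
by split => //; rewrite tE he//; lra.
Qed.

(** The left limit of the inverse is the first time [s1] at which the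
    occupation time is [y]. Just before [s1] the occupation time increases, so
    the path is in [S] there, at a constant value since it has left limits. *)
Lemma trace_time_left y : 0 < y -> exists2 e, 0 < e & exists2 a, a \in S &
  forall y', y - e < y' < y -> x (tau y') = a.
Proof.
(* the first time with occupation time y is the supremum of D' *)
move=> y0; pose D' : set R := [set s | 0 <= s /\ T s < y].
have D0 : D' 0 by split => //; rewrite (time_spent0 S cx).
have supD' : has_sup D'.
  split; first by exists 0.
  by have [u [v hv]] := supD (ltW y0); exists v => s [s0 Ts]; apply: hv; split => //; exact: ltW.
pose s1 := sup D'.
have s10 : 0 <= s1 by apply: ub_le_sup => //; exact: supD'.2.
have below s : 0 <= s -> s < s1 -> T s < y.
  move=> s0 ss; have e0 : 0 < s1 - s by rewrite subr_gt0.
  have [w [w0 Tw]] := sup_adherent e0 supD'; rewrite opprB addrC subrK => sw.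
  by apply: le_lt_trans Tw; rewrite (time_spent_mono S cx)// ltW.
have Ts1 : T s1 = y.
  apply/eqP; rewrite eq_le; apply/andP; split.
    apply/ler_addgt0Pr => e e0.
    have [s [s0 Ts]] := sup_adherent e0 supD'; rewrite -/s1 => ts.
    have st : s <= s1 by apply: ub_le_sup => //; exact: supD'.2.
    by have := time_spent_lip S cx s0 st; lra.
  rewrite leNgt; apply/negP => Ty.
  pose s := s1 + (y - T s1) / 2.
  have l : s1 <= s by rewrite lerDl; lra.
  have : D' s.
    by split; [lra|have := time_spent_lip S cx s10 l; rewrite /s; lra].
  by move=> /(ub_le_sup supD'.2); rewrite -/s1 /s; lra.
have s1p : 0 < s1.
  by rewrite lt_neqAle s10 andbT; apply/eqP => h; move: Ts1; rewrite -h (time_spent0 S cx) => h'; move: y0; rewrite h' ltxx.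
have [g /andP[g0 gs] [a ha]] := cadlag_left cx s1p.
have TE d : 0 < d < g -> y = T (s1 - d) + d * (a \in S)%:R.
  move=> /andP[d0 dg]; have l0 : 0 <= s1 - d by lra.
  have l1 : s1 - d <= s1 by lra.
  rewrite -{1}Ts1 (time_spent_const S cx (a := a) l0 l1); last by move=> s hs; apply: ha; lra.
  by congr (_ + _ * _); ring.
have aS : a \in S.
  apply: contraT => /negbTE aS; have := TE (g / 2); rewrite aS mulr0 addr0.
  move=> H; have := below (s1 - g / 2); rewrite -H ?ltxx; last by lra.
  by move=> /(_ _ _); apply; lra.
exists g => //; exists a => // y' /andP[y1 y2].
have d1 : 0 < y - y' < g by lra.
have te : tau y' = s1 - (y - y').
  apply: trace_time_unique; first by lra.
    by have := TE _ d1; rewrite aS mulr1; lra.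
  move=> s' hs'; have [l|l] := ltP s' s1.
    have := TE (s1 - s'); rewrite aS mulr1 => H; have {}H := H _.
    by rewrite (_ : s' = s1 - (s1 - s')); [lra|ring].
  by have := time_spent_mono S cx s10 l; lra.
by rewrite te; apply: ha; lra.
Qed.

(** Index, among the visits to [S], of the observation that stands for time
    [t]. The shift by [2 ^ n] exceeds the bounded error of the Riemann sums,
    while [2 ^ n / 4 ^ n] tends to 0. *)
Definition visit_index n t : nat := (Num.truncn (t * 4 ^+ n) + 2 ^ n)%N.

(** The observation number [visit_index n t] among those in [S] comes after the
    trace time of [c t], because of the shift, and before the path leaves its
    value at that time, because the shift is negligible on the time scale. *)
Lemma visits_limit c t : 0 < c -> 0 <= t ->
  exists n0, forall n, (n0 <= n)%N -> exists i : nat,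
    x (i%:R * (c / 4 ^+ n)) = x (tau (c * t)) /\
    visits S x (c / 4 ^+ n) i = visit_index n t.
Proof.
move=> c0 t0; have y0 : 0 <= c * t by rewrite mulr_ge0// ltW.
set y := c * t in y0 *.
have [e e0 he] := cadlag_right cx (trace_time_ge0 y0).
have t1 := trace_time_ge0 y0; set q := tau y in t1 he *.
have [|J hJ] := @riemann_visits _ _ S x cx (q + e); first by lra.
(* beyond this m, the shift 2 ^ n exceeds the Riemann error J, and its duration
    c / 2 ^ n is less than e *)
pose m := J.+3%:R + c * J.+3%:R / e.
have m0 : 0 <= m by rewrite addr_ge0// divr_ge0 ?mulr_ge0// ltW.
exists (Num.truncn m).+1 => n hn.
have two : m < 2 ^+ n :> R.
  apply: (lt_trans (truncnS_gt m)).
  apply: (@le_lt_trans _ _ (n%:R : R)); first by rewrite ler_nat.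
  by rewrite -natrX ltr_nat ltn_expl.
set P := 2 ^+ n in two; have P0 : 0 < P by rewrite /P exprn_gt0.
have four : 4 ^+ n = P * P :> R by rewrite /P -exprMn; congr (_ ^+ _); ring.
have J3 : J.+3%:R = J%:R + 3 :> R by rewrite -addn3 natrD.
have J0 : 0 <= J%:R :> R by rewrite ler0n.
have P1 : J%:R + 3 < P.
  by apply: le_lt_trans two; rewrite /m J3 lerDl divr_ge0 ?mulr_ge0// ?ltW//; lra.
have P2 : c * (J%:R + 3) < e * P.
  rewrite [ltRHS]mulrC -ltr_pdivrMr//; apply: le_lt_trans two.
  by rewrite /m J3 lerDr addr_ge0.
set h := c / 4 ^+ n; have h0 : 0 < h by rewrite divr_gt0// four mulr_gt0.
have hP : h * P * P = c by rewrite /h four -mulrA divfK// gt_eqF// mulr_gt0.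
have hPe : h * P * (J%:R + 3) < e.
  by rewrite -(ltr_pM2r P0); move: P2; rewrite -{1}hP; lra.
have hle : h <= h * P by rewrite ler_peMr ?ltW//; lra.
have [i0 /andP[i1 i2]] := grid_cell h0 t1.
(* first observation after the trace time *)
set i := i0.+1; rewrite -/i in i2.
have i3 : i%:R * h <= q + h by rewrite /i -natr1; lra.
have hPJ : 0 <= h * P * J%:R by rewrite mulr_ge0// ltW// mulr_gt0.
have ie : i%:R * h <= q + e by nra.
have Ti : T (i%:R * h) = y + (i%:R * h - q).
  rewrite (@time_spent_const _ _ S x cx q _ (x q) t1 (ltW i2)).
    by rewrite time_spent_trace_time// trace_time_in// mulr1.
  by move=> s hs; apply: he; lra.
have := hJ h i h0 ie; rewrite Ti ler_norml => /andP[v1 v2].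
(* V differs from t * 4 ^ n by a bounded number, so V <= visit_index n t *)
set V := visits S x h i in v1 v2 *.
have yP : y = h * (t * 4 ^+ n) by rewrite /y /h -mulrA (mulrCA _ t) mulVf ?mulr1// four gt_eqF// mulr_gt0.
have k1 : t * 4 ^+ n - 1 + P <= (visit_index n t)%:R.
  by rewrite /visit_index natrD natrX lerD2r lerBlDr natr1 ltW// truncnS_gt.
have k2 : (visit_index n t)%:R <= t * 4 ^+ n + P.
  by rewrite /visit_index natrD natrX lerD2r truncn_le// mulr_ge0// exprn_ge0.
set W := t * 4 ^+ n in yP k1 k2.
have Vk : (V <= visit_index n t)%N.
  rewrite -(ler_nat R) -(ler_pM2l h0).
  have : h * (W - 1 + P) <= h * (visit_index n t)%:R by rewrite ler_pM2l.
  have : h * (J%:R + 3) <= h * P by rewrite ler_pM2l// ltW.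
  by move: v1 v2; rewrite yP; lra.
(* the next l observations are all equal to x q, which is in S; the last of
    them is the required one *)
set l := (visit_index n t - V)%N.
have lh : l%:R * h <= h * P + J%:R * h.
  rewrite /l natrB// mulrBl.
  have : h * (visit_index n t)%:R <= h * (W + P) by rewrite ler_pM2l.
  by move: v1 v2; rewrite yP; lra.
have inS (j : nat) : (j <= l)%N -> x ((i + j)%:R * h) = x q.
  move=> jl; apply: he; rewrite natrD mulrDl.
  have j0 : 0 <= j%:R * h by rewrite mulr_ge0// ltW.
  have jl' : j%:R * h <= l%:R * h by rewrite ler_pM2r// ler_nat.
  have hJP : J%:R * h <= h * P * J%:R by rewrite mulrC ler_wpM2r.
  by apply/andP; split; lra.
have vis (j : nat) : (j <= l)%N -> visits S x h (i + j) = (V + j)%N.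
  elim: j => [|j IH] jl; first by rewrite !addn0.
  by rewrite addnS visitsS IH ?inS ?trace_time_in ?addn1 ?addnS// ltnW.
exists (i + l)%N; split; first exact: inS.
by rewrite vis// /l subnKC.
Qed.

Lemma trace_path_cadlag c (e0 : {e : E | e \in S}) : 0 < c ->
  cadlag (fun t => trace_path e0 x (c * t)).
Proof.
move=> c0; split.
  move=> t t0; have y0 : 0 <= c * t by rewrite mulr_ge0// ltW.
  have [e epos he] := trace_time_right y0.
  apply: (@near_rightI _ _ t (e / c)); first by rewrite divr_gt0.
  move=> s /andP[s1 s2]; rewrite /trace_path; congr insubd.
  apply: (he _ _).2; rewrite ler_pM2l// ltW//=.
  by rewrite -ltrBlDl -mulrBr mulrC -ltr_pdivlMr//; lra.
move=> t t0; have y0 : 0 < c * t by rewrite mulr_gt0.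
have [e epos [a aS he]] := trace_time_left y0.
exists (insubd e0 a); apply: (@near_leftI _ _ t (e / c)); first by rewrite divr_gt0.
move=> s /andP[s1 s2]; rewrite /trace_path; congr insubd; apply: he.
rewrite ltr_pM2l// s2 andbT ltrBlDl -ltrBlDr -mulrBr mulrC -ltr_pdivlMr//; lra.
Qed.

End TraceTime.

(** * Paths of discrete-time chains *)

Section PathExpectation.
Context {R : realType} {E : finType}.
Implicit Types (Q : E -> E -> R) (x y : E) (F G : seq E -> R).

(** Expectation of [F] over the first [n + 1] states of the chain with kernel
    [Q] started at [x], as a finite iterated sum. *)
Fixpoint path_exp Q (n : nat) x F : R :=
  if n is m.+1 then \sum_y Q x y * path_exp Q m y (fun l => F (x :: l)) else F [:: x].

Definition stochastic Q : Prop :=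
  (forall x y, 0 <= Q x y) /\ (forall x, \sum_y Q x y = 1).

Lemma path_exp_ext Q n x F G : (forall l, size l = n.+1 -> F l = G l) ->
  path_exp Q n x F = path_exp Q n x G.
Proof.
elim: n x F G => /= [|n IH] x F G FG; first by rewrite FG.
by apply: eq_bigr => y _; congr (_ * _); apply: IH => l sl; rewrite FG//= sl.
Qed.

Lemma path_expZ Q n x (a : R) F :
  path_exp Q n x (fun l => a * F l) = a * path_exp Q n x F.
Proof.
elim: n x F => //= n IH x F; rewrite mulr_sumr; apply: eq_bigr => y _.
by rewrite (IH y (fun l => F (x :: l))) mulrCA.
Qed.

Lemma path_exp_cst Q n x (a : R) : stochastic Q -> path_exp Q n x (fun=> a) = a.
Proof.
move=> [_ Q1]; elim: n x => //= n IH x; under eq_bigr do rewrite IH.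
by rewrite -mulr_suml Q1 mul1r.
Qed.

Lemma path_exp_le Q n x F G : stochastic Q ->
  (forall l, size l = n.+1 -> F l <= G l) -> path_exp Q n x F <= path_exp Q n x G.
Proof.
move=> [Q0 _]; elim: n x F G => /= [|n IH] x F G FG; first exact: FG.
apply: ler_sum => y _; rewrite ler_wpM2l//; apply: IH => l sl.
by rewrite FG//= sl.
Qed.

Lemma path_exp_bound Q n x F (C : R) : stochastic Q -> (forall l, `|F l| <= C) ->
  `|path_exp Q n x F| <= C.
Proof.
move=> sQ FC; rewrite ler_norml -[X in X <= _ <= _](path_exp_cst n x (- C) sQ) -[X in _ <= _ <= X](path_exp_cst n x C sQ).
by apply/andP; split; apply: path_exp_le => // l _; have := FC l; rewrite ler_norml => /andP[].
Qed.

(** The kernels are exchanged one step at a time, at a price of [k C] for each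
    step. *)
Lemma path_exp_tv Q Q' n x F (C k : R) : stochastic Q -> stochastic Q' ->
  (forall l, `|F l| <= C) -> (forall x, \sum_y `|Q x y - Q' x y| <= k) ->
  `|path_exp Q n x F - path_exp Q' n x F| <= n%:R * k * C.
Proof.
move=> sQ sQ'; elim: n x F => /= [|n IH] x F FC Qk; first by rewrite subrr normr0 !mul0r.
pose G y l := F (x :: l).
rewrite (_ : _ - _ = \sum_y ((Q x y - Q' x y) * path_exp Q n y (G y) +
    Q' x y * (path_exp Q n y (G y) - path_exp Q' n y (G y)))); last first.
  by rewrite -sumrB; apply: eq_bigr => y _; rewrite /G; ring.
have C0 : 0 <= C by apply: le_trans (FC [::]).
rewrite big_split/= -natr1 !mulrDl mul1r addrC; apply: (le_trans (ler_normD _ _)).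
apply: lerD; last first.
  apply: (le_trans (ler_norm_sum _ _ _)).
  apply: (@le_trans _ _ (\sum_y `|Q x y - Q' x y| * C)); last first.
    by rewrite -mulr_suml ler_wpM2r.
  apply: ler_sum => y _; rewrite normrM ler_wpM2l//.
  by apply: path_exp_bound => // l; rewrite /G.
apply: (le_trans (ler_norm_sum _ _ _)).
rewrite -[leRHS]mul1r -[X in _ <= X * _](sQ'.2 x) mulr_suml; apply: ler_sum => y _.
by rewrite normrM (ger0_norm (sQ'.1 x y)); apply: ler_wpM2l; [exact: sQ'.1|apply: IH => // l; exact: FC].
Qed.

Fixpoint path_weight Q x (s : seq E) : R :=
  if s is y :: s' then Q x y * path_weight Q y s' else 1.

Lemma path_exp_sum Q n x F :
  path_exp Q n x F = \sum_(t : n.-tuple E) F (x :: t) * path_weight Q x t.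
Proof.
elim: n x F => [|n IH] x F /=.
  rewrite (big_pred1 [tuple]) ?mulr1// => t; rewrite (tuple0 t)/=.
  by rewrite eqxx.
rewrite (reindex (fun p : E * n.-tuple E => cons_tuple p.1 p.2))/=; last first.
  exists (fun t => (thead t, behead_tuple t)) => [[y t] _|t _] /=.
    by rewrite theadE; congr (_, _); apply: val_inj.
  by rewrite [RHS]tuple_eta; apply: val_inj.
rewrite -(pair_bigA _ (fun y (t : n.-tuple E) => F [:: x, y & t] * (Q x y * path_weight Q y t)))/=.
apply: eq_bigr => y _; rewrite IH mulr_sumr; apply: eq_bigr => t _.
by rewrite mulrCA.
Qed.

Lemma path_weight_prod Q x s :
  path_weight Q x s = \prod_(i < size s) Q (nth x (x :: s) i) (nth x s i).
Proof.
elim: s x => [|y s IH] x /=; first by rewrite big_ord0.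
rewrite big_ord_recl/=; congr (_ * _); rewrite IH; apply: eq_bigr => i _ /=.
by congr Q; apply: set_nth_default => //=; rewrite ltnS ltnW.
Qed.

End PathExpectation.

Section DiscreteMarkov.
Context {R : realType} {E : finType} d (W : measurableType d) (P : probability W R).
Local Open Scope classical_set_scope.
Local Open Scope ring_scope.
Implicit Types (Q : E -> E -> R) (Z : W -> nat -> E).

Definition discrete_process Z : Prop :=
  forall k e, measurable [set w | Z w k = e].

Definition discrete_markov Q x0 Z : Prop := discrete_process Z /\
  forall s : seq E, s != [::] ->
  P [set w | mkseq (Z w) (size s) = s] =
    ((head x0 s == x0)%:R * path_weight Q (head x0 s) (behead s))%:E.

Lemma measurable_mkseq_eq Z n (s : seq E) : discrete_process Z ->
  measurable [set w | mkseq (Z w) n = s].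
Proof.
move=> mZ; elim: n s => [|n IH] s.
  have [->|s0] := eqVneq s [::]; first by rewrite (_ : [set w | _] = setT)//; apply/seteqP.
  rewrite (_ : [set w | _] = set0)//; apply/seteqP; split => // w /= h.
  by move: s0; rewrite -h.
case/lastP: s => [|s e].
  by rewrite (_ : [set w | _] = set0)//; apply/seteqP; split.
rewrite (_ : [set w | _] = [set w | mkseq (Z w) n = s] `&` [set w | Z w n = e]).
  exact: measurableI.
by apply/seteqP; split => w /=; rewrite mkseqS; [move=> /rcons_inj[-> ->]|move=> [-> ->]].
Qed.

Lemma measurable_mkseq Z n (A : pred (seq E)) : discrete_process Z ->
  measurable [set w | A (mkseq (Z w) n)].
Proof.
move=> mZ.
rewrite (_ : [set w | _] = \bigcup_(t in [set t : n.-tuple E | A t]) [set w | mkseq (Z w) n = t]).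
  by apply: fin_bigcup_measurable => [|t _]; [exact: finite_finset|exact: measurable_mkseq_eq].
apply/seteqP; split => w /=.
  have sz : size (mkseq (Z w) n) == n by rewrite size_mkseq.
  by move=> Aw; exists (Tuple sz).
by move=> [t At ->].
Qed.

Lemma measurable_fun_mkseq Z n (F : seq E -> R) : discrete_process Z ->
  measurable_fun setT (fun w => F (mkseq (Z w) n)).
Proof.
move=> mZ _ B mB; rewrite setTI.
rewrite (_ : _ @^-1` _ = [set w | `[< B (F (mkseq (Z w) n)) >]]).
  exact: (measurable_mkseq n (fun s => `[< B (F s) >]) mZ).
by apply/seteqP; split => w /=; [move/asboolP|move/asboolP].
Qed.

Lemma integral_mkseq Z n (F : seq E -> R) : discrete_process Z -> (forall s, 0 <= F s) ->
  (\int[P]_w (F (mkseq (Z w) n))%:E =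
   \sum_(t : n.-tuple E) (F t)%:E * P [set w | mkseq (Z w) n = t])%E.
Proof.
move=> mZ F0.
transitivity (\int[P]_w (\sum_(t : n.-tuple E) (F t * \1_[set w | mkseq (Z w) n = t] w)%:E))%E.
  apply: eq_integral => w _; rewrite sumEFin; congr (_%:E).
  have sz : size (mkseq (Z w) n) == n by rewrite size_mkseq.
  rewrite (bigD1 (Tuple sz))//= indicE mem_set//= mulr1 big1 ?addr0// => t tn.
  rewrite indicE memNset ?mulr0//= => h; move/eqP: tn; apply; apply: val_inj.
  by rewrite /= h.
have mt (t : n.-tuple E) : measurable [set w | mkseq (Z w) n = t].
  exact: measurable_mkseq_eq.
rewrite ge0_integral_sum//=; last 2 first.
- move=> t; apply/measurable_EFinP; apply: measurable_funM => //.
- by move=> t w _; rewrite lee_fin mulr_ge0// indicE.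
apply: eq_bigr => t _; under eq_integral do rewrite EFinM.
rewrite ge0_integralZl//; last 2 first.
- by apply/measurable_EFinP; exact: measurable_indic.
- by rewrite lee_fin.
by rewrite integral_indic// setIT.
Qed.

Lemma markov_expectation Q x0 Z n (F : seq E -> R) : discrete_markov Q x0 Z ->
  (forall s, 0 <= F s) ->
  (\int[P]_w (F (mkseq (Z w) n.+1))%:E = (path_exp Q n x0 F)%:E)%E.
Proof.
move=> [mZ law] F0; rewrite integral_mkseq// path_exp_sum -sumEFin.
rewrite (reindex (fun p : E * n.-tuple E => cons_tuple p.1 p.2))/=; last first.
  exists (fun t => (thead t, behead_tuple t)) => [[y t] _|t _] /=.
    by rewrite theadE; congr (_, _); apply: val_inj.
  by rewrite [RHS]tuple_eta; apply: val_inj.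
have e y (t : n.-tuple E) : ((F (y :: t))%:E * P [set w | mkseq (Z w) n.+1 = y :: t] =
  (F (y :: t) * ((y == x0)%:R * path_weight Q y t))%:E)%E.
  by have := law (y :: t) isT; rewrite /= size_tuple => ->.
rewrite (eq_bigr _ (fun p _ => e p.1 p.2)).
rewrite -(pair_bigA _ (fun y (t : n.-tuple E) => (F (y :: t) * ((y == x0)%:R * path_weight Q y t))%:E))/=.
rewrite (bigD1 x0)//= [X in (_ + X)%E]big1 ?adde0.
  by apply: eq_bigr => t _; rewrite eqxx mul1r.
by move=> y /negbTE ->; rewrite big1// => t _; rewrite mul0r mulr0.
Qed.

Lemma markov_probability Q x0 Z n (A : pred (seq E)) : discrete_markov Q x0 Z ->
  P [set w | A (mkseq (Z w) n.+1)] = (path_exp Q n x0 (fun s => (A s)%:R))%:E.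
Proof.
move=> mk; rewrite -(markov_expectation _ mk)//.
rewrite -[in LHS](setIT [set w | _]) -integral_indic//; last exact: (measurable_mkseq n.+1 A mk.1).
apply: eq_integral => w _; rewrite indicE; congr ((nat_of_bool _)%:R%:E).
by apply/idP/idP => h; [move: h; rewrite inE|rewrite inE].
Qed.

End DiscreteMarkov.

Section Skeleton.
Context {R : realType} {E : finType} d (W : measurableType d) (P : probability W R).

Lemma transition_stochastic L (p : R -> E -> E -> R) h : transition_function L p -> 0 <= h ->
  stochastic (p h).
Proof. by move=> [p0 p1 _ _ _] h0; split => *; [exact: p0|exact: p1]. Qed.

(** One transition function serves for all steps [h], which is what allows to
    let [h] tend to 0. *)
Lemma skeleton_markov L x0 (X : W -> R -> E) : markov_chain P L x0 X ->
  exists2 p, transition_function L p & forall h, 0 <= h ->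
    discrete_markov P (p h) x0 (fun w i => X w (i%:R * h)).
Proof.
move=> [mX _ [p tp law]]; exists p => // h h0; split.
  by move=> k e; apply: mX; rewrite mulr_ge0.
move=> [//|y s] _ /=.
have -> : [set w | mkseq (fun i : nat => X w (i%:R * h)) (size s).+1 = y :: s]%classic =
  [set w | forall i : nat, (i <= size s)%N -> X w (i%:R * h) = nth y (y :: s) i]%classic.
  apply/seteqP; split => w /= hw.
    by move=> i si; rewrite -hw nth_mkseq.
  apply: (@eq_from_nth _ y) => [|i]; rewrite size_mkseq// => si.
  by rewrite nth_mkseq// hw.
have := law (size s) (fun i => i%:R * h) (nth y (y :: s)); rewrite mul0r => ->//; last first.
  by move=> i; rewrite ler_wpM2r// ler_nat.
congr ((_ * _)%:E); rewrite path_weight_prod; apply: eq_bigr => i _.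
rewrite -mulrBl -[i.+1]addn1 natrD [_ + 1]addrC addrK mul1r addn1/=.
by [].
Qed.

End Skeleton.

(** * The trace of a discrete-time chain *)

Section Aux.
Context {R : realType}.
Local Open Scope classical_set_scope.
Local Open Scope ring_scope.

Lemma cvg_bigsum (I : Type) (r : seq I) (T : Type) (G : set_system T) {FG : Filter G}
    (F : I -> T -> R) (l : I -> R) :
  (forall i, F i t @[t --> G] --> l i) ->
  \sum_(i <- r) F i t @[t --> G] --> \sum_(i <- r) l i.
Proof.
move=> Fl; elim: r => [|i r IH].
  rewrite big_nil; rewrite [X in X @ _](_ : _ = fun=> 0); first exact: cvg_cst.
  by apply/funext => t; rewrite big_nil.
rewrite big_cons [X in X @ _](_ : _ = fun t => F i t + \sum_(j <- r) F j t).
  exact: cvgD.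
by apply/funext => t; rewrite big_cons.
Qed.

(** Used to compute a limit by means of a second expression of the same
    sequence. *)
Lemma cvg_seq_unique (u v : nat -> R) (l l' : R) : u =1 v ->
  u n @[n --> \oo] --> l -> v n @[n --> \oo] --> l' -> l = l'.
Proof. by move=> /funext -> h1 h2; exact: (cvg_unique _ h1 h2). Qed.

Lemma finite_argmax (E : finType) (f : E -> R) (x : E) : exists m, forall y, f y <= f m.
Proof.
have [m _ h] := @arg_maxP _ _ _ x xpredT f isT.
by exists m => y; apply: h.
Qed.

(** Two comparable probability distributions are equal. *)
Lemma ler_sum_eq (I : finType) (a b : I -> R) : (forall i, a i <= b i) ->
  \sum_i a i = \sum_i b i -> forall i, a i = b i.
Proof.
move=> ab s i; apply/eqP; rewrite eq_le ab /= leNgt; apply/negP => lt.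
have : \sum_i a i < \sum_i b i.
  by rewrite (bigD1 i)//= [ltRHS](bigD1 i)//= ltr_leD// ler_sum.
by rewrite s ltxx.
Qed.

End Aux.

Section Visits.
Context {E : finType} (S : {set E}).
Implicit Types (z : nat -> E) (s : seq E).

Definition visit_count z (i : nat) : nat := count (mem S) (mkseq z i).

Lemma visit_countS z i : visit_count z i.+1 = (visit_count z i + (z i \in S))%N.
Proof. by rewrite /visit_count mkseqS -cats1 count_cat/= addn0. Qed.

Lemma visit_count_mono z i j : (i <= j)%N -> (visit_count z i <= visit_count z j)%N.
Proof.
by move/subnK <-; elim: (j - i)%N => // k IH; rewrite addSn visit_countS (leq_trans IH)// leq_addr.
Qed.

Lemma visit_count_inj z i j : z i \in S -> z j \in S ->
  visit_count z i = visit_count z j -> i = j.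
Proof.
move=> iS jS e; case: (ltngtP i j) => // h.
  by have := visit_count_mono z h; rewrite visit_countS iS addn1 e ltnn.
by have := visit_count_mono z h; rewrite visit_countS jS addn1 e ltnn.
Qed.

Lemma nth_filter_visit z n k a : (k < size (seq.filter (mem S) (mkseq z n)))%N ->
  exists i, [/\ z i \in S, visit_count z i = k & nth a (seq.filter (mem S) (mkseq z n)) k = z i].
Proof.
elim: n => [|n IH]; first by rewrite ltn0.
rewrite mkseqS filter_rcons; case: ifP => zn; last exact: IH.
rewrite size_rcons ltnS leq_eqVlt => /predU1P[->|lt].
  exists n; split => //; first by rewrite /visit_count -size_filter.
  by rewrite nth_rcons ltnn eqxx.
by have [i [h1 h2 h3]] := IH lt; exists i; split => //; rewrite nth_rcons lt.
Qed.

Variable e0 : {e : E | e \in S}.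

(** The state at the visit number [k] to [S], counted from 0; [e0] stands for
    it if there are not so many visits. *)
Definition trace_chain z (k : nat) : {e : E | e \in S} :=
  if pselect (exists i, z i \in S /\ visit_count z i = k) is left ex
  then insubd e0 (z (projT1 (cid ex))) else e0.

Lemma trace_chainE z i : z i \in S -> val (trace_chain z (visit_count z i)) = z i.
Proof.
move=> zi; rewrite /trace_chain; case: pselect => [ex|[]]; last by exists i.
case: cid => j [jS e]; rewrite insubdK//=.
by rewrite (visit_count_inj jS zi e).
Qed.

(** The trace chain is determined by any path that is long enough. *)
Lemma trace_chain_prefix z n (s : seq {e : E | e \in S}) :
  prefix (map val s) (seq.filter (mem S) (mkseq z n)) ->
  mkseq (trace_chain z) (size s) = s.
Proof.
move=> /prefixP[s' e]; apply: (@eq_from_nth _ e0) => [|k]; rewrite size_mkseq// => ks.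
rewrite nth_mkseq//; apply: val_inj.
have kn : (k < size (seq.filter (mem S) (mkseq z n)))%N.
  by rewrite e size_cat size_map ltn_addr.
have [i [h1 h2 h3]] := nth_filter_visit (val e0) kn.
rewrite -h2 trace_chainE// h2 -h3 e nth_cat size_map ks.
by rewrite (nth_map e0).
Qed.

End Visits.

Section TraceKernel.
Context {R : realType} {E : finType} (S : {set E}) (Q : E -> E -> R).
Local Open Scope classical_set_scope.
Local Open Scope ring_scope.
Hypothesis sQ : stochastic Q.
Variables (phi : E -> R) (a : R).
Hypothesis phi0 : forall x, 0 <= phi x.
Hypothesis a0 : 0 < a.
Hypothesis phia : forall x, x \notin S -> \sum_y Q x y * phi y <= phi x - a.
Implicit Types (x y : E) (s : seq E).

(** At a maximum of [D - t phi] off [S] the two hypotheses contradict each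
    other, since [t phi] decreases in mean by [t a], more than the error [eta].
    With small [eta] this turns an approximate equation into an estimate of its
    solution. *)
Lemma discrete_max_principle (D : E -> R) (eta t : R) :
  (forall x, x \in S -> D x <= 0) ->
  (forall x, x \notin S -> D x <= \sum_y Q x y * D y + eta) ->
  eta < t * a -> 0 <= t -> forall x, D x <= t * phi x.
Proof.
move=> DS Dh et t0 x; have [m hm] := finite_argmax (fun y => D y - t * phi y) x.
suff : D m - t * phi m <= 0 by have := hm x; lra.
have [mS|mS] := boolP (m \in S).
  by have := DS _ mS; have := mulr_ge0 t0 (phi0 m); lra.
have h1 := Dh _ mS; have h2 := phia mS.
have : \sum_y Q m y * (D y - t * phi y) <= D m - t * phi m.
  rewrite -[leRHS]mul1r -(sQ.2 m) mulr_suml; apply: ler_sum => y _.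
  by apply: ler_wpM2l; [exact: sQ.1|exact: hm].
have -> : \sum_y Q m y * (D y - t * phi y) = \sum_y Q m y * D y - t * \sum_y Q m y * phi y.
  by rewrite mulr_sumr -sumrB; apply: eq_bigr => y _; ring.
have : t * \sum_y Q m y * phi y <= t * (phi m - a) by rewrite ler_wpM2l.
nra.
Qed.

(** Comparison with arbitrarily small multiples of [phi]. *)
Lemma discrete_uniqueness (D : E -> R) :
  (forall x, x \in S -> D x = 0) ->
  (forall x, x \notin S -> D x = \sum_y Q x y * D y) -> forall x, D x = 0.
Proof.
move=> DS Dh x.
have main (D' : E -> R) : (forall x, x \in S -> D' x = 0) ->
  (forall x, x \notin S -> D' x = \sum_y Q x y * D' y) -> D' x <= 0.
  move=> h1 h2; apply/ler_addgt0Pr => e e0; rewrite add0r.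
  pose t := e / (phi x + 1); have p1 : 0 < phi x + 1 by have := phi0 x; lra.
  have t0 : 0 < t by rewrite divr_gt0.
  apply: (@le_trans _ _ (t * phi x)).
    apply: (@discrete_max_principle _ 0); rewrite ?(mulr_gt0 t0 a0) ?(ltW t0)//.
      by move=> y /h1 ->.
    by move=> y /h2 ->; rewrite addr0.
  apply: (@le_trans _ _ (t * (phi x + 1))); last by rewrite /t divfK ?gt_eqF.
  by apply: ler_wpM2l; [exact: ltW|lra].
apply/eqP; rewrite eq_le main//=.
rewrite -oppr_le0; apply: (main (fun y => - D y)) => y yS; first by rewrite DS// oppr0.
by rewrite Dh// -sumrN; apply: eq_bigr => z _; rewrite mulrN.
Qed.

(** Probability that the first states visited in [S] are those of [s], if only
    [n] steps are observed. *)
Definition visit_prob n x s : R :=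
  path_exp Q n x (fun l => (prefix s (seq.filter (mem S) l))%:R).

Lemma visit_prob_ge0 n x s : 0 <= visit_prob n x s.
Proof. by rewrite -(path_exp_cst n x 0 sQ); apply: path_exp_le => // l _. Qed.

Lemma visit_prob_le1 n x s : visit_prob n x s <= 1.
Proof.
rewrite -[leRHS](path_exp_cst n x 1 sQ); apply: path_exp_le => // l _.
by case: prefix; rewrite ?lexx ?ler01.
Qed.

Lemma visit_prob_nil n x : visit_prob n x [::] = 1.
Proof.
rewrite -[RHS](path_exp_cst n x 1 sQ); apply: path_exp_ext => l _.
by rewrite prefix0s.
Qed.

Lemma visit_prob_in n x e s : x \in S ->
  visit_prob n.+1 x (e :: s) = (e == x)%:R * \sum_y Q x y * visit_prob n y s.
Proof.
move=> xS; rewrite /visit_prob /= mulr_sumr; apply: eq_bigr => y _.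
rewrite mulrCA; congr (_ * _); rewrite -path_expZ; apply: path_exp_ext => l _.
by rewrite xS prefix_cons; case: eqP; rewrite ?mul1r ?mul0r.
Qed.

Lemma visit_prob_out n x s : x \notin S ->
  visit_prob n.+1 x s = \sum_y Q x y * visit_prob n y s.
Proof.
move=> xS; rewrite /visit_prob /=; apply: eq_bigr => y _.
by congr (_ * _); apply: path_exp_ext => l _; rewrite (negbTE xS).
Qed.

(** Adding observations at the end of a path keeps its visits. *)
Lemma visit_prob_mono x s : nondecreasing_seq (fun n => visit_prob n x s).
Proof.
apply/nondecreasing_seqP => n; elim: n x s => [|n IH] x [|e s].
- by rewrite !visit_prob_nil.
- have [xS|xS] := boolP (x \in S).
    rewrite visit_prob_in// {1}/visit_prob/= xS prefix_cons.
    case: eqP => _; rewrite ?mul0r// mul1r prefixs0.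
    case: eqP => [->|_]; last by rewrite sumr_ge0// => y _; rewrite mulr_ge0 ?visit_prob_ge0 ?sQ.1.
    under eq_bigr do rewrite visit_prob_nil mulr1; by rewrite sQ.2.
  by rewrite {1}/visit_prob/= (negbTE xS)/= visit_prob_ge0.
- by rewrite !visit_prob_nil.
- have [xS|xS] := boolP (x \in S).
    rewrite !visit_prob_in// ler_wpM2l//; apply: ler_sum => y _.
    by apply: ler_wpM2l; [exact: sQ.1|exact: IH].
  rewrite !visit_prob_out//; apply: ler_sum => y _.
  by apply: ler_wpM2l; [exact: sQ.1|exact: IH].
Qed.

Definition visit_lim x s : R := limn (fun n => visit_prob n x s).

Lemma visit_prob_cvg x s : visit_prob n x s @[n --> \oo] --> visit_lim x s.
Proof.
apply: nondecreasing_is_cvgn; first exact: visit_prob_mono.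
by exists 1 => _ [n _ <-]; exact: visit_prob_le1.
Qed.

Lemma visit_lim_ge n x s : visit_prob n x s <= visit_lim x s.
Proof.
apply: nondecreasing_cvgn_le; first exact: visit_prob_mono.
by apply/cvg_ex; exists (visit_lim x s); exact: visit_prob_cvg.
Qed.

Lemma visit_lim_ge0 x s : 0 <= visit_lim x s.
Proof. by apply: le_trans (visit_lim_ge 0 x s); exact: visit_prob_ge0. Qed.

Lemma visit_lim_nil x : visit_lim x [::] = 1.
Proof.
apply: (cvg_seq_unique (v := fun=> 1) _ (@visit_prob_cvg x [::])); last exact: cvg_cst.
by move=> n; rewrite visit_prob_nil.
Qed.

Let cvg_step x s :
  \sum_y Q x y * visit_prob n y s @[n --> \oo] --> \sum_y Q x y * visit_lim y s.
Proof.
by apply: cvg_bigsum => y; apply: cvgM; [exact: cvg_cst|exact: visit_prob_cvg].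
Qed.

Lemma visit_lim_in x e s : x \in S ->
  visit_lim x (e :: s) = (e == x)%:R * \sum_y Q x y * visit_lim y s.
Proof.
move=> xS; have h := @visit_prob_cvg x (e :: s).
rewrite -(cvg_shiftS (fun n => visit_prob n x (e :: s))) in h.
apply: (cvg_seq_unique (v := fun n => (e == x)%:R * \sum_y Q x y * visit_prob n y s) _ h).
  by move=> n /=; rewrite visit_prob_in.
by apply: cvgM; [exact: cvg_cst|exact: cvg_step].
Qed.

Lemma visit_lim_out x s : x \notin S ->
  visit_lim x s = \sum_y Q x y * visit_lim y s.
Proof.
move=> xS; have h := @visit_prob_cvg x s.
rewrite -(cvg_shiftS (fun n => visit_prob n x s)) in h.
apply: (cvg_seq_unique (v := fun n => \sum_y Q x y * visit_prob n y s) _ h); last exact: cvg_step.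
by move=> n /=; rewrite visit_prob_out.
Qed.

Lemma visit_lim1_in x e : x \in S -> visit_lim x [:: e] = (e == x)%:R.
Proof.
move=> xS; rewrite visit_lim_in//; under eq_bigr do rewrite visit_lim_nil mulr1.
by rewrite sQ.2 mulr1.
Qed.

(** The strong Markov property at the first visit to [S]. Both sides solve the
    same equation off [S] and have the same values on [S]. *)
Lemma visit_lim_cons x e s : e \in S ->
  visit_lim x (e :: s) = visit_lim x [:: e] * \sum_y Q e y * visit_lim y s.
Proof.
move=> eS; apply/eqP; rewrite -subr_eq0; apply/eqP; move: x.
apply: discrete_uniqueness => x xS.
  rewrite visit_lim1_in// visit_lim_in//.
  by case: eqP => [->|_]; rewrite ?mul0r ?subrr// !mul1r subrr.
rewrite visit_lim_out// [in X in _ - X * _]visit_lim_out// mulr_suml -sumrB.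
by apply: eq_bigr => y _; ring.
Qed.

(** One step of the chain, then the entrance law of [S]: the state at the next
    visit. *)
Definition trace_kernel (e e' : {e : E | e \in S}) : R :=
  \sum_y Q (val e) y * visit_lim y [:: val e'].

(** [S] is reached almost surely, by [discrete_uniqueness]. *)
Lemma visit_lim_sum x : \sum_(e : {e : E | e \in S}) visit_lim x [:: val e] = 1.
Proof.
apply/eqP; rewrite eq_sym -subr_eq0; apply/eqP; move: x.
apply: discrete_uniqueness => x xS.
  rewrite (bigD1 (Sub x xS))//= visit_lim1_in// eqxx big1 ?addr0 ?subrr// => e ex.
  rewrite visit_lim1_in//; case: eqP => // h; move/eqP: ex => [].
  by apply: val_inj.
under eq_bigr do rewrite visit_lim_out//.
rewrite exchange_big/= -{1}(sQ.2 x) -sumrB; apply: eq_bigr => y _.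
by rewrite mulrBr mulr1 mulr_sumr.
Qed.

Lemma trace_kernel_stochastic : stochastic trace_kernel.
Proof.
split=> [e e'|e].
  by apply: sumr_ge0 => y _; rewrite mulr_ge0 ?visit_lim_ge0 ?sQ.1.
rewrite /trace_kernel exchange_big/= -[RHS](sQ.2 (val e)); apply: eq_bigr => y _.
by rewrite -mulr_sumr visit_lim_sum mulr1.
Qed.

Lemma visit_lim_weight (e : {e : E | e \in S}) (s : seq {e : E | e \in S}) :
  \sum_y Q (val e) y * visit_lim y (map val s) = path_weight trace_kernel e s.
Proof.
elim: s e => [|e' s IH] e /=.
  by under eq_bigr do rewrite visit_lim_nil mulr1; rewrite sQ.2.
rewrite -IH /trace_kernel mulr_suml; apply: eq_bigr => y _.
by rewrite visit_lim_cons ?(valP e')// mulrA.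
Qed.

(** Induction on [n], with [phi x + C m] as a budget: each step off [S] uses
    [a] of the budget, and [C] is added at each of the less than [m] visits. So
    paths that are long compared with [m] can hardly have less than [m] visits. *)
Lemma few_visits (C : R) n m x : 0 <= C ->
  (forall x, \sum_y Q x y * phi y <= phi x + C - a) ->
  path_exp Q n x (fun l => (count (mem S) l < m)%:R) * (n%:R * a) <= phi x + C * m%:R.
Proof.
move=> C0 phiC; elim: n x m => [|n IH] x m.
  by rewrite mul0r mulr0 addr_ge0// mulr_ge0.
have sumE (g : E -> R) (c : R) : (\sum_y Q x y * g y) * c = \sum_y Q x y * (g y * c).
  by rewrite mulr_suml; apply: eq_bigr => y _; rewrite mulrA.
have step m' : (\sum_y Q x y * path_exp Q n y (fun l => (count (mem S) l < m')%:R)) *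
    (n.+1%:R * a) <= \sum_y Q x y * phi y + C * m'%:R + a.
  rewrite sumE.
  have -> : \sum_y Q x y * phi y + C * m'%:R + a = \sum_y Q x y * (phi y + C * m'%:R + a).
    under [RHS]eq_bigr do rewrite -addrA mulrDr.
    by rewrite big_split/= -mulr_suml sQ.2 mul1r addrA.
  apply: ler_sum => y _; apply: ler_wpM2l; first exact: sQ.1.
  rewrite -natr1 mulrDl mul1r mulrDr; apply: lerD; first exact: IH.
  apply: (@le_trans _ _ (1 * a)); last by rewrite mul1r.
  apply: ler_wpM2r; first exact: ltW.
  rewrite -[X in _ <= X](path_exp_cst n y 1 sQ).
  by apply: path_exp_le => // l _; case: (_ < _)%N; rewrite ?ler01 ?lexx.
rewrite /=; have [xS|xS] := boolP (x \in S); last first.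
  by apply: le_trans (step m) _; have := phia xS; lra.
case: m => [|m].
  rewrite big1 ?mul0r ?addr_ge0 ?mulr_ge0// => y _.
  rewrite [X in _ * X](_ : _ = 0) ?mulr0//.
  by rewrite -[RHS](path_exp_cst n y 0 sQ); apply: path_exp_ext.
apply: le_trans (_ : \sum_y Q x y * phi y + C * m%:R + a <= _); last first.
  by have := phiC x; rewrite -natr1; lra.
rewrite (eq_bigr (fun y => Q x y * path_exp Q n y (fun l => (count (mem S) l < m)%N%:R))).
  exact: step.
by move=> y _; congr (_ * _); apply: path_exp_ext => l _; rewrite add1n ltnS.
Qed.

End TraceKernel.

Section TraceLaw.
Context {R : realType} {E : finType} d (W : measurableType d) (P : probability W R).
Local Open Scope classical_set_scope.
Local Open Scope ring_scope.
Variables (S : {set E}) (Q : E -> E -> R) (phi : E -> R) (a : R).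
Hypothesis sQ : stochastic Q.
Hypothesis phi0 : forall x, 0 <= phi x.
Hypothesis a0 : 0 < a.
Hypothesis phia : forall x, x \notin S -> \sum_y Q x y * phi y <= phi x - a.
Variable e0 : {e : E | e \in S}.
Variable Z : W -> nat -> E.
Hypothesis mZ : discrete_markov P Q (val e0) Z.

Lemma visit_event_measurable i k e :
  measurable [set w | Z w i = e /\ visit_count S (Z w) i = k].
Proof.
rewrite (_ : [set w | _] = [set w | Z w i = e] `&` [set w | (fun s => count (mem S) s == k) (mkseq (Z w) i)]).
  by apply: measurableI; [exact: mZ.1|exact: (measurable_mkseq i (fun s => count (mem S) s == k) mZ.1)].
by apply/seteqP; split => w /= [h1 h2]; split => //; [exact/eqP|exact/eqP].
Qed.

Lemma trace_chain_process : discrete_process (fun w => trace_chain e0 (Z w)).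
Proof.
move=> k e.
have m1 : measurable (\bigcup_i [set w | Z w i = val e /\ visit_count S (Z w) i = k]).
  by apply: bigcup_measurable => i _; exact: visit_event_measurable.
have m2 : measurable (\bigcup_i \bigcup_(f in [set f | f \in S])
    [set w | Z w i = f /\ visit_count S (Z w) i = k]).
  apply: bigcup_measurable => i _; apply: fin_bigcup_measurable; first exact: finite_finset.
  by move=> f _; exact: visit_event_measurable.
have tcE w : (exists i, Z w i \in S /\ visit_count S (Z w) i = k) ->
   exists i, [/\ Z w i \in S, visit_count S (Z w) i = k & val (trace_chain e0 (Z w) k) = Z w i].
  by move=> [i [h1 h2]]; exists i; split => //; rewrite -h2 trace_chainE.
have tcN w : ~ (exists i, Z w i \in S /\ visit_count S (Z w) i = k) -> trace_chain e0 (Z w) k = e0.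
  by rewrite /trace_chain; case: pselect.
have [ee|ee] := eqVneq e e0.
  rewrite (_ : [set w | _] = (\bigcup_i [set w | Z w i = val e /\ visit_count S (Z w) i = k]) `|`
    ~` (\bigcup_i \bigcup_(f in [set f | f \in S]) [set w | Z w i = f /\ visit_count S (Z w) i = k])).
    by apply: measurableU => //; exact: measurableC.
  apply/seteqP; split => w /=.
    move=> h; have [/tcE[i [h1 h2 h3]]|nx] := pselect (exists i, Z w i \in S /\ visit_count S (Z w) i = k).
      by left; exists i => //=; rewrite -h3 h.
    by right => -[i _ [f /= fS [h1 h2]]]; apply: nx; exists i; rewrite h1.
  move=> [[i _ [h1 h2]]|nx].
    by apply: val_inj; rewrite -h2 trace_chainE ?h1 ?(valP e).
  rewrite ee; apply: tcN => -[i [h1 h2]]; apply: nx; exists i => //.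
  by exists (Z w i).
rewrite (_ : [set w | _] = (\bigcup_i [set w | Z w i = val e /\ visit_count S (Z w) i = k]))//.
apply/seteqP; split => w /=.
  move=> h; have [/tcE[i [h1 h2 h3]]|/tcN nx] := pselect (exists i, Z w i \in S /\ visit_count S (Z w) i = k).
    by exists i => //=; rewrite -h3 h.
  by move/eqP: ee; rewrite -h nx.
move=> [i _ [h1 h2]].
by apply: val_inj; rewrite -h2 trace_chainE ?h1 ?(valP e).
Qed.

(** The probability that the trace chain starts with [t] is at least the limit
    [c t] of the probabilities that this is seen within [n] steps. As the [c t]
    add up to 1, equality holds for each [t]. This avoids a discussion of the
    paths with few visits. *)
Lemma trace_chain_markov :
  discrete_markov P (trace_kernel Q) e0 (fun w => trace_chain e0 (Z w)).
Proof.
split; first exact: trace_chain_process.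
have K1 := trace_kernel_stochastic sQ phi0 a0 phia.
move=> [//|e s] _; pose m := size s.
pose b (t : m.+1.-tuple {e : E | e \in S}) := fine (P [set w | mkseq (trace_chain e0 (Z w)) m.+1 = t]).
pose c (t : m.+1.-tuple {e : E | e \in S}) : R := (thead t == e0)%:R * path_weight (trace_kernel Q) (thead t) (behead t).
have bE (t : m.+1.-tuple {e : E | e \in S}) : P [set w | mkseq (trace_chain e0 (Z w)) m.+1 = t] = (b t)%:E.
  rewrite /b fineK// fin_num_measure//.
  exact: (measurable_mkseq_eq m.+1 t trace_chain_process).
have cb t : c t <= b t.
  have vt : visit_lim S Q (val e0) (map val t) = c t.
    rewrite /c {1}(tuple_eta t) /= visit_lim_in ?(valP e0)// (visit_lim_weight sQ phi0 a0 phia).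
    have [->|ne] := eqVneq (thead t) e0; first by rewrite eqxx.
    rewrite (_ : (_ == _) = false) ?mul0r//; apply/negbTE.
    by apply: contra ne => /eqP/val_inj ->.
  rewrite -vt; apply: limr_le; first by apply/cvg_ex; eexists; exact: visit_prob_cvg.
  apply: nearW => n; rewrite -lee_fin -bE.
  have <- := markov_probability n (fun l => prefix (map val t) (seq.filter (mem S) l)) mZ.
  apply: le_measure; rewrite ?inE.
  - exact: (measurable_mkseq n.+1 (fun l => prefix (map val t) (seq.filter (mem S) l)) mZ.1).
  - exact: (measurable_mkseq_eq m.+1 t trace_chain_process).
  - by move=> w h; have := trace_chain_prefix e0 (h : prefix _ _); rewrite size_tuple.
have sc : \sum_t c t = 1.
  rewrite -[RHS](path_exp_cst m e0 1 K1) path_exp_sum.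
  rewrite (reindex (fun p : {e : E | e \in S} * m.-tuple {e : E | e \in S} => cons_tuple p.1 p.2))/=; last first.
    exists (fun t => (thead t, behead_tuple t)) => [[y t] _|t _] /=.
      by rewrite theadE; congr (_, _); apply: val_inj.
    by rewrite [RHS]tuple_eta; apply: val_inj.
  rewrite -(pair_bigA _ (fun y (t : m.-tuple {e : E | e \in S}) => (y == e0)%:R * path_weight (trace_kernel Q) y t))/=.
  rewrite (bigD1 e0)//= [X in _ + X]big1 ?addr0.
    by apply: eq_bigr => t _; rewrite eqxx.
  by move=> y /negbTE ->; rewrite big1// => t _; rewrite mul0r.
have sb : \sum_t b t = 1.
  have := integral_mkseq P m.+1 trace_chain_process (fun _ : seq _ => ler01 : 0 <= 1 :> R).
  rewrite (eq_bigr (fun t => (b t)%:E)); last by move=> t _; rewrite mul1e bE.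
  rewrite integral_cst// sumEFin => e1.
  have e2 : (1 * P [set: W])%E = 1%E by rewrite mul1e; exact: probability_setT.
  by have := congr1 fine (etrans (esym e2) e1).
have szt : size (e :: s) == m.+1 by [].
have := ler_sum_eq cb (etrans sc (esym sb)) (Tuple szt).
have th : thead (Tuple szt) = e by rewrite /thead (tnth_nth e).
rewrite /c th /= => ->.
by rewrite -bE.
Qed.

End TraceLaw.

(** * Kernels of traces at small time steps *)

Section KernelAsymptotics.
Context {R : realType} {E : finType}.
Local Open Scope classical_set_scope.
Local Open Scope ring_scope.
Variables (L : (E -> R) -> E -> R) (p : R -> E -> E -> R).
Hypothesis tp : transition_function L p.

(** The derivative of the semigroup at 0, uniformly over the finite state
    space. *)
Lemma transition_near (f : E -> R) (e : R) : 0 < e ->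
  \forall h \near 0^'+, forall x, `|\sum_y p h x y * f y - f x - h * L f x| <= e * h.
Proof.
move=> e0; apply: filter_forall => x; have [_ _ _ _ /(_ f x)] := tp.
move=> /cvgrPdist_le/(_ e e0); apply: filterS2 (nbhs_right_gt _) => h h0.
rewrite -(ler_pM2r h0) => l; apply: le_trans l.
rewrite -[X in _ <= _ * X](ger0_norm (ltW h0)) -normrM distrC.
rewrite mulrBl mulrAC mulVf ?gt_eqF// mul1r -normrN opprB.
by rewrite [X in `|_ - X|]mulrC distrC -normrN opprB le_eqVlt eqxx.
Qed.

Variables (S : {set E}) (phi : E -> R).
Hypothesis phi0 : forall x, 0 <= phi x.
Hypothesis Lphi : forall x, x \notin S -> L phi x <= -1.

(** For small time steps the Lyapunov function of the generator is one for the
    kernel. *)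
Lemma potential_near :
  \forall h \near 0^'+, forall x, x \notin S -> \sum_y p h x y * phi y <= phi x - h / 2.
Proof.
have h2 : (0 : R) < 1 / 2 by rewrite divr_gt0.
apply: filterS2 (nbhs_right_gt 0) (transition_near phi h2) => h h0 l x xS.
have := l x; rewrite ler_norml => /andP[_]; have := Lphi xS.
by rewrite -(ler_pM2l h0); lra.
Qed.

Definition growth_bound : R := \sum_x `|L phi x| + 1.

Lemma growth_near :
  \forall h \near 0^'+, forall x, \sum_y p h x y * phi y <= phi x + h * growth_bound.
Proof.
have h1 : (0 : R) < 1 by [].
apply: filterS2 (nbhs_right_gt 0) (transition_near phi h1) => h h0 l x.
have := l x; rewrite ler_norml => /andP[_].
have : L phi x <= \sum_x `|L phi x|.
  rewrite (bigD1 x)//=; apply: (le_trans (ler_norm _)); rewrite lerDl.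
  by apply: sumr_ge0.
rewrite -(ler_pM2l h0) /growth_bound; lra.
Qed.

Variable H : E -> E -> R.
Hypothesis HS : forall x j, x \in S -> H x j = (x == j)%:R.
Hypothesis LH : forall x j, x \notin S -> L (H ^~ j) x = 0.

(** The entrance law of the discrete chain nearly solves the equation of [H]:
    the defect is [o(h)] by harmonicity, so by the maximum principle with
    [phi], which decreases by [h / 2] per step, the two differ by [o(1)]. In
    the trace kernel this difference is multiplied by the probability to leave
    the state, which is [O(h)]. *)
Lemma trace_kernel_near (e : R) : 0 < e -> \forall h \near 0^'+,
  forall i j : {x : E | x \in S},
  `|trace_kernel (p h) i j - (i == j)%:R - h * L (H ^~ (val j)) (val i)| <= e * h.
Proof.
move=> e0; pose Phi := \sum_x phi x.
have phiPhi x : phi x <= Phi by rewrite /Phi (bigD1 x)//= lerDl sumr_ge0.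
have Phi0 : 0 <= Phi by apply: sumr_ge0.
pose q := \sum_x `|L (fun y => (y == x)%:R) x| + 1.
have q0 : 0 < q by rewrite ltr_pwDr// sumr_ge0.
(* tolerance in the equation of H: e / 2 for the main term; the other bound
    makes 4 d Phi q at most e / 2 *)
pose d := Num.min (e / 2) (e / (8 * q * (Phi + 1))).
have P1 : 0 < 8 * q * (Phi + 1) by rewrite !mulr_gt0// ltr_wpDl.
have d0 : 0 < d by rewrite lt_min !divr_gt0.
have d1 : d <= e / 2 by rewrite ge_min lexx.
have d2 : 4 * d * Phi * q <= e / 2.
  have : d * (8 * q * (Phi + 1)) <= e by rewrite -ler_pdivlMr// ge_min lexx orbT.
  have : 0 <= d * q by rewrite mulr_ge0// ltW.
  by nra.
have nH : \forall h \near 0^'+, forall (j x : E),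
    `|\sum_y p h x y * H y j - H x j - h * L (H ^~ j) x| <= d * h.
  by apply: filter_forall => j; exact: transition_near.
have nI : \forall h \near 0^'+, forall (j x : E),
    `|\sum_y p h x y * (y == j)%:R - (x == j)%:R - h * L (fun y => (y == j)%:R) x| <= 1 * h.
  by apply: filter_forall => j; exact: transition_near.
near=> h => i j.
have h0 : 0 < h by near: h; exact: nbhs_right_gt.
have sp : stochastic (p h) by apply: (transition_stochastic tp); exact: ltW.
have ph : forall x, x \notin S -> \sum_y p h x y * phi y <= phi x - h / 2.
  by near: h; exact: potential_near.
have hH : forall (j x : E), `|\sum_y p h x y * H y j - H x j - h * L (H ^~ j) x| <= d * h.
  by near: h.
have hI : forall (j x : E), `|\sum_y p h x y * (y == j)%:R - (x == j)%:R - h * L (fun y => (y == j)%:R) x| <= 1 * h.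
  by near: h.
have a0 : 0 < h / 2 by rewrite divr_gt0.
pose D y := visit_lim S (p h) y [:: val j] - H y (val j).
have DS y : y \in S -> D y = 0.
  by move=> yS; rewrite /D (visit_lim1_in sp)// HS// eq_sym subrr.
have Dout y : y \notin S -> D y = \sum_z p h y z * D z + (\sum_z p h y z * H z (val j) - H y (val j)).
  move=> yS; rewrite {1}/D (visit_lim_out sp)//.
  under [in RHS]eq_bigr do rewrite mulrBr; rewrite sumrB; ring.
(* maximum principle with t = 4 d, as t h / 2 > d h *)
have Db y : `|D y| <= 4 * d * phi y.
  have t0 : 0 <= 4 * d by rewrite mulr_ge0// ltW.
  have dt : d * h < 4 * d * (h / 2) by have := mulr_gt0 d0 h0; lra.
  rewrite ler_norml -lerNl; apply/andP; split.
    apply: (@discrete_max_principle _ _ S (p h) sp phi (h / 2) phi0 ph (fun y => - D y) (d * h) (4 * d)) => // x xS.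
      by rewrite DS// oppr0.
    rewrite Dout//; have := hH (val j) x; rewrite LH// mulr0 subr0 ler_norml => /andP[l1 l2].
    have -> : \sum_y p h x y * - D y = - \sum_y p h x y * D y.
      by rewrite -sumrN; apply: eq_bigr => z _; rewrite mulrN.
    by lra.
  apply: (@discrete_max_principle _ _ S (p h) sp phi (h / 2) phi0 ph D (d * h) (4 * d)) => // x xS.
    by rewrite DS.
  rewrite Dout//; have := hH (val j) x; rewrite LH// mulr0 subr0 ler_norml => /andP[l1 l2].
  by lra.
have KE : trace_kernel (p h) i j = \sum_y p h (val i) y * H y (val j) + \sum_y p h (val i) y * D y.
  by rewrite /trace_kernel -big_split/=; apply: eq_bigr => y _; rewrite /D; ring.
have out : \sum_(y | y != val i) p h (val i) y <= q * h.
  have := hI (val i) (val i); rewrite eqxx mulr1n ler_norml => /andP[l1 _].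
  have e1 : \sum_y p h (val i) y * (y == val i)%:R = p h (val i) (val i).
    by rewrite (bigD1 (val i))//= eqxx mulr1 big1 ?addr0// => y /negbTE ->; rewrite mulr0.
  have := sp.2 (val i); rewrite (bigD1 (val i))//= => e2.
  have l3 : - L (fun y => (y == val i)%:R) (val i) <= \sum_x `|L (fun y => (y == x)%:R) x|.
    apply: (@le_trans _ _ `|L (fun y => (y == val i)%:R) (val i)|).
      by rewrite -normrN ler_norm.
    by rewrite [leRHS](bigD1 (val i))//= lerDl sumr_ge0.
  have := ler_wpM2r (ltW h0) l3; rewrite /q; rewrite e1 in l1; lra.
have second : `|\sum_y p h (val i) y * D y| <= e / 2 * h.
  rewrite (bigD1 (val i))//= DS ?(valP i)// mulr0 add0r.
  apply: (le_trans (ler_norm_sum _ _ _)).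
  apply: (@le_trans _ _ (\sum_(y | y != val i) p h (val i) y * (4 * d * Phi))).
    apply: ler_sum => y _; rewrite normrM (ger0_norm (sp.1 _ _)).
    apply: ler_wpM2l; first exact: sp.1.
    by apply: (le_trans (Db y)); apply: ler_wpM2l => //; rewrite mulr_ge0// ltW.
  rewrite -mulr_suml; have t0 : 0 <= 4 * d * Phi by rewrite !mulr_ge0// ltW.
  apply: (le_trans (ler_wpM2r t0 out)).
  rewrite (_ : q * h * _ = 4 * d * Phi * q * h); last by ring.
  by apply: ler_wpM2r => //; exact: ltW.
have first := hH (val j) (val i).
rewrite HS ?(valP i)// (_ : (val i == val j) = (i == j)) // in first.
rewrite KE (_ : _ - _ = (\sum_y p h (val i) y * H y (val j) - (i == j)%:R - h * L (H ^~ (val j)) (val i))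
  + \sum_y p h (val i) y * D y); last by ring.
apply: (le_trans (ler_normD _ _)); have : d * h <= e / 2 * h by rewrite ler_wpM2r// ltW.
by move: first second; lra.
Unshelve. all: by end_near.
Qed.

End KernelAsymptotics.

Section TraceApproximation.
Context {R : realType} {E : finType} d (W : measurableType d) (P : probability W R).
Local Open Scope classical_set_scope.
Local Open Scope ring_scope.
Variables (L : (E -> R) -> E -> R) (S : {set E}) (phi : E -> R).
Hypothesis phi0 : forall x, 0 <= phi x.
Hypothesis Lphi : forall x, x \notin S -> L phi x <= -1.
Variables (e0 : {e : E | e \in S}) (X : W -> R -> E).
Hypothesis mX : markov_chain P L (val e0) X.

Lemma visit_countE (x : R -> E) (h : R) i :
  visit_count S (fun j : nat => x (j%:R * h)) i = visits S x h i.
Proof.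
elim: i => [|i IH]; first by rewrite /visits big_ord0.
by rewrite visit_countS visitsS IH.
Qed.

Lemma pow4_near (A : R -> Prop) : (\forall h \near 0^'+, A h) ->
  exists n0 : nat, forall n, (n0 <= n)%N -> A (4 ^+ n)^-1.
Proof.
move=> /nbhs_right_ex[e epos hA]; exists (Num.truncn e^-1).+1 => n hn.
have n4 : (0 : R) < 4 ^+ n by rewrite exprn_gt0.
apply: hA; rewrite invr_gt0 n4 add0r -[ltRHS]invrK ltf_pV2 ?posrE ?invr_gt0//.
apply: (lt_trans (truncnS_gt _)); apply: (@le_lt_trans _ _ (n%:R : R)); first by rewrite ler_nat.
by rewrite -natrX ltr_nat ltn_expl.
Qed.

(** By [few_visits], observed on finer and finer time grids, a bounded
    occupation time up to a large time [v] has probability [O (1 / v)]. Riemann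
    sums pass from visits to occupation times. *)
Lemma trace_unbounded_ae :
  {ae P, forall w, forall y : R, exists2 v, 0 <= v & y < time_spent S (X w) v}.
Proof.
have [p tp mZ] := skeleton_markov mX.
have cX w : cadlag (X w) by have [_ cX _] := mX.
suff H (y : nat) : {ae P, forall w, exists2 v, 0 <= v & y%:R < time_spent S (X w) v}.
  have := ae_foralln H; apply: filterS => w hw y.
  have [v v0 yv] := hw (Num.truncn y).+1; exists v => //.
  by apply: lt_trans yv; exact: truncnS_gt.
pose h (n : nat) : R := (4 ^+ n)^-1.
have h0 n : 0 < h n by rewrite invr_gt0 exprn_gt0.
have h4 n : h n * 4 ^+ n = 1 by rewrite mulVf// expf_neq0.
pose Z n w (i : nat) := X w (i%:R * h n).
have mZn n : discrete_markov P (p (h n)) (val e0) (Z n) by apply: mZ; exact: ltW.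
(* less than (y + 1) 4 ^ n observations in S up to time v, hence an occupation
    time less than about y + 1 *)
pose bad (v n : nat) := [set w | (fun l => (count (mem S) l < y.+1 * 4 ^ n)%N) (mkseq (Z n w) (v * 4 ^ n).+1)].
have mbad v n : measurable (bad v n).
  exact: (measurable_mkseq (v * 4 ^ n).+1 (fun l => (count (mem S) l < y.+1 * 4 ^ n)%N) (mZn n).1).
pose c := 2 * (phi (val e0) + (growth_bound L phi + 1 / 2) * y.+1%:R).
have [n1 hn1] : exists n1, forall n, (n1 <= n)%N ->
    (forall x, x \notin S -> \sum_y p (h n) x y * phi y <= phi x - h n / 2) /\
    (forall x, \sum_y p (h n) x y * phi y <= phi x + h n * growth_bound L phi).
  have [m1 H1] := pow4_near (potential_near tp Lphi).
  have [m2 H2] := pow4_near (growth_near tp phi).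
  by exists (maxn m1 m2) => n; rewrite geq_max => /andP[/H1 ? /H2].
have g0 : 0 <= growth_bound L phi by rewrite addr_ge0// sumr_ge0.
have c0 : 0 <= c by rewrite !mulr_ge0// addr_ge0// mulr_ge0// addr_ge0.
have Pbad v n : (0 < v)%N -> (n1 <= n)%N -> (P (bad v n) <= (c / v%:R)%:E)%E.
  move=> v0 n1n; have [H1 H2] := hn1 n n1n.
  rewrite (markov_probability (v * 4 ^ n) (fun l => (count (mem S) l < y.+1 * 4 ^ n)%N) (mZn n)).
  rewrite lee_fin ler_pdivlMr ?ltr0n//.
  have sp : stochastic (p (h n)) by apply: (transition_stochastic tp); exact: ltW.
  have C0 : 0 <= h n * growth_bound L phi + h n / 2.
    by rewrite addr_ge0 ?mulr_ge0 ?divr_ge0// ltW.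
  have a0 : 0 < h n / 2 by rewrite divr_gt0.
  have H3 x : \sum_y p (h n) x y * phi y <= phi x + (h n * growth_bound L phi + h n / 2) - h n / 2.
    by have := H2 x; lra.
  have := few_visits sp phi0 a0 H1 (v * 4 ^ n) (y.+1 * 4 ^ n) (val e0) C0 H3.
  rewrite !natrM !natrX; set pe := path_exp _ _ _ _; rewrite /c.
  have -> : pe * (v%:R * 4 ^+ n * (h n / 2)) = pe * v%:R / 2 * (h n * 4 ^+ n) by ring.
  have -> : (h n * growth_bound L phi + h n / 2) * (y.+1%:R * 4 ^+ n) =
    (growth_bound L phi + 1 / 2) * y.+1%:R * (h n * 4 ^+ n) by field.
  by rewrite h4 !mulr1; lra.
pose F v := \bigcup_m \bigcap_(n in [set n | (m <= n)%N]) bad v n.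
have mFm v m : measurable (\bigcap_(n in [set n | (m <= n)%N]) bad v n).
  by apply: bigcap_measurable; [exists m => /=|move=> n _; exact: mbad].
have mF v : measurable (F v) by apply: bigcup_measurable => m _; exact: mFm.
have PF v : (0 < v)%N -> (P (F v) <= (c / v%:R)%:E)%E.
  move=> v0.
  have cv : P (\bigcap_(n in [set n | (m <= n)%N]) bad v n) @[m --> \oo] --> P (F v).
    apply: (nondecreasing_cvg_mu (mFm v) (mF v)) => m m' mm'.
    by apply/subsetPset => w hw n /= mn; apply: hw => /=; exact: leq_trans mn.
  rewrite -(cvg_lim _ cv)//; apply: lime_le; first by apply/cvg_ex; exists (P (F v)).
  apply: nearW => m; apply: (@le_trans _ _ (P (bad v (maxn m n1)))).
    apply: le_measure; rewrite ?inE//.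
    by move=> w; apply => /=; rewrite leq_maxl.
  by apply: Pbad => //; rewrite leq_maxr.
exists (\bigcap_(v in [set v | (0 < v)%N]) F v); split.
- by apply: bigcap_measurable; [exists 1%N|move=> v _; exact: mF].
- apply/eqP; rewrite eq_le measure_ge0 andbT; apply/lee_addgt0Pr => e epos.
  rewrite add0e; pose v := (Num.truncn (c / e)).+1.
  apply: (@le_trans _ _ (P (F v))).
    apply: le_measure; rewrite ?inE//; first by apply: bigcap_measurable; [exists 1%N|move=> ? _; exact: mF].
    by move=> w; apply.
  apply: (le_trans (PF v isT)); rewrite lee_fin ler_pdivrMr ?ltr0n//.
  by rewrite mulrC -ler_pdivrMr//; apply: ltW; exact: truncnS_gt.
- move=> w /= nw v v0; apply: contrapT => nF; apply: nw.
  have [J hJ] := @riemann_visits _ _ S (X w) (cX w) (v%:R + 1) (addr_ge0 (ler0n _ _) ler01).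
  exists (v%:R + 1); first by rewrite addr_ge0.
  apply: contrapT => /negP; rewrite -leNgt => Ty; apply: nF.
  exists (Num.truncn (J%:R : R)).+1 => // n /= Jn.
  have n4 : (0 : R) < 4 ^+ n by rewrite exprn_gt0.
  have Jh : J%:R * h n < 1.
    rewrite /h ltr_pdivrMr// mul1r; apply: (lt_trans (truncnS_gt _)).
    apply: (@le_lt_trans _ _ (n%:R : R)); first by rewrite ler_nat.
    by rewrite -natrX ltr_nat ltn_expl.
  have hv : (v * 4 ^ n)%:R * h n = v%:R by rewrite natrM natrX -mulrA mulfV ?mulr1// gt_eqF.
  have h1 : h n <= 1 by rewrite invf_le1// -natrX ler1n expn_gt0.
  have le1 : (v * 4 ^ n).+1%:R * h n <= v%:R + 1 by rewrite -natr1 mulrDl hv mul1r lerD2l.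
  have := hJ (h n) (v * 4 ^ n).+1 (h0 n) le1; rewrite ler_norml => /andP[_ l2].
  have := @time_spent_mono _ _ S (X w) (cX w) ((v * 4 ^ n).+1%:R * h n) (v%:R + 1) _ le1.
  move=> /(_ _) l3; have {}l3 := l3 (mulr_ge0 (ler0n _ _) (ltW (h0 n))).
  suff vc : (visits S (X w) (h n) (v * 4 ^ n).+1 < y.+1 * 4 ^ n)%N.
    by move: vc; rewrite -(visit_countE (X w) (h n)).
  rewrite -(ltr_nat R) natrM natrX -(ltr_pM2l (h0 n)).
  have -> : h n * (y.+1%:R * 4 ^+ n) = y%:R + 1 by rewrite mulrCA h4 mulr1 natr1.
  lra.
Qed.

Lemma trace_approx_ae (c : R) : 0 < c ->
  {ae P, forall w, cadlag (fun t => trace_path e0 (X w) (c * t)) /\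
    forall t, 0 <= t -> exists n0, forall n, (n0 <= n)%N ->
      trace_chain e0 (fun i : nat => X w (i%:R * (c / 4 ^+ n))) (visit_index n t) =
      trace_path e0 (X w) (c * t)}.
Proof.
move=> c0; apply: filterS trace_unbounded_ae => w Tw.
have cX : cadlag (X w) by have [_ cX _] := mX.
split; first exact: trace_path_cadlag.
move=> t t0; have [n0 hn] := visits_limit cX Tw c0 t0; exists n0 => n /hn[i [h1 h2]].
have y0 : 0 <= c * t by rewrite mulr_ge0// ltW.
apply: val_inj; rewrite -h2 -visit_countE trace_chainE; last by rewrite h1 trace_time_in.
by rewrite h1 /trace_path insubdK// trace_time_in.
Qed.

End TraceApproximation.

(** * Integrals of functions that need not be measurable *)

Section OuterIntegral.
Context {R : realType} d (W : measurableType d) (P : probability W R).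
Local Open Scope classical_set_scope.
Local Open Scope ring_scope.
Implicit Types (f g : W -> R).

(** The integral of a nonnegative function is a supremum over the simple
    functions below it, so monotonicity needs no measurability. *)
Lemma ge0_integral_mono (f g : W -> \bar R) : (forall w, (0 <= f w)%E) ->
  (forall w, (f w <= g w)%E) -> (\int[P]_w f w <= \int[P]_w g w)%E.
Proof.
move=> f0 fg; have g0 w : (0 <= g w)%E by apply: le_trans (fg w).
rewrite !ge0_integralE// !patch_setT; apply: le_ereal_sup => _ [h hf <-].
by exists h => // w; apply: le_trans (hf w) (fg w).
Qed.

Lemma ge0_integral_bounded f (C : R) : (forall w, 0 <= f w <= C) ->
  exists2 r, (\int[P]_w (f w)%:E = r%:E)%E & 0 <= r <= C.
Proof.
move=> fC.
have h0 : (0 <= \int[P]_w (f w)%:E)%E.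
  by apply: integral_ge0 => w _; rewrite lee_fin; have /andP[] := fC w.
have hC : (\int[P]_w (f w)%:E <= C%:E)%E.
  have -> : (C%:E = \int[P]_w (C%:E))%E by rewrite integral_cst// [X in (_ * X)%E](probability_setT P) mule1.
  by apply: ge0_integral_mono => w; rewrite lee_fin; have /andP[] := fC w.
have fn : (\int[P]_w (f w)%:E)%E \is a fin_num by rewrite ge0_fin_numE// (le_lt_trans hC)// ltry.
exists (fine (\int[P]_w (f w)%:E)%E); first by rewrite fineK.
by rewrite -!lee_fin fineK// h0.
Qed.

(** The real-valued integral is defined through [fine]; for bounded functions
    no infinite value is lost. *)
Lemma Rintegral_split f (C : R) : (forall w, `|f w| <= C) ->
  exists a b, [/\ (\int[P]_w (Num.max (f w) 0)%:E = a%:E)%E,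
    (\int[P]_w (Num.max (- f w) 0)%:E = b%:E)%E & \int[P]_w f w = a - b].
Proof.
move=> fC.
have bnd g : (forall w, `|g w| <= C) -> forall w, 0 <= Num.max (g w) 0 <= C.
  move=> gC w; rewrite le_max lexx orbT ge_max/=; have := gC w; rewrite ler_norml => /andP[h1 h2].
  by rewrite h2 (le_trans (normr_ge0 (g w))).
have [a ea _] := ge0_integral_bounded (bnd f fC).
have [b eb _] := ge0_integral_bounded (bnd (fun w => - f w) (fun w => ltac:(rewrite normrN; exact: fC))).
exists a, b; split => //.
rewrite /Rintegral integralE.
rewrite (_ : (\int[P]_x (fun w => (f w)%:E)^\+ x)%E = a%:E); last first.
  by rewrite -ea; apply: eq_integral => w _; rewrite funeposE -EFin_max.
rewrite (_ : (\int[P]_x (fun w => (f w)%:E)^\- x)%E = b%:E)//.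
by rewrite -eb; apply: eq_integral => w _; rewrite funenegE -EFinN -EFin_max.
Qed.

(** For a function that is not measurable the integral is not additive, but it
    is odd: the positive and the negative parts are integrated separately. *)
Lemma RintegralN_bounded f (C : R) : (forall w, `|f w| <= C) ->
  \int[P]_w (- f w) = - \int[P]_w f w.
Proof.
move=> fC; have [a [b [ea eb ->]]] := Rintegral_split fC.
have fC' w : `|- f w| <= C by rewrite normrN.
have [a' [b' [ea' eb' ->]]] := Rintegral_split fC'.
have -> : a' = b by have := etrans (esym ea') eb; case.
rewrite opprB; congr (_ - _).
have : b'%:E = a%:E.
  by rewrite -eb' -ea; apply: eq_integral => w _; rewrite opprK.
by case.
Qed.

(** The inequality fails at most on a measurable null set, on which the
    positive part of [g] can be replaced by [C] and the negative part by 0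
    without changing their integrals. After this, the inequality holds
    everywhere. *)
Lemma Rintegral_le_ae f g (C : R) : (forall w, `|f w| <= C) -> (forall w, `|g w| <= C) ->
  measurable_fun setT g -> {ae P, forall w, f w <= g w} ->
  \int[P]_w f w <= \int[P]_w g w.
Proof.
move=> fC gC mg [N [mN N0 hN]].
have [a [b [ea eb ->]]] := Rintegral_split fC.
have [a' [b' [ea' eb' ->]]] := Rintegral_split gC.
have inN w : ~ N w -> f w <= g w.
  by move=> nN; apply: contrapT => fg; apply: nN; apply: hN.
have mg1 : measurable_fun setT (fun w => (Num.max (g w) 0)%:E).
  by apply/measurable_EFinP; apply: measurable_maxr.
have mg2 : measurable_fun setT (fun w => (Num.max (- g w) 0)%:E).
  by apply/measurable_EFinP; apply: measurable_maxr => //; apply: measurableT_comp.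
have C0 (w : W) : 0 <= C := le_trans (normr_ge0 _) (fC w).
have aeN (h1 h2 : W -> \bar R) : (forall w, ~ N w -> h1 w = h2 w) -> ae_eq P setT h1 h2.
  by move=> h; exists N; split => // w /= nh; apply: contrapT => nN; apply: nh => _; exact: h.
rewrite lerB//.
  rewrite -lee_fin -ea -ea'.
  have -> : (\int[P]_w (Num.max (g w) 0)%:E =
      \int[P]_w ((fun w => Num.max (Num.max (g w) 0) (C * \1_N w)) w)%:E)%E.
    apply: ge0_ae_eq_integral => //.
    - by apply/measurable_EFinP; apply: measurable_maxr; [exact/measurable_EFinP|apply: measurable_funM].
    - by move=> w _; rewrite lee_fin !le_max lexx orbT.
    - by move=> w _; rewrite lee_fin !le_max lexx orbT.
    apply: aeN => w nN; cbv beta; rewrite indicE memNset// mulr0; congr (_%:E).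
    by rewrite [RHS]max_l// le_max lexx orbT.
  apply: ge0_integral_mono => w; first by rewrite lee_fin le_max lexx orbT.
  rewrite lee_fin; have [wN|nN] := pselect (N w).
    rewrite indicE mem_set// mulr1 le_max; apply/orP; right.
    by rewrite ge_max (C0 w) andbT; have := fC w; rewrite ler_norml => /andP[].
  rewrite le_max; apply/orP; left; rewrite ge_max le_max inN//=.
  by rewrite le_max lexx orbT.
rewrite -lee_fin -eb -eb'.
have -> : (\int[P]_w (Num.max (- g w) 0)%:E =
    \int[P]_w ((fun w => Num.max (- g w) 0 * (1 - \1_N w)) w)%:E)%E.
  apply: ge0_ae_eq_integral => //.
  - by apply/measurable_EFinP; apply: measurable_funM; [exact/measurable_EFinP|apply: measurable_funB].
  - by move=> w _; rewrite lee_fin le_max lexx orbT.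
  - move=> w _; rewrite lee_fin; apply: mulr_ge0; first by rewrite le_max lexx orbT.
    by rewrite indicE subr_ge0; case: (w \in N).
  by apply: aeN => w nN; cbv beta; rewrite indicE memNset// subr0 mulr1.
apply: ge0_integral_mono => w.
  rewrite lee_fin; apply: mulr_ge0; first by rewrite le_max lexx orbT.
  by rewrite indicE subr_ge0; case: (w \in N).
rewrite lee_fin; have [wN|nN] := pselect (N w).
  by rewrite indicE mem_set// subrr mulr0 le_max lexx orbT.
rewrite indicE memNset// subr0 mulr1 ge_max le_max lerN2 inN//=.
by rewrite le_max lexx orbT.
Qed.

(** Only the functions [g n] are measurable. The function [f] is compared with
    their inferior limit. *)
Lemma Rintegral_fatou f (g : nat -> W -> R) (C b : R) : 0 <= C -> (forall w, `|f w| <= C) ->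
  (forall n, measurable_fun setT (g n)) -> (forall n w, 0 <= g n w <= 2 * C) ->
  {ae P, forall w, exists n0, forall n, (n0 <= n)%N -> f w + C <= g n w} ->
  (exists n0, forall n, (n0 <= n)%N -> (\int[P]_w (g n w)%:E <= (b + C)%:E)%E) ->
  \int[P]_w f w <= b.
Proof.
move=> C0 fC mg g0 fg [n0 hn0].
(* the inferior limit is measurable, and bounds f + C almost everywhere *)
pose l w := limn_einf (fun n => (g n w)%:E).
have einfs_cv w : einfs (fun n => (g n w)%:E) n @[n --> \oo] --> l w.
  by rewrite /l limn_einf_lim; exact: is_cvg_einfs.
have l_ge w (c : R) m : (forall n, (m <= n)%N -> c <= g n w) -> (c%:E <= l w)%E.
  move=> h; rewrite /l limn_einf_lim; apply: lime_ge; first exact: is_cvg_einfs.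
  exists m => // n /= mn; apply: le_ereal_inf_tmp => _ [k /= nk <-].
  by rewrite lee_fin h// (leq_trans mn).
have l0 w : (0 <= l w)%E by apply: (l_ge w 0 0%N) => n _; have /andP[] := g0 n w.
have lC w : (l w <= (2 * C)%:E)%E.
  rewrite /l limn_einf_lim; apply: lime_le; first exact: is_cvg_einfs.
  apply: nearW => n; apply: (@le_trans _ _ (g n w)%:E).
    by apply: ereal_inf_lbound; exists n => /=.
  by rewrite lee_fin; have /andP[] := g0 n w.
have lfin w : l w \is a fin_num by rewrite ge0_fin_numE// (le_lt_trans (lC w))// ltry.
have ml : measurable_fun setT l.
  rewrite /l (_ : (fun w => _) = (fun w => - limn_esup (fun n => (- g n w)%:E))%E).
    apply: measurableT_comp => //; apply: measurable_fun_limn_esup => n.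
    by apply/measurable_EFinP; exact: measurableT_comp.
  by apply/funext => w; rewrite /limn_einf.
pose G w := fine (l w) - C.
have mG : measurable_fun setT G.
  by apply: measurable_funB => //; apply: measurableT_comp => //; exact: measurable_fine.
have GC w : `|G w| <= C.
  have h1 := l0 w; have h2 := lC w; rewrite -(fineK (lfin w)) !lee_fin in h1 h2.
  by rewrite /G ler_norml; lra.
apply: (@le_trans _ _ (\int[P]_w G w)).
  apply: (Rintegral_le_ae fC GC mG); apply: filterS fg => w [m hm].
  by rewrite /G lerBrDr -lee_fin fineK// (l_ge w _ m).
have lE : (\int[P]_w l w <= (b + C)%:E)%E.
  apply: (@le_trans _ _ (limn_einf (fun n => \int[P]_w (g n w)%:E)%E)).
    apply: fatou => // [n|n w _]; first by apply/measurable_EFinP.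
    by rewrite lee_fin; have /andP[] := g0 n w.
  rewrite limn_einf_lim; apply: lime_le; first exact: is_cvg_einfs.
  exists n0 => // n /= n0n; apply: le_trans (hn0 n n0n).
  by apply: ereal_inf_lbound; exists n => /=.
have iC : P.-integrable setT (EFin \o (cst C : W -> R)).
  exact: finite_measure_integrable_cst.
have il : P.-integrable setT (EFin \o (fun w => fine (l w))).
  apply: (le_integrable measurableT (g := EFin \o (cst (2 * C) : W -> R))).
  - by apply/measurable_EFinP; apply: measurableT_comp => //; exact: measurable_fine.
  - move=> w _ /=; have h1 := l0 w; have h2 := lC w; rewrite -(fineK (lfin w)) !lee_fin in h1 h2.
    by rewrite lee_fin !ger0_norm// mulr_ge0.
  - exact: finite_measure_integrable_cst.
rewrite /G RintegralB// Rintegral_cst// [X in fine X](probability_setT P) mulr1 lerBlDr.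
rewrite /Rintegral; under eq_integral do rewrite fineK//.
rewrite -lee_fin fineK//.
rewrite ge0_fin_numE; first by rewrite (le_lt_trans lE)// ltry.
by apply: integral_ge0.
Qed.

End OuterIntegral.

Section BoundedConvergence.
Context {R : realType} d (W : measurableType d) (P : probability W R).
Local Open Scope classical_set_scope.
Local Open Scope ring_scope.
Implicit Types (f g : W -> R).

Lemma bounded_integrable f (C : R) : measurable_fun setT f -> (forall w, `|f w| <= C) ->
  P.-integrable setT (EFin \o f).
Proof.
move=> mf fC; apply: (le_integrable measurableT (g := EFin \o (cst C : W -> R))).
- exact/measurable_EFinP.
- by move=> w _ /=; rewrite lee_fin [X in _ <= X]ger0_norm// (le_trans (normr_ge0 _) (fC w)).
- exact: finite_measure_integrable_cst.
Qed.

Lemma integral_Rintegral f : P.-integrable setT (EFin \o f) ->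
  (\int[P]_w (f w)%:E)%E = (\int[P]_w f w)%:E.
Proof. by move=> fi; rewrite /Rintegral fineK//; exact: integrable_fin_num. Qed.

(** Dominated convergence on a probability space. *)
Lemma bounded_convergence (f : nat -> W -> R) g (C : R) :
  (forall n, measurable_fun setT (f n)) -> measurable_fun setT g ->
  (forall n w, `|f n w| <= C) -> (forall w, `|g w| <= C) ->
  (forall w, f n w @[n --> \oo] --> g w) ->
  \int[P]_w f n w @[n --> \oo] --> \int[P]_w g w.
Proof.
move=> mf mg fC gC fg.
have igC := bounded_integrable mg gC.
apply: fine_cvg; rewrite fineK; last exact: integrable_fin_num.
apply: (dominated_cvg measurableT (g := EFin \o (cst C : W -> R))) => //.
- by move=> n; exact/measurable_EFinP.
- by move=> w _; apply: cvg_EFin; [exact: nearW|exact: fg].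
- exact: finite_measure_integrable_cst.
- by move=> n w _; rewrite /= lee_fin.
Qed.

End BoundedConvergence.

(** * Envelopes of a functional over paths with given samples *)

Section Envelope.
Context {R : realType} {E : finType} (y0 : E) (F : (R -> E) -> R) (C : R).
Hypothesis C0 : 0 <= C.
Hypothesis FC : forall x, `|F x| <= C.
Variables (d : R) (I : nat).
Hypothesis d0 : 0 < d.
Local Open Scope classical_set_scope.
Local Open Scope ring_scope.
Implicit Types (z x : R -> E) (s l : seq E) (c : nat -> E).

Definition grid_values z : seq E := mkseq (fun i : nat => z (i%:R * d)) I.+1.

Definition slow_path z : Prop := cadlag z /\
  forall i : nat, (i < I)%N -> one_change z (i%:R * d) (i.+1%:R * d).

(** The supremum of [F] over the slow paths with given values on the grid, and
    0 if there is no such path. *)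
Definition envelope s : R := sup [set F z | z in [set z | slow_path z /\ grid_values z = s]].

(** The observation that stands for the grid point [i d] among those of the
    chain with step [4 ^- n]. *)
Definition grid_index n (i : nat) : nat := visit_index n (i%:R * d).

Definition grid_sample n l : seq E := mkseq (fun i => nth y0 l (grid_index n i)) I.+1.

(** The observations witness two changes in the same cell. *)
Definition hasty n l : bool := `[< exists i k1 k2 k3 : nat, [/\ (i < I)%N,
  (grid_index n i <= k1)%N && (k1 < k2)%N && (k2 < k3)%N && (k3 <= grid_index n i.+1)%N,
  nth y0 l k1 != nth y0 l k2 & nth y0 l k2 != nth y0 l k3] >].

(** An upper bound of [F] as a function of the observations, shifted by [C] so
    that it is nonnegative. *)
Definition upper_value n l : R := (if hasty n l then C else envelope (grid_sample n l)) + C.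

Definition sample_size n := grid_index n I.

Lemma envelope_bound s : `|envelope s| <= C.
Proof.
rewrite /envelope; set A := [set F z | z in _].
have [[a Aa]|nA] := pselect (A !=set0); last first.
  by rewrite sup_out ?normr0// => -[].
have AC b : A b -> - C <= b <= C by move=> [z _ <-]; rewrite -ler_norml.
have hA : has_sup A by split; [exists a|exists C => b /AC/andP[]].
rewrite ler_norml; apply/andP; split.
  by apply: le_trans (ub_le_sup hA.2 Aa); have /andP[] := AC _ Aa.
by apply: ge_sup => [|b /AC/andP[]//]; exists a.
Qed.

Lemma envelope_ge z : slow_path z -> F z <= envelope (grid_values z).
Proof.
move=> sz; apply: ub_le_sup; last by exists z.
by exists C => _ [u _ <-]; have := FC u; rewrite ler_norml => /andP[].
Qed.

Lemma upper_value_bound n l : 0 <= upper_value n l <= 2 * C.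
Proof.
rewrite /upper_value; case: ifP => _; first by have := C0; move=> h; apply/andP; split; lra.
have := envelope_bound (grid_sample n l); rewrite ler_norml => /andP[h1 h2]; apply/andP; split; lra.
Qed.

Lemma visit_index_mono n (s t : R) : s <= t -> (visit_index n s <= visit_index n t)%N.
Proof.
move=> st; rewrite leq_add2r le_truncn// ler_wpM2r// exprn_ge0//.
Qed.

(** The shift by [2 ^ n] is a shift by [2 ^- n] in time. *)
Lemma visit_index_time n (t : R) : 0 <= t ->
  t <= (visit_index n t)%:R * (4 ^+ n)^-1 <= t + (2 ^+ n)^-1.
Proof.
move=> t0; have p4 : (0 : R) < 4 ^+ n by rewrite exprn_gt0.
have p2 : (1 : R) <= 2 ^+ n by rewrite exprn_ege1// ler1n.
have /truncn_itv : 0 <= t * 4 ^+ n by rewrite mulr_ge0// ltW.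
rewrite /visit_index; set k := Num.truncn _ => /andP[k1 k2].
have e4 : (4 ^+ n : R) = 2 ^+ n * 2 ^+ n by rewrite -exprMn -natrM.
rewrite ler_pdivlMr// ler_pdivrMr// natrD natrX.
apply/andP; split; first by move: k2; rewrite -natr1; lra.
rewrite mulrDl lerD// e4 mulrA mulVf ?mul1r//; lra.
Qed.

Lemma sample_le n i : (i <= I)%N -> (grid_index n i <= sample_size n)%N.
Proof. by move=> iI; apply: visit_index_mono; rewrite ler_pM2r// ler_nat. Qed.

Lemma nth_sample n c k : (k <= sample_size n)%N ->
  nth y0 (mkseq c (sample_size n).+1) k = c k.
Proof. by move=> h; rewrite nth_mkseq. Qed.

(** The chain [c n] with step [4 ^- n] gives the path [x] in the limit.
    Convergence is pointwise in time; there is no uniformity in [t]. *)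
Definition samples (c : nat -> nat -> E) x : Prop :=
  forall t, 0 <= t -> exists n0, forall n, (n0 <= n)%N -> c n (visit_index n t) = x t.

Lemma samples_grid (c : nat -> nat -> E) x : samples c x -> exists n0, forall n, (n0 <= n)%N ->
  grid_sample n (mkseq (c n) (sample_size n).+1) = grid_values x.
Proof.
move=> cx.
have /choice[N hN] (i : nat) : exists n0, forall n, (n0 <= n)%N -> c n (grid_index n i) = x (i%:R * d).
  by apply: cx; rewrite mulr_ge0// ltW.
exists (\max_(i < I.+1) N i)%N => n hn; apply/eq_in_map => i; rewrite mem_iota add0n => iI.
rewrite nth_sample; last exact: sample_le.
by apply: hN; apply: leq_trans hn; exact: (leq_bigmax (Ordinal iI)).
Qed.

(** If [x] is slow it is one of the paths in the supremum. Otherwise three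
    times in one cell show two changes, and the chain sees the values at these
    times eventually, so that its samples are hasty and the trivial bound [C]
    applies. *)
Lemma upper_value_ge (c : nat -> nat -> E) x : cadlag x -> samples c x ->
  exists n0, forall n, (n0 <= n)%N -> F x + C <= upper_value n (mkseq (c n) (sample_size n).+1).
Proof.
move=> cdx cx; have [n0 h0] := samples_grid cx.
have FxC : F x <= C by have := FC x; rewrite ler_norml => /andP[].
have [sx|nsx] := pselect (slow_path x).
  exists n0 => n /h0 e; rewrite /upper_value lerD2r; case: ifP => _ //.
  by rewrite e envelope_ge.
have [i iI [u1 [u2 [u3 [h1 h2 h3 h4 [h5 h6]]]]]] : exists2 i : nat, (i < I)%N &
    exists u1 u2 u3, [/\ i%:R * d <= u1, u1 < u2, u2 < u3, u3 <= i.+1%:R * d &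
      x u1 <> x u2 /\ x u2 <> x u3].
  apply: contrapT => nex; apply: nsx; split => // i iI u1 u2 u3 h1 h2 h3 h4.
  apply: contrapT => /not_orP[h5 h6]; apply: nex; exists i => //.
  by exists u1, u2, u3.
have u10 : 0 <= u1 by apply: le_trans h1; rewrite mulr_ge0// ltW.
have [n1 k1] := cx u1 u10.
have [n2 k2] := cx u2 (le_trans u10 (ltW h2)).
have [n3 k3] := cx u3 (le_trans u10 (ltW (lt_trans h2 h3))).
exists (maxn n1 (maxn n2 n3)) => n; rewrite !geq_max => /and3P[/k1 e1 /k2 e2 /k3 e3].
rewrite /upper_value ifT ?lerD2r//; apply/asboolP.
have m12 := visit_index_mono n (ltW h2); have m23 := visit_index_mono n (ltW h3).
have m3 : (visit_index n u3 <= grid_index n i.+1)%N by exact: visit_index_mono.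
have mI := sample_le n iI.
exists i, (visit_index n u1), (visit_index n u2), (visit_index n u3).
rewrite !nth_sample ?e1 ?e2 ?e3; last first.
- exact: leq_trans (leq_trans m12 m23) (leq_trans m3 mI).
- exact: leq_trans m23 (leq_trans m3 mI).
- exact: leq_trans m3 mI.
split => //; [|exact/eqP|exact/eqP].
have -> : (grid_index n i <= visit_index n u1)%N by exact: visit_index_mono.
rewrite m3 !ltn_neqAle m12 m23 !andbT /=.
apply/andP; split; apply/eqP => e.
  by apply: h5; rewrite -e1 -e2 e.
by apply: h6; rewrite -e2 -e3 e.
Qed.

End Envelope.

(** By right-continuity, as [visit_index n t * 4 ^- n] tends to [t] from the
    right. *)
Lemma samples_self {R : realType} {E : finType} (x : R -> E) : cadlag x ->
  samples (fun n i => x (i%:R * (4 ^+ n)^-1)) x.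
Proof.
move=> cx t t0; have [e e0 he] := cadlag_right cx t0.
exists (Num.truncn e^-1).+1 => n hn; apply: he.
have /andP[h1 h2] := visit_index_time n t0; rewrite h1 (le_lt_trans h2)// ltrD2l.
have n2 : (0 : R) < 2 ^+ n by rewrite exprn_gt0.
rewrite -[ltRHS]invrK ltf_pV2 ?posrE ?invr_gt0//.
apply: (lt_trans (truncnS_gt _)); apply: (@le_lt_trans _ _ (n%:R : R)); first by rewrite ler_nat.
by rewrite -natrX ltr_nat ltn_expl.
Qed.

(** * Comparison of laws through discrete approximations *)

Section Sandwich.
Context {R : realType} {E : finType} (y0 : E).
Local Open Scope classical_set_scope.
Local Open Scope ring_scope.

(** Time step of the fine grids, on which chains are observed. *)
Definition dyadic n : R := (4 ^+ n)^-1.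

Lemma dyadic_gt0 n : 0 < dyadic n.
Proof. by rewrite invr_gt0 exprn_gt0. Qed.

(** Mesh of the coarse grids, on which envelopes are taken. *)
Definition mesh j : R := (2 ^+ j)^-1.

Lemma mesh_gt0 j : 0 < mesh j.
Proof. by rewrite invr_gt0 exprn_gt0. Qed.

Lemma mesh_le1 j : mesh j <= 1.
Proof. by rewrite invf_le1 ?exprn_gt0// exprn_ege1// ler1n. Qed.

Lemma mesh_small (e : R) : 0 < e -> exists j0, forall j, (j0 <= j)%N -> mesh j < e.
Proof.
move=> e0; exists (Num.truncn e^-1).+1 => n hn.
rewrite -[ltRHS]invrK ltf_pV2 ?posrE ?invr_gt0 ?exprn_gt0//.
apply: (lt_trans (truncnS_gt _)); apply: (@le_lt_trans _ _ (n%:R : R)); first by rewrite ler_nat.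
by rewrite -natrX ltr_nat ltn_expl.
Qed.

Lemma mesh_mono i j : (i <= j)%N -> mesh j <= mesh i.
Proof. by move=> ij; rewrite lef_pV2 ?posrE ?exprn_gt0// ler_weXn2l// ler1n. Qed.

Lemma mesh_cells m j : (m * 2 ^ j)%:R * mesh j = m%:R.
Proof. by rewrite natrM natrX mulfK// expf_neq0. Qed.

(** Three observations in the same cell are at distance at most two meshes,
    less than the distance between changes of [y]. *)
Lemma never_hasty (y : R -> E) (m : nat) : cadlag y -> exists j0, forall j, (j0 <= j)%N ->
  forall n, (j <= n)%N -> ~~ hasty y0 (mesh j) (m * 2 ^ j) n
    (mkseq (fun i => y (i%:R * dyadic n)) (sample_size (mesh j) (m * 2 ^ j) n).+1).
Proof.
move=> cy; have [|e e0 he] := cadlag_separated cy (v := m%:R + 1); first by rewrite addr_ge0.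
have [j0 hj] := mesh_small (divr_gt0 e0 (ltr0n R 2)); exists j0 => j jj n jn.
have dj := hj _ jj; apply/negP => /asboolP[i [k1 [k2 [k3 [iI /andP[/andP[/andP[h1 h2] h3] h4]]]]]].
have h5 := sample_le (mesh_gt0 j) n iI.
have s3 := leq_trans h4 h5; have s2 := leq_trans (ltnW h3) s3; have s1 := leq_trans (ltnW h2) s2.
rewrite !nth_sample// => /eqP n12 /eqP n23.
have d0 := dyadic_gt0 n.
have g0 (k : nat) : 0 <= k%:R * mesh j by rewrite mulr_ge0// ltW// mesh_gt0.
have /andP[t1 _] := visit_index_time n (g0 i).
have /andP[_ t2] := visit_index_time n (g0 i.+1).
have r1 : i%:R * mesh j <= k1%:R * dyadic n by apply: le_trans t1 _; rewrite ler_pM2r// ler_nat.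
have r3 : k3%:R * dyadic n <= i.+1%:R * mesh j + mesh n.
  by apply: le_trans t2; rewrite ler_pM2r// ler_nat.
have lI : i.+1%:R * mesh j <= m%:R by rewrite -(mesh_cells m j) ler_pM2r ?mesh_gt0// ler_nat.
have nj := mesh_mono jn; have n1 := mesh_le1 n.
have e1 : i.+1%:R * mesh j = i%:R * mesh j + mesh j by rewrite -natr1 mulrDl mul1r.
have := he (k1%:R * dyadic n) (k2%:R * dyadic n) (k3%:R * dyadic n).
case; [exact: le_trans r1|by rewrite ltr_pM2r// ltr_nat|by rewrite ltr_pM2r// ltr_nat|lra|lra|exact: n12|exact: n23].
Qed.

Context d' (W' : measurableType d') (P' : probability W' R) (Y : W' -> R -> E).
Hypothesis cY : forall w, cadlag (Y w).
Hypothesis mY : forall t e, 0 <= t -> measurable [set w | Y w t = e].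

Local Notation Zy n := (fun w (i : nat) => Y w (i%:R * dyadic n)).

Lemma grid_process (h : R) : 0 <= h -> discrete_process (fun w (i : nat) => Y w (i%:R * h)).
Proof. by move=> h0 k e; apply: mY; rewrite mulr_ge0. Qed.

Definition hasty_event m j n : set W' := [set w | hasty y0 (mesh j) (m * 2 ^ j) n
    (mkseq (Zy n w) (sample_size (mesh j) (m * 2 ^ j) n).+1)].

Lemma hasty_event_measurable m j n : measurable (hasty_event m j n).
Proof. by apply: measurable_mkseq; apply: grid_process; rewrite ltW// dyadic_gt0. Qed.

(** For each path no pair [(j, n)] with [j <= n] is hasty once [j] is large, so
    the events [T J] decrease to the empty set. The choice of [j] is uniform in
    [n]. *)
Lemma hasty_rare (m j0 : nat) (e : R) : 0 < e -> exists2 j, (j0 <= j)%N &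
  forall n, (j <= n)%N -> (P' (hasty_event m j n) <= e%:E)%E.
Proof.
move=> e0.
pose T J : set W' := \bigcup_(j in [set j | (J <= j)%N]) \bigcup_(n in [set n | (j <= n)%N]) hasty_event m j n.
have mT J : measurable (T J).
  by apply: bigcup_measurable => j _; apply: bigcup_measurable => n _; exact: hasty_event_measurable.
have T0 : \bigcap_J T J = set0.
  apply/seteqP; split => // w Tw; have [J0 hJ] := never_hasty m (cY w).
  by have [j Jj [n jn]] := Tw J0 I; have := hJ j Jj n jn => /negP h /h.
have := @nonincreasing_cvg_mu _ _ _ P' T.
rewrite T0 measure0 => cv.
have /fine_cvgP[_ /cvgrPdist_le /(_ e e0) [J1 _ hJ1]] : P' (T n) @[n --> \oo] --> (0%:E)%E.
  apply: cv => //.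
  - by apply: (le_lt_trans (probability_le1 P' (mT 0%N))); rewrite ltry.
  - move=> J J' JJ'; apply/subsetPset => w [j J'j [n jn h]].
    by exists j; [exact: leq_trans J'j|exists n].
have hT : `|0 - fine (P' (T (maxn j0 J1)))| <= e by apply: hJ1; rewrite /= leq_maxr.
exists (maxn j0 J1); rewrite ?leq_maxl// => n jn.
apply: (@le_trans _ _ (P' (T (maxn j0 J1)))).
  apply: le_measure; rewrite ?inE//; first exact: hasty_event_measurable.
  by move=> w hw; exists (maxn j0 J1); [exact: leqnn|exists n].
rewrite -[X in (X <= _)%E]fineK; last exact: fin_num_measure.
by move: hT; rewrite sub0r normrN lee_fin => /(le_trans (ler_norm _)).
Qed.

Variable q : nat -> E -> E -> R.
Hypothesis sq : forall n, stochastic (q n).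
Hypothesis mq : forall n, discrete_markov P' (q n) y0 (Zy n).

(** [X] is almost surely the limit of Markov chains with time step [4 ^- n],
    whose kernels differ from those of [Y] by [kappa] per unit of time. Nothing
    is assumed on the measurability of [X]. *)
Definition approximated d (W : measurableType d) (P : probability W R) (X : W -> R -> E)
    (kappa : R) : Prop := exists (K : nat -> E -> E -> R) (Z : nat -> W -> nat -> E),
  [/\ exists n0, forall n, (n0 <= n)%N -> stochastic (K n) /\ discrete_markov P (K n) y0 (Z n),
      {ae P, forall w, cadlag (X w) /\ samples (fun n => Z n w) (X w)}
    & forall e, 0 < e -> exists n0, forall n, (n0 <= n)%N -> forall x,
        \sum_y `|K n x y - q n x y| <= dyadic n * (kappa + e)].

(** [Y] can be treated in the same way as the processes that converge to it. *)
Lemma approximated_self : approximated P' Y 0.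
Proof.
exists q, (fun n => Zy n); split.
- by exists 0%N => n _; split.
- by apply: aeW => w; split => //; exact: samples_self.
- move=> e e0; exists 0%N => n _ x; rewrite big1 ?add0r ?mulr_ge0 ?ltW// ?dyadic_gt0//.
  by move=> y _; rewrite subrr normr0.
Qed.

Section Fixed.
Variables (F : (R -> E) -> R) (C : R).
Hypothesis C0 : 0 <= C.
Hypothesis FC : forall x, `|F x| <= C.
Variables (m j : nat) (delta : R).
Hypothesis rare : forall n, (j <= n)%N -> (P' (hasty_event m j n) <= delta%:E)%E.
Local Notation dj := (mesh j).
Local Notation cells := (m * 2 ^ j)%N.

Definition upper_mean : R := \int[P']_w envelope F dj cells (grid_values dj cells (Y w)).

Lemma measurable_envelope : measurable_fun setT (fun w => envelope F dj cells (grid_values dj cells (Y w))).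
Proof.
exact: (measurable_fun_mkseq _ (envelope F dj cells) (grid_process (ltW (mesh_gt0 j)))).
Qed.

(** As [n] tends to infinity the samples of [Y] become its values on the coarse
    grid; the term with [delta] is due to hasty samples. *)
Lemma upper_value_limit (e : R) : 0 < e -> exists n0, forall n, (n0 <= n)%N ->
  (\int[P']_w (upper_value y0 F C dj cells n (mkseq (Zy n w) (sample_size dj cells n).+1))%:E <=
    (upper_mean + C + 2 * C * delta + e)%:E)%E.
Proof.
move=> e0.
pose env n w := envelope F dj cells (grid_sample y0 dj cells n (mkseq (Zy n w) (sample_size dj cells n).+1)).
have mZ n : discrete_process (Zy n) by apply: grid_process; rewrite ltW// dyadic_gt0.
have menv n : measurable_fun setT (env n).
  exact: (measurable_fun_mkseq _ (fun l => envelope F dj cells (grid_sample y0 dj cells n l)) (mZ n)).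
have envC n w : `|env n w| <= C by exact: envelope_bound.
have cv : \int[P']_w env n w @[n --> \oo] --> upper_mean.
  apply: (bounded_convergence (C := C)) => //; first exact: measurable_envelope.
    by move=> w; exact: envelope_bound.
  move=> w; have [n0 hn] := samples_grid y0 cells (mesh_gt0 j) (samples_self (cY w)).
  apply: cvg_near_cst; exists n0 => // n /= /hn h.
  by rewrite /env -[in RHS]h.
have /cvgrPdist_le/(_ e e0)[n1 _ hn1] := cv.
exists (maxn j n1) => n; rewrite geq_max => /andP[jn /hn1 /=].
rewrite ler_norml => /andP[h1 _].
have mup : measurable_fun setT (fun w => upper_value y0 F C dj cells n (mkseq (Zy n w) (sample_size dj cells n).+1)).
  exact: (measurable_fun_mkseq _ (upper_value y0 F C dj cells n) (mZ n)).
have mA := hasty_event_measurable m j n; set A := hasty_event m j n in mA.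
have i1 : P'.-integrable setT (EFin \o (fun w => env n w + C)).
  apply: (@bounded_integrable _ _ _ _ _ (C + C)); first exact: measurable_funD.
  by move=> w; rewrite (le_trans (ler_normD _ _))// lerD// ger0_norm.
have i2 : P'.-integrable setT (EFin \o (fun w => 2 * C * \1_A w)).
  apply: (@bounded_integrable _ _ _ _ _ (2 * C)); first exact: measurable_funM.
  by move=> w; rewrite indicE; case: (w \in A); rewrite ?mulr1 ?mulr0 ?normr0 ?ger0_norm// mulr_ge0.
apply: (@le_trans _ _ (\int[P']_w ((env n w + C) + 2 * C * \1_A w)%:E)%E).
  apply: ge0_le_integral => //.
  - by move=> w _; rewrite lee_fin; have /andP[] := upper_value_bound y0 C0 FC dj cells n (mkseq (Zy n w) (sample_size dj cells n).+1).
  - exact/measurable_EFinP.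
  - apply/measurable_EFinP; apply: measurable_funD; last exact: measurable_funM.
    exact: measurable_funD.
  - move=> w _; rewrite lee_fin /upper_value; case: ifPn => hh.
      rewrite indicE mem_set// mulr1; have := envC n w; rewrite ler_norml => /andP[h2 _].
      by lra.
    by rewrite indicE memNset ?mulr0 ?addr0//; exact/negP.
rewrite (integralD_EFin _ i1 i2)//.
have i3 : P'.-integrable setT (EFin \o (\1_A : W' -> R)).
  apply: (@bounded_integrable _ _ _ _ _ 1) => // w.
  by rewrite indicE; case: (w \in A); rewrite ?normr0 ?normr1.
have i4 : P'.-integrable setT (EFin \o env n) by exact: bounded_integrable (envC n).
have i5 : P'.-integrable setT (EFin \o (cst C : W' -> R)) by exact: finite_measure_integrable_cst.
rewrite (integral_Rintegral i1) (integral_Rintegral i2) -EFinD lee_fin.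
rewrite RintegralD// Rintegral_cst// RintegralZl//.
rewrite [X in fine X](probability_setT P') mulr1.
have -> : \int[P']_w \1_A w = fine (P' A) by rewrite /Rintegral integral_indic// setIT.
have PA : fine (P' A) <= delta.
  by rewrite -lee_fin fineK ?fin_num_measure//; exact: rare.
have : 2 * C * fine (P' A) <= 2 * C * delta by apply: ler_wpM2l => //; rewrite mulr_ge0.
by lra.
Qed.

(** By Fatou's lemma, the mean of [F] over [X] is at most the inferior limit of
    the mean of the upper values of the approximating chains. As these depend
    on at most [(m + 1) 4 ^ n] steps, exchanging [X] for [Y] changes them by at
    most [2 C (m + 1) kappa], uniformly in [n]. *)
Lemma sandwich d (W : measurableType d) (P : probability W R) (X : W -> R -> E) (kappa : R) :
  0 <= kappa -> approximated P X kappa ->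
  \int[P]_w F (X w) <= upper_mean + 2 * C * delta + 2 * C * (m%:R + 1) * kappa.
Proof.
move=> k0 [K [Z [[n1 hn1] aeX tv]]]; apply/ler_addgt0Pr => e e0.
(* half of the tolerance e goes to the kernels, half to the limit in n *)
pose e1 := e / (4 * (C + 1) * (m%:R + 1)).
have m1 : 0 < m%:R + 1 :> R by rewrite ltr_wpDl.
have C1 : 0 < C + 1 by rewrite ltr_wpDl.
have e10 : 0 < e1 by rewrite divr_gt0// !mulr_gt0.
have e1e : 2 * C * (m%:R + 1) * e1 <= e / 2.
  have : 4 * (C + 1) * (m%:R + 1) * e1 = e by rewrite /e1 mulrC divfK// !mulf_neq0// gt_eqF.
  have : 0 <= (m%:R + 1) * e1 by rewrite ltW// mulr_gt0.
  by lra.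
have [n2 hn2] := upper_value_limit (divr_gt0 e0 (ltr0n R 2)).
have [n3 hn3] := tv _ e10.
pose n0 := maxn n1 (maxn n2 n3).
have upb n l : 0 <= upper_value y0 F C dj cells n l <= 2 * C by exact: upper_value_bound.
pose g n w := upper_value y0 F C dj cells (n0 + n) (mkseq (Z (n0 + n)%N w) (sample_size dj cells (n0 + n)).+1).
have N0 n : [/\ (n1 <= n0 + n)%N, (n2 <= n0 + n)%N & (n3 <= n0 + n)%N].
  by split; apply: leq_trans (leq_addr _ _); rewrite !leq_max leqnn ?orbT.
apply: (Rintegral_fatou (g := g) (C := C)) => //.
- move=> n; have [h1 _ _] := N0 n; have [_ [mZ _]] := hn1 _ h1.
  exact: (measurable_fun_mkseq _ (upper_value y0 F C dj cells (n0 + n)) mZ).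
- by move=> n w; exact: upb.
- apply: filterS aeX => w [cX sX].
  have [n4 hn4] := upper_value_ge y0 FC cells (mesh_gt0 j) cX sX.
  by exists n4 => n nn; apply: hn4; exact: leq_trans (leq_addl _ _).
exists 0%N => n _; have [h1 h2 h3] := N0 n; set n' := (n0 + n)%N in h1 h2 h3.
have [sK mK] := hn1 _ h1.
have h2' := hn2 _ h2.
rewrite /g -/n' (markov_expectation _ mK); last by move=> l; have /andP[] := upb n' l.
rewrite (markov_expectation _ (mq n')) in h2'; last by move=> l; have /andP[] := upb n' l.
rewrite lee_fin in h2'; rewrite lee_fin.
have upC l : `|upper_value y0 F C dj cells n' l| <= 2 * C.
  by have /andP[a1 a2] := upb n' l; rewrite ger0_norm.
have := path_exp_tv (sample_size dj cells n') y0 sK (sq n') upC (hn3 _ h3).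
rewrite ler_norml => /andP[_ h4].
have h5 : (sample_size dj cells n')%:R * dyadic n' <= m%:R + 1.
  have p0 : 0 <= cells%:R * dj by rewrite mulr_ge0// ltW// mesh_gt0.
  have /andP[_] := visit_index_time n' p0; rewrite mesh_cells.
  by have := mesh_le1 n'; rewrite /mesh; rewrite /sample_size /grid_index mesh_cells /dyadic; lra.
have h6 : (sample_size dj cells n')%:R * dyadic n' * (kappa + e1) * (2 * C) <= (m%:R + 1) * (kappa + e1) * (2 * C).
  by apply: ler_wpM2r; [rewrite mulr_ge0|apply: ler_wpM2r; [rewrite addr_ge0// ltW|]].
by move: h4 h6; rewrite !mulrA; lra.
Qed.

End Fixed.

(** The sum is the oscillation of [F] over the slow paths with the same grid
    values as [y]. Nearly optimal paths for [F] and for [- F] both converge to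
    [y], so continuity of [F] at [y] makes it vanish. *)
Lemma envelope_gap (F : (R -> E) -> R) (C : R) (j : nat -> nat) (y : R -> E) :
  0 <= C -> (forall x, `|F x| <= C) -> skorohod_continuous F -> cadlag y -> (forall m, (m <= j m)%N) ->
  let e m G := envelope G (mesh (j m)) (m * 2 ^ j m) (grid_values (mesh (j m)) (m * 2 ^ j m) y) in
  e m F + e m (fun x => - F x) @[m --> \oo] --> (0 : R).
Proof.
move=> C0 FC cF cy jm e.
have FC' x : `|- F x| <= C by rewrite normrN.
pose tol m : R := (m.+1%:R)^-1.
have tol0 m : 0 < tol m by rewrite invr_gt0.
pose cls m z := slow_path (mesh (j m)) (m * 2 ^ j m) z /\
  grid_values (mesh (j m)) (m * 2 ^ j m) z = grid_values (mesh (j m)) (m * 2 ^ j m) y.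
have near_opt G m : (forall x, `|G x| <= C) -> (exists z, cls m z) -> exists z, cls m z /\ e m G - tol m <= G z.
  move=> GC [z0 cz0].
  have hs : has_sup [set G z | z in [set z | cls m z]].
    split; first by exists (G z0), z0.
    by exists C => _ [u _ <-]; have := GC u; rewrite ler_norml => /andP[].
  have [_ [z cz <-] h] := sup_adherent (tol0 m) hs.
  by exists z; split => //; exact: ltW.
have /choice[z hz] m : exists z : (R -> E) * (R -> E),
    [/\ z.1 = y \/ cls m z.1, z.2 = y \/ cls m z.2, cadlag z.1, cadlag z.2 &
      0 <= e m F + e m (fun x => - F x) <= F z.1 - F z.2 + 2 * tol m].
  have [ex|nex] := pselect (exists z, cls m z); last first.
    exists (y, y); split => //=; try by left.
    have e0 G : e m G = 0.
      rewrite /e /envelope sup_out// => -[[_ [z cz _]] _].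
      by apply: nex; exists z.
    by rewrite !e0 subrr !add0r lexx mulr_ge0// ltW.
  have [z1 [c1 h1]] := near_opt F m FC ex.
  have [z2 [c2 h2]] := near_opt _ m FC' ex.
  exists (z1, z2); split => /=; [by right|by right|by have [[]] := c1|by have [[]] := c2|].
  have g1 : F z1 <= e m F by have := envelope_ge FC c1.1; rewrite c1.2.
  have g2 : - F z1 <= e m (fun x => - F x) by have := envelope_ge FC' c1.1; rewrite c1.2.
  by apply/andP; split; lra.
have sk (u : nat -> R -> E) : (forall m, u m = y \/ cls m (u m)) -> (forall m, cadlag (u m)) -> skorohod_cvg u y.
  move=> hu cu; apply: (close_skorohod_cvg (d := fun m => mesh (j m)) (G := fun m => m%:R)) => //.
  - by move=> m; exact: mesh_gt0.
  - apply/cvgrPdist_lt => t t0; have [j0 hj] := mesh_small t0.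
    exists j0 => // m /= mj; rewrite sub0r normrN ger0_norm ?ltW ?mesh_gt0//.
    by apply: hj; exact: leq_trans (jm m).
  - move=> T; exists (Num.truncn `|T|).+1 => // m /= mT.
    apply: (le_trans (ler_norm _)); apply: (le_trans (ltW (truncnS_gt _))).
    by rewrite ler_nat.
  - move=> m; have [->|[su gu]] := hu m; [by left|right].
    move=> i; rewrite -(mesh_cells m (j m)) ler_pM2r ?mesh_gt0// ler_nat => iI.
    have gE k : (k <= m * 2 ^ j m)%N -> u m (k%:R * mesh (j m)) = y (k%:R * mesh (j m)).
      by move=> kI; have := congr1 (nth y0 ^~ k) gu; rewrite !nth_mkseq.
    by split; [apply: gE; exact: ltnW|exact: gE|exact: su.2].
have c1 : F (z m).1 @[m --> \oo] --> F y.
  by apply: cF => [m|//|]; [have [] := hz m|apply: sk => m; have [] := hz m].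
have c2 : F (z m).2 @[m --> \oo] --> F y.
  by apply: cF => [m|//|]; [have [] := hz m|apply: sk => m; have [] := hz m].
have c3 : tol m @[m --> \oo] --> (0 : R) by exact: cvg_harmonic.
apply: (@squeeze_cvgr _ _ _ _ (cst 0) (fun m => F (z m).1 - F (z m).2 + 2 * tol m)).
- by apply: nearW => m; have [] := hz m.
- exact: cvg_cst.
- rewrite (_ : 0 = F y - F y + 2 * 0); last by rewrite mulr0 subrr addr0.
  by apply: cvgD; [exact: cvgB|apply: cvgM; [exact: cvg_cst|]].
Qed.

(** [sandwich] for [F] and [- F] bounds the mean over [X] from both sides, and,
    with [kappa = 0], the mean over [Y]. By [envelope_gap] the bounds are close
    to each other for a fine grid, which is chosen first; then [kappa] is small
    compared with the horizon [m] of that grid. *)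
Theorem law_approximation (F : (R -> E) -> R) (e : R) :
  (exists C, forall x, `|F x| <= C) -> skorohod_continuous F -> 0 < e ->
  exists2 k0, 0 < k0 & forall d (W : measurableType d) (P : probability W R) (X : W -> R -> E) k,
    0 <= k <= k0 -> approximated P X k -> `|\int[P]_w F (X w) - \int[P']_w F (Y w)| <= e.
Proof.
move=> [C FC] cF e0.
have C0 : 0 <= C by apply: le_trans (normr_ge0 _) (FC (fun=> y0)).
have FC' x : `|- F x| <= C by rewrite normrN.
have /choice[j hj] m : exists jm, (m <= jm)%N /\ forall n, (jm <= n)%N -> (P' (hasty_event m jm n) <= (m.+1%:R^-1)%:E)%E.
  by have [|jm h1 h2] := @hasty_rare m m (m.+1%:R^-1) _; [rewrite invr_gt0|exists jm].
pose U m G := upper_mean G m (j m).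
have gap : U m F + U m (fun x => - F x) @[m --> \oo] --> (0 : R).
  pose D m w := envelope F (mesh (j m)) (m * 2 ^ j m) (grid_values (mesh (j m)) (m * 2 ^ j m) (Y w)) +
    envelope (fun x => - F x) (mesh (j m)) (m * 2 ^ j m) (grid_values (mesh (j m)) (m * 2 ^ j m) (Y w)).
  have mD m : measurable_fun setT (D m) by apply: measurable_funD; exact: measurable_envelope.
  have -> : (fun m => U m F + U m (fun x => - F x)) = (fun m => \int[P']_w D m w).
    apply/funext => m; rewrite /U /upper_mean /D RintegralD//.
      by apply: (@bounded_integrable _ _ _ _ _ C); [exact: measurable_envelope|move=> w; exact: envelope_bound].
    by apply: (@bounded_integrable _ _ _ _ _ C); [exact: measurable_envelope|move=> w; exact: envelope_bound].
  rewrite (_ : 0 = \int[P']_w (cst 0 w)); last by rewrite Rintegral_cst// mul0r.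
  apply: (bounded_convergence (C := C + C)) => //.
  - move=> m w; rewrite (le_trans (ler_normD _ _))// lerD//; exact: envelope_bound.
  - by move=> w; rewrite normr0 addr_ge0.
  - by move=> w; exact: (envelope_gap C0 FC cF (cY w) (fun m => (hj m).1)).
have e4 : 0 < e / 4 by rewrite divr_gt0.
have tol : (4 * C) * m.+1%:R^-1 @[m --> \oo] --> (0 : R).
  by rewrite -[X in _ --> X](mulr0 (4 * C)); apply: cvgM; [exact: cvg_cst|exact: cvg_harmonic].
have [m [hm1 hm2]] : exists m, U m F + U m (fun x => - F x) <= e / 4 /\ 4 * C * m.+1%:R^-1 <= e / 4.
  have /cvgrPdist_le/(_ _ e4)[m1 _ h1] := gap.
  have /cvgrPdist_le/(_ _ e4)[m2 _ h2] := tol.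
  exists (maxn m1 m2); split.
    have := h1 (maxn m1 m2) (leq_maxl _ _); rewrite /= sub0r normrN; exact: le_trans (ler_norm _).
  have := h2 (maxn m1 m2) (leq_maxr _ _); rewrite /= sub0r normrN; exact: le_trans (ler_norm _).
have [_ rare] := hj m.
have m1 : 0 < m%:R + 1 :> R by rewrite ltr_wpDl.
have C1 : 0 < C + 1 by rewrite ltr_wpDl.
exists (e / (4 * (C + 1) * (m%:R + 1))); first by rewrite divr_gt0// !mulr_gt0.
move=> d W P X k /andP[k0 kk] aX.
have ke : 2 * C * (m%:R + 1) * k <= e / 2.
  have : k * (4 * (C + 1) * (m%:R + 1)) <= e by rewrite -ler_pdivlMr// !mulr_gt0.
  have : 0 <= (m%:R + 1) * k by rewrite mulr_ge0// ltW.
  by lra.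
have s1 := sandwich C0 FC rare k0 aX.
have s2 := sandwich C0 FC' rare k0 aX.
have s3 := sandwich C0 FC rare (lexx 0) approximated_self.
have s4 := sandwich C0 FC' rare (lexx 0) approximated_self.
rewrite (RintegralN_bounded _ (C := C)) in s2; last by move=> w; exact: FC.
rewrite (RintegralN_bounded _ (C := C)) in s4; last by move=> w; exact: FC.
rewrite mulr0 addr0 in s3 s4.
have e2 : 4 * C / m.+1%:R = 2 * (2 * C / m.+1%:R) by ring.
rewrite e2 in hm2; move: hm1 hm2 s1 s2 s3 s4 ke; rewrite /U ler_norml.
set u1 := upper_mean _ _ _; set u2 := upper_mean _ _ _; set v := 2 * C / _; set a := 2 * C * _ * _.
set i1 := Rintegral _ _ _; set i2 := Rintegral _ _ _ => hm1 hm2 s1 s2 s3 s4 ke.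
by apply/andP; split; lra.
Qed.

End Sandwich.

Lemma dyadic_near {R : realType} (A : R -> Prop) (c : R) : 0 < c ->
  (\forall h \near 0^'+, A h)%classic ->
  exists n0, forall n, (n0 <= n)%N -> A (c / 4 ^+ n).
Proof.
move=> c0 /nbhs_right_ex[e e0 hA].
apply: (@pow4_near R (fun h => A (c * h))).
apply: (@near_rightI _ _ _ (e / c)); first by rewrite divr_gt0.
move=> h /andP[h0 he]; apply: hA.
by rewrite mulr_gt0//= add0r mulrC -ltr_pdivlMr// -[ltRHS]add0r.
Qed.

(** * Convergence of the trace *)

Section TraceIsApproximated.
Context {R : realType} {E : finType} d (W : measurableType d) (P : probability W R).
Local Open Scope classical_set_scope.
Local Open Scope ring_scope.

(** The trace chains of the skeletons of [X] with time step [c / 4 ^ n]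
    approximate the trace of [X] speeded up by [c]. Both kernels are known up
    to [o (4 ^- n)]. *)
Lemma trace_approximated (L : (E -> R) -> E -> R) (S : {set E}) (e0 : {x : E | x \in S})
    (X : W -> R -> E) (phi : E -> R) (H : E -> E -> R)
    (G : ({x : E | x \in S} -> R) -> {x : E | x \in S} -> R) q (c kappa : R) :
  markov_chain P L (val e0) X -> (forall x, 0 <= phi x) ->
  (forall x, x \notin S -> L phi x <= -1) ->
  (forall x j, x \in S -> H x j = (x == j)%:R) ->
  (forall x j, x \notin S -> L (H ^~ j) x = 0) ->
  transition_function G q -> 0 < c ->
  (forall x : {x : E | x \in S}, \sum_(y : {x : E | x \in S}) `|c * L (H ^~ (val y)) (val x) - G (fun z => (z == y)%:R) x| <= kappa) ->
  approximated e0 (fun n => q (dyadic n)) P (fun w t => trace_path e0 (X w) (c * t)) kappa.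
Proof.
move=> mX phi0 Lphi HS LH tq c0 hk.
have [p tp mZ] := skeleton_markov mX.
have h0 n : 0 < c / 4 ^+ n by rewrite divr_gt0// exprn_gt0.
exists (fun n => trace_kernel (p (c / 4 ^+ n))),
  (fun n w => trace_chain e0 (fun i : nat => X w (i%:R * (c / 4 ^+ n)))); split.
- have [n0 hn0] := dyadic_near c0 (potential_near tp Lphi).
  exists n0 => n /hn0 hphi.
  have sp := transition_stochastic tp (ltW (h0 n)).
  have a0 : 0 < c / 4 ^+ n / 2 by rewrite divr_gt0.
  split; first exact: (trace_kernel_stochastic sp phi0 a0 hphi).
  exact: (trace_chain_markov sp phi0 a0 hphi (mZ _ (ltW (h0 n)))).
- apply: filterS (trace_approx_ae phi0 Lphi mX c0) => w [cX sX]; split; [exact: cX|exact: sX].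
- move=> e epos.
  pose m : R := #|{: {x : E | x \in S}}|%:R + 1.
  have m0 : 0 < m by rewrite ltr_wpDl.
  have e1 : 0 < e / (2 * m * c) by rewrite divr_gt0// !mulr_gt0.
  have e2 : 0 < e / (2 * m) by rewrite divr_gt0// !mulr_gt0.
  have [n1 hn1] := dyadic_near c0 (trace_kernel_near tp phi0 Lphi HS LH e1).
  have [n2 hn2] : exists n2, forall n, (n2 <= n)%N -> forall y x,
    `|\sum_z q (dyadic n) x z * (z == y)%:R - (x == y)%:R - dyadic n * G (fun z => (z == y)%:R) x|
      <= e / (2 * m) * dyadic n.
    apply: (@pow4_near _ (fun h : R => forall y x, `|\sum_z q h x z * (z == y)%:R -
       (x == y)%:R - h * G (fun z => (z == y)%:R) x| <= e / (2 * m) * h)).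
    by apply: filter_forall => y; exact: (transition_near tq).
  exists (maxn n1 n2) => n; rewrite geq_max => /andP[/hn1 k1 /hn2 k2] x.
  have d0 := dyadic_gt0 (R := R) n.
  have cd : c / 4 ^+ n = c * dyadic n by [].
  have bnd y : `|trace_kernel (p (c / 4 ^+ n)) x y - q (dyadic n) x y| <=
      dyadic n * `|c * L (H ^~ (val y)) (val x) - G (fun z => (z == y)%:R) x| + dyadic n * (e / m).
    have := k1 x y; have := k2 y x.
    have -> : \sum_z q (dyadic n) x z * (z == y)%:R = q (dyadic n) x y.
      rewrite (bigD1 y)//= eqxx mulr1 big1 ?addr0// => z /negbTE ->.
      by rewrite mulr0.
    rewrite cd; set a := trace_kernel _ _ _; set b := q _ _ _; set l := L _ _; set g := G _ _.
    have -> : e / (2 * m * c) * (c * dyadic n) = dyadic n * (e / m) / 2 by field; rewrite !gt_eqF.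
    have -> : e / (2 * m) * dyadic n = dyadic n * (e / m) / 2 by field; rewrite !gt_eqF.
    set u := dyadic n * (e / m); set D := (x == y)%:R => h2 h1.
    have -> : dyadic n * `|c * l - g| = `|dyadic n * (c * l - g)| by rewrite normrM (ger0_norm (ltW d0)).
    have -> : a - b = (a - D - c * dyadic n * l) - (b - D - dyadic n * g) + dyadic n * (c * l - g) by ring.
    apply: (le_trans (ler_normD _ _)); rewrite addrC lerD2l.
    by apply: (le_trans (ler_normB _ _)); lra.
  apply: (le_trans (ler_sum _ (fun y _ => bnd y))).
  rewrite big_split/= -mulr_sumr mulrDr; apply: lerD.
    by rewrite ler_pM2l//; exact: hk.
  rewrite sumr_const -mulrnAr ler_pM2l// -mulr_natr.
  rewrite mulrAC ler_pdivrMr// ler_pM2l// /m.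
  by rewrite lerDl.
Qed.

End TraceIsApproximated.

Section LimitRates.
Context {R : realType} {N : nat} {K : species -> nat}.
Hypothesis hK : (K A + K B + K C)%N = (N.*2).+1.
Hypothesis K3 : forall a, (2 < K a)%N.
Variable r : site N -> site N -> R.
Local Notation seg_config := {w | w \in segregated_set hK}.

Lemma seg_state_inj : injective (@seg_state N K hK).
Proof. by move=> i j /(congr1 val) /=; exact: segregated_inj. Qed.

Lemma seg_state_surj (x : seg_config) : exists i, x = seg_state hK i.
Proof.
have /imsetP[i _ e] := valP x; exists i; exact: val_inj.
Qed.

Lemma seg_generator_delta i j : seg_generator r (fun z => (z == seg_state hK j)%:R) (seg_state hK i) =
  if i == j then - \sum_(l | l != i) r i l else r i j.
Proof.
rewrite /seg_generator (big_pred1 i); last by move=> l; rewrite (inj_eq seg_state_inj).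
rewrite (inj_eq seg_state_inj); have [<-|ij] := eqVneq i j.
  rewrite -sumrN; apply: eq_bigr => l /negbTE li.
  by rewrite (inj_eq seg_state_inj) li sub0r mulrN1.
rewrite (bigD1 j) 1?eq_sym//= eqxx subr0 mulr1 big1 ?addr0// => l /andP[_ /negbTE lj].
by rewrite (inj_eq seg_state_inj) lj subr0 mulr0.
Qed.

Lemma seg_sum (f : config N K -> R) : (forall y, y \notin segregated_set hK -> f y = 0) ->
  \sum_y f y = \sum_l f (segregated hK l).
Proof.
move=> f0; rewrite (bigID (mem (segregated_set hK)))/= [X in _ + X]big1// addr0.
rewrite /segregated_set big_imset//=.
by move=> i j _ _; exact: (segregated_inj K3).
Qed.

Variables (H : R -> config N K -> config N K -> R) (phi : R -> config N K -> R).
Hypothesis hH : harmonic_extension (@swap N K) (@jump_rate N K R) (segregated_set hK) H phi.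
Let trace_rate b i j := gen (@swap N K) (jump_rate b) (H b ^~ (segregated hK j)) (segregated hK i).

(** The hitting probabilities add up to 1, so the rates [trace_rate b i l] add
    up to 0 over [l]. *)
Lemma trace_rate_diag b i : trace_rate b i i = - \sum_(l | l != i) trace_rate b i l.
Proof.
have /eqP : \sum_l trace_rate b i l = 0.
  rewrite /trace_rate -(seg_sum (f := fun y => gen (@swap N K) (jump_rate b) (H b ^~ y) (segregated hK i))); last first.
    move=> y yS; rewrite -[RHS](generator_cst (@swap N K) (jump_rate b) 0 (segregated hK i)).
    by congr gen; apply/funext => z; rewrite (hext_out hH).
  rewrite -[RHS](generator_cst (@swap N K) (jump_rate b) 1 (segregated hK i)).
  under eq_bigr do rewrite -[gen _ _ _ _]mul1r.
  rewrite -(generator_lin _ _ (fun=> 1)); congr gen; apply/funext => z.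
  by under eq_bigr do rewrite mul1r; exact: (hext_sum hH).
by rewrite (bigD1 i)//= addr_eq0 => /eqP.
Qed.

(** Distance between the generators of the speeded up trace and of the limit
    process. *)
Definition deviation b : R := \sum_(x : seg_config) \sum_(y : seg_config)
  `|expR ((@min_count K)%:R * b) * gen (@swap N K) (jump_rate b) (H b ^~ (val y)) (val x) -
    seg_generator r (fun z => (z == y)%:R) x|.

Hypothesis hr : forall i j, i != j ->
  (expR ((@min_count K)%:R * b) * trace_rate b i j @[b --> +oo] --> r i j)%classic.

Lemma deviation_cvg0 : (deviation b @[b --> +oo] --> (0 : R))%classic.
Proof.
have term i j : (expR ((@min_count K)%:R * b) * trace_rate b i j -
    seg_generator r (fun z => (z == seg_state hK j)%:R) (seg_state hK i) @[b --> +oo] --> (0 : R))%classic.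
  rewrite -[X in (_ --> X)%classic](subrr (seg_generator r (fun z => (z == seg_state hK j)%:R) (seg_state hK i))).
  apply: cvgB; last exact: cvg_cst.
  rewrite seg_generator_delta; have [<-|ij] := eqVneq i j; last exact: hr.
  rewrite (_ : (fun b => _) = (fun b => - \sum_(l | l != i) expR ((@min_count K)%:R * b) * trace_rate b i l)).
    apply: cvgN; rewrite big_mkcond; under eq_fun do rewrite big_mkcond.
    apply: cvg_bigsum => l; case: ifP => [li|_]; last exact: cvg_cst.
    by apply: hr; rewrite eq_sym.
  by apply/funext => b; rewrite trace_rate_diag mulrN mulr_sumr.
rewrite /deviation -[X in (_ --> X)%classic](_ : \sum_(x : seg_config) \sum_(y : seg_config) `|0 : R| = 0); last first.
  by rewrite big1// => x _; rewrite big1// => y _; rewrite normr0.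
apply: cvg_bigsum => x; apply: cvg_bigsum => y; apply: cvg_norm.
have [i ->] := seg_state_surj x; have [j ->] := seg_state_surj y.
exact: term.
Qed.

End LimitRates.

Theorem theorem2p5 (R : realType) (N : nat) (K : species -> nat)
    (hK3 : forall a, (3 <= K a)%N)
    (hK : (K A + K B + K C)%N = (N.*2).+1) :
  let M := minn (K A) (minn (K B) (K C)) in
  exists r : site N -> site N -> R,
    (forall i j, i != j -> 0 < r i j) /\
    forall (k : site N)
      (d : R -> measure_display) (W : forall b, measurableType (d b))
      (P : forall b, probability (W b) R)
      (eta : forall b, W b -> R -> config N K)
      (d' : measure_display) (W' : measurableType d')
      (P' : probability W' R) (Y : W' -> R -> {w | w \in segregated_set hK}),
    (forall b, markov_chain (P b) (abc_generator b) (segregated hK k) (eta b)) ->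
    markov_chain P' (seg_generator r) (seg_state hK k) Y ->
    cvg_in_law P
      (fun b w t => trace_path (seg_state hK k) (eta b w) (expR (M%:R * b) * t))
      P' Y.
Proof.
move=> M; have [H [phi [r [hH r0 hr]]]] := @trace_rates R N K hK hK3.
exists r; split=> // k d W P eta d' W' P' Y meta mY F bF cF.
have [mYt cY _] := mY; have [q tq mq] := skeleton_markov mY.
have sq n : stochastic (q (dyadic n)) by apply: (transition_stochastic tq); rewrite ltW// dyadic_gt0.
have mq' n := mq _ (ltW (dyadic_gt0 (R := R) n)).
apply/cvgrPdist_le => e e0.
have [k0 k0pos hk0] := law_approximation cY (fun t e => mYt t e) sq mq' bF cF e0.
have /cvgrPdist_le/(_ _ k0pos) := deviation_cvg0 hK3 hH hr.
apply: filterS => b; rewrite sub0r normrN => hb.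
have app : approximated (seg_state hK k) (fun n => q (dyadic n)) (P b)
    (fun w t => trace_path (seg_state hK k) (eta b w) (expR (M%:R * b) * t)) (deviation hK r H b).
  apply: (@trace_approximated R _ _ _ (P b) (abc_generator b) _ (seg_state hK k) (eta b)
    (phi b) (H b) _ q (expR (M%:R * b)) _ (meta b) _ _ _ _ tq).
  - exact: (hext_phi_ge0 hH).
  - by move=> x; exact: (hext_phi hH).
  - by move=> x j; exact: (hext_in hH).
  - by move=> x j; exact: (hext_harm hH).
  - exact: expR_gt0.
  - move=> x; rewrite /deviation [leRHS](bigD1 x)//= lerDl.
    by apply: sumr_ge0 => z _; apply: sumr_ge0 => y _.
rewrite distrC; apply: (hk0 _ _ _ _ _ _ app).
rewrite (le_trans (ler_norm _) hb) andbT.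
by apply: sumr_ge0 => x _; apply: sumr_ge0 => y _.
Qed.
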